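(* Suppose that $\Lambda\prec\Psi$ for some admissible control parameter $\Psi$, that $\Delta$ is an admissible graph, and that $w$ is a weight adapted to $\Delta$. Then for all $F\subset V_s(\Delta)$ and all $\boldsymbol\mu\in\{1,\dots,N\}^{V_e(\Delta)}$ we have $$X_F^{w,\boldsymbol\mu}(\Delta)\;\prec\;\Psi^{\deg(\Delta)+|F|}.$$
   Context: **Random matrix.** For each $N\in\mathbb N$ let $(h_{ij} : 1\le i\le j\le N)$ be independent complex random variables (depending on $N$) with $\mathbb E h_{ij}=0$ and $h_{ii}\in\mathbb R$; set $h_{ij}=\overline{h_{ji}}$ for $i>j$, so $H=(h_{ij})$ is an $N\times N$ Hermitian matrix. Let $s_{ij}=\mathbb E|h_{ij}|^2$, $M=M_N=1/\max_{i,j}s_{ij}$. Assume $\sum_j s_{ij}=1$ for all $i$, and $N^\delta\le M\le N$ for some fixed $\delta>0$. Let $\zeta_{ij}=s_{ij}^{-1/2}h_{ij}$ (a normalized Gaussian if $s_{ij}=0$); assume that for every $p\in\mathbb N$ there is a constant $\kappa_p$ with $\mathbb E|\zeta_{ij}|^p\le\kappa_p$ for all $N,i,j$. **Resolvent.** For $z=E+\mathrm i\eta$, $\eta>0$: $m=m(z)=\frac1{2\pi}\int_{-2}^2\frac{\sqrt{4-\xi^2}}{\xi-z}\,d\xi$, $G=G(z)=(H-z)^{-1}$, $G^*=(G(z))^*$, $\mathcal G_{ij}=G_{ij}-\delta_{ij}m$, $\mathcal G^*_{ij}=G^*_{ij}-\delta_{ij}\bar m$. Fix $\gamma>0$ small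 and domains $\mathbf S=\mathbf S^{(N)}\subset\{z: -10\le E\le 10,\ M^{-1+\gamma}\le\eta\le10\}$; all $z$-dependent quantities are considered for $z\in\mathbf S$. Let $\Lambda(z)=\max_{x,y}|G_{xy}(z)-\delta_{xy}m(z)|$. **Partial expectation.** $H^{(i)}$ is the matrix obtained from $H$ by setting all entries in row and column $i$ to zero. $P_iX=\mathbb E(X\mid H^{(i)})$, $Q_iX=X-P_iX$. **Stochastic domination.** For random $X=X^{(N)}(u)$ and deterministic $\Psi=\Psi^{(N)}(u)\ge0$, $u\in U^{(N)}$, write $X\prec\Psi$ if for all $\varepsilon>0$, $D>0$ there is $N_0$ such that $\sup_{u}\mathbb P[|X^{(N)}(u)|>N^\varepsilon\Psi^{(N)}(u)]\le N^{-D}$ for $N\ge N_0$. It is always understood to be uniform in all parameters ($z\in\mathbf S$, matrix indices, external indices, weights); $N_0$ depends on $\varepsilon$, $D$ and on the fixed data ($\delta$, $(\kappa_p)$, the graph, etc.). **Control parameters.** A control parameter is a positive deterministic $N$-dependent function $\Psi$ on $\mathbf S$; it is admissible if there is a constant $c>0$ with $M^{-1/2}\le\Psi(z)\le M^{-c}$ for all $N$, $z\in\mathbf S$. **Graphs and monomials.** An admissible graph $\Delta$ is a finite directed multigraph (loops and multiple edges allowed) with vertex set $V(\Delta)=V_s(\Delta)\sqcup V_e(\Delta)$ (summation and external vertices), edge set $E(\Delta)$ with source and target maps $\alpha,\beta:E(\Delta)\to V(\Delta)$, and a colouring $\xi:E(\Delta)\to\{1,*\}$. Its degree is $\deg(\Delta)=|E(\Delta)|$.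 For summation indices $\mathbf a=(a_i)_{i\in V_s(\Delta)}$ and external indices $\boldsymbol\mu=(\mu_i)_{i\in V_e(\Delta)}$, all in $\{1,\dots,N\}$, let $u_i=a_i$ for $i\in V_s(\Delta)$, $u_i=\mu_i$ for $i\in V_e(\Delta)$, and $\mathcal Z^{\boldsymbol\mu}_{\mathbf a}(\Delta)=\prod_{e\in E(\Delta)}\mathcal G^{\xi_e}_{u_{\alpha(e)}u_{\beta(e)}}$ (with $\mathcal G^{1}=\mathcal G$). **Weights.** For a tuple $\mathbf a_J=(a_i)_{i\in J}$ let $\mathcal P(\mathbf a_J)$ be the partition of $J$ given by $k\sim l$ iff $a_k=a_l$. A map $w:\{1,\dots,N\}^{V_s(\Delta)}\to[0,1]$ is a weight adapted to $\Delta$ if for every (possibly trivial) splitting $V_s(\Delta)=I\sqcup J$, with $\mathbf a=(\mathbf a_I,\mathbf a_J)$, and every partition $P$ of $J$, $$\max_{\mathbf a_I}\sum_{\mathbf a_J}\mathbf 1(\mathcal P(\mathbf a_J)=P)\,w(\mathbf a_I,\mathbf a_J)\le M^{|P|-|V_s(\Delta)|},$$ where $|P|$ is the number of blocks of $P$. **Averages.** $X_F^{w,\boldsymbol\mu}(\Delta)=\sum_{\mathbf a}w(\mathbf a)\big[\prod_{i\in F}Q_{a_i}\big]\mathcal Z_{\mathbf a}^{\boldsymbol\mu}(\Delta)$, the sum being over all $\mathbf a\in\{1,\dots,N\}^{V_s(\Delta)}$ whose entries are pairwise distinct and all different from every $\mu_j$, $j\in V_e(\Delta)$. *)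

(* Defs.v *)
From HB Require Import structures.
From mathcomp Require Import all_boot all_order all_algebra.
From mathcomp Require Import all_classical all_reals all_analysis.
From mathcomp Require Import spectral sesquilinear complex.

Set Implicit Arguments.
Unset Strict Implicit.
Unset Printing Implicit Defensive.
Import Order.TTheory GRing.Theory Num.Theory.
Import numFieldNormedType.Exports.

Local Open Scope classical_set_scope.
Local Open Scope ring_scope.
Local Open Scope complex_scope.

(* The modulus with values in R; `|z| lives in R[i]. *)
Notation cmod := ComplexField.Normc.normc.

Section complex_random_variables.
Context {R : realType} {d : measure_display} {T : measurableType d}.

(* R[i] carries no measurable structure: Borel sets of the complex plane are
   taken in R * R. *)
Definition to_plane (z : R[i]) : measurableTypeR R * measurableTypeR R :=
  (complex.Re z, complex.Im z).

Definition cintegral (mu : {measure set T -> \bar R}) (D : set T)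
    (f : T -> R[i]) : R[i] :=
  Rintegral mu D (fun x => complex.Re (f x)) +i*
  Rintegral mu D (fun x => complex.Im (f x)).

Variable P : probability T R.

Definition mutually_independent (I : finType) (D : {set I})
    (X : I -> T -> R[i]) : Prop :=
  forall (J : {set I})
         (B : I -> set (measurableTypeR R * measurableTypeR R)),
    J \subset D -> (forall i, i \in J -> measurable (B i)) ->
    P [set t | forall i, i \in J -> B i (to_plane (X i t))] =
    (\prod_(i in J) P [set t | B i (to_plane (X i t))])%E.

Definition sigma_mx (m n : nat) (X : T -> 'M[R[i]]_(m, n)) : set (set T) :=
  <<s [set A | exists k l (B : set (measurableTypeR R * measurableTypeR R)),
        measurable B /\ A = [set t | B (to_plane (X t k l))]] >>.

(* Y is a version of the conditional expectation of X given the sigma-algebra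
   F. *)
Definition is_cond_exp (F : set (set T)) (X Y : T -> R) : Prop :=
  [/\ P.-integrable setT (EFin \o X),
      P.-integrable setT (EFin \o Y),
      forall B : set (measurableTypeR R), measurable B -> F (Y @^-1` B) &
      forall A, F A ->
        (\int[P]_(t in A) (Y t)%:E = \int[P]_(t in A) (X t)%:E)%E].

(* A chosen version (they all agree almost surely); 0 if X is not
   integrable. *)
Definition cond_exp (F : set (set T)) (X : T -> R) : T -> R :=
  xget (cst 0) [set Y | is_cond_exp F X Y].

Definition ccond_exp (F : set (set T)) (X : T -> R[i]) : T -> R[i] :=
  fun t => cond_exp F (fun s => complex.Re (X s)) t +i*
           cond_exp F (fun s => complex.Im (X s)) t.

End complex_random_variables.

Definition stoch_dom {R : realType} {d : nat -> measure_display}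
    {T : forall N, measurableType (d N)} (P : forall N, probability (T N) R)
    (U : nat -> Type) (D : forall N, set (U N))
    (X : forall N, U N -> T N -> R[i]) (Psi : forall N, U N -> R) : Prop :=
  forall eps L : R, 0 < eps -> 0 < L ->
  exists N0 : nat, forall N, (N0 <= N)%N -> forall u : U N, D N u ->
    (P N [set t | (cmod (X N u t) > N%:R `^ eps * Psi N u)%R] <=
     (N%:R `^ (- L))%:E)%E.

Section random_matrix.
Context {R : realType} {d : measure_display} {T : measurableType d}.
Variables (P : probability T R) (N : nat) (H : T -> 'M[R[i]]_N).

Definition variance (i j : 'I_N) : R :=
  Rintegral P setT (fun t => cmod (H t i j) ^+ 2).

Definition bandwidth : R :=
  1 / \big[Num.max/0]_(i < N) \big[Num.max/0]_(j < N) variance i j.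

(* E |zeta_ij|^p; zeta_ij is a standard Gaussian when s_ij = 0. *)
Definition zeta_moment (p : nat) (i j : 'I_N) : \bar R :=
  if variance i j == 0 then (\int[normal_prob (0 : R) 1]_x (`|x| ^+ p)%:E)%E
  else (\int[P]_t (cmod (((Num.sqrt (variance i j))^-1)%:C * H t i j) ^+ p)%:E)%E.

Record random_hermitian : Prop := RandomHermitian {
  rh_measurable : forall i j,
    measurable_fun setT (fun t => to_plane (H t i j));
  rh_hermitian : forall t, H t = ((H t)^t*)%sesqui;
  rh_independent : mutually_independent P
    [set k : 'I_N * 'I_N | (k.1 <= k.2)%N]%SET
    (fun k t => H t k.1 k.2);
  rh_square_integrable : forall i j,
    P.-integrable setT (fun t => (cmod (H t i j) ^+ 2)%:E);
  rh_centered : forall i j, cintegral P setT (fun t => H t i j) = 0;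
  rh_stochastic : forall i, \sum_(j < N) variance i j = 1
}.

Definition minor (i : 'I_N) (t : T) : 'M[R[i]]_N :=
  \matrix_(k, l) if (k == i) || (l == i) then 0 else H t k l.

Definition partial_exp (i : 'I_N) (X : T -> R[i]) : T -> R[i] :=
  ccond_exp P (sigma_mx (minor i)) X.

Definition partial_fluct (i : 'I_N) (X : T -> R[i]) : T -> R[i] :=
  fun t => X t - partial_exp i X t.

Definition msc (z : R[i]) : R[i] :=
  ((2 * pi)^-1)%:C *
  cintegral (@lebesgue_measure R) `[-2, 2]
    (fun x : R => (Num.sqrt (4 - x ^+ 2))%:C / (x%:C - z)).

Definition green (z : R[i]) (t : T) : 'M[R[i]]_N := invmx (H t - z%:M).

Definition calG (z : R[i]) (t : T) : 'M[R[i]]_N := green z t - (msc z)%:M.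

Definition calGstar (z : R[i]) (t : T) : 'M[R[i]]_N :=
  ((green z t)^t*)%sesqui - ((msc z)^*)%:M.

Definition Lambda (z : R[i]) (t : T) : R :=
  \big[Num.max/0]_(x < N) \big[Num.max/0]_(y < N)
    cmod (green z t x y - (x == y)%:R * msc z).

End random_matrix.

Definition spectral_domain {R : realType} (gamma M : R) : set R[i] :=
  [set z | -10 <= complex.Re z <= 10 /\
           M `^ (-1 + gamma) <= complex.Im z <= 10].

Definition admissible_control {R : realType} (M : nat -> R)
    (S : nat -> set R[i]) (Psi : nat -> R[i] -> R) : Prop :=
  (forall N z, (0 < N)%N -> S N z -> 0 < Psi N z) /\
  exists2 c : R, 0 < c & forall N z, (0 < N)%N -> S N z ->
    M N `^ (- 2^-1) <= Psi N z <= M N `^ (- c).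

(* The edge e carries the colour * when gstar e is true, and 1 otherwise. *)
Record admissible_graph := Graph {
  gsum : finType;
  gext : finType;
  gedge : finType;
  gsrc : gedge -> gsum + gext;
  gtgt : gedge -> gsum + gext;
  gstar : gedge -> bool
}.

Definition deg (Delta : admissible_graph) : nat := #|gedge Delta|.

Section monomials.
Context {R : realType} (Delta : admissible_graph).

Definition vertex_index (N : nat) (a : {ffun gsum Delta -> 'I_N})
    (mu : {ffun gext Delta -> 'I_N}) (v : gsum Delta + gext Delta) : 'I_N :=
  match v with inl i => a i | inr j => mu j end.

(* Fixing b fixes a_I for I the complement of J. *)
Definition adapted_weight (N : nat) (M : R)
    (w : {ffun gsum Delta -> 'I_N} -> R) : Prop :=
  (forall a, 0 <= w a <= 1) /\
  forall (J : {set gsum Delta}) (Pi : {set {set gsum Delta}}),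
    finset.partition Pi J ->
    forall b : {ffun gsum Delta -> 'I_N},
      \sum_(a : {ffun gsum Delta -> 'I_N} |
             [forall i in ~: J, a i == b i] && (preim_partition a J == Pi)) w a
      <= M ^ (#|Pi|%:Z - #|gsum Delta|%:Z).

Context {d : measure_display} {T : measurableType d}.
Variables (P : probability T R) (N : nat) (H : T -> 'M[R[i]]_N).

Definition monomial (z : R[i]) (a : {ffun gsum Delta -> 'I_N})
    (mu : {ffun gext Delta -> 'I_N}) (t : T) : R[i] :=
  \prod_(e : gedge Delta)
    (if gstar e then calGstar H z t else calG H z t)
      (vertex_index a mu (gsrc e)) (vertex_index a mu (gtgt e)).

(* The operators Q_(a i), i in F, commute almost surely when the entries of H
   are independent and a is injective; they are applied along enum F. *)
Definition average (F : {set gsum Delta}) (z : R[i])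
    (w : {ffun gsum Delta -> 'I_N} -> R) (mu : {ffun gext Delta -> 'I_N})
    (t : T) : R[i] :=
  \sum_(a : {ffun gsum Delta -> 'I_N} |
         injectiveb a && [forall i, forall j, a i != mu j])
    (w a)%:C * foldr (fun i X => partial_fluct P H (a i) X)
                      (monomial z a mu) (enum F) t.

End monomials.

(* Main.v *)
Require Import Defs.
From HB Require Import structures.
From mathcomp Require Import all_boot all_order all_algebra.
From mathcomp Require Import all_classical all_reals all_analysis.
From mathcomp Require Import measurable_realfun spectral sesquilinear complex.
From mathcomp Require Import ring lra.

Import Order.TTheory GRing.Theory Num.Theory.
Import numFieldNormedType.Exports.
Local Open Scope classical_set_scope.
Local Open Scope ring_scope.
Local Open Scope complex_scope.

Set Implicit Arguments.
Unset Strict Implicit.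
Unset Printing Implicit Defensive.

(** The variables [Q_(a i)] produce one factor [Psi] each, on top of the factor
    [Psi] of each edge, for the following reasons.

    By independence of the entries, conditioning on the minor without the row [a]
    amounts to averaging over an independent copy of the row [a]
    ([cond_exp_minor]). The operators [P_a] and [Q_a] thus become operators
    [row_average] and [row_fluct] on functions of the sample; these commute, and
    [Q_a] annihilates whatever does not depend on the row [a].

    The resolvent of a minor satisfies Schur's formula
    [G x y - G^(a) x y = G x a * G a y / G a a], where the two entries of the
    numerator are small and [G a a] is close to [m], which is bounded away from 0
    ([cmod_msc_lb]). Hence, if the rows [s] do not occur among the indices of a
    monomial [Z] of degree [D], the iterated difference of [Z] under removal of
    these rows is of order [theta ^ (D + |s|)], where [theta] is the distance from
    the resolvent to [m] ([mx_monomial_controlled]). Since [Z] and this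
    difference have the same image under the product of the [Q_b], [b] in [s],
    that image has moments of order [Psi ^ (D + |s|)] up to a small power of [N]
    ([moment_row_flucts]). The event that the resolvent is far from [m] has a
    probability below every negative power of [N], and there the entries are still
    at most [1 / eta <= N].

    The expectation of [X ^ p] is a sum over [p] assignments of indices. Call an
    index of one of the factors, taken in [F], lone if its value [v] occurs in no
    other factor. Its own factor is centred with respect to the row [v], so in
    the expansion of every factor into its average and its fluctuation in that row
    only those terms survive in which another factor fluctuates as well. That
    factor does not contain [v], hence gains [Psi] ([expect_prod_fluct]). At least
    half as many indices repeat a value seen before as there are indices in [F]
    that are not lone ([lone_count]), and every repetition costs a factor [M^-1 <= Psi ^ 2] because
    the weight is adapted ([adapted_weight_fix], [sum_seq_weight]). Both effects
    together yield [Psi ^ (p * |F|)] ([expect_fluct_average]), and Markov's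
    inequality with a large even [p] turns the bound on the moments into
    stochastic domination ([average_tail]). *)

(** * Moduli of complex numbers *)

Section Modulus.
Variable R : realType.
Implicit Types x y : R[i].

Lemma cmod0 : cmod (0 : R[i]) = 0. Proof. exact: Normc.normc0. Qed.

Lemma cmod1 : cmod (1 : R[i]) = 1. Proof. exact: Normc.normc1. Qed.

Lemma cmodM x y : cmod (x * y) = cmod x * cmod y.
Proof. exact: Normc.normcM. Qed.

Lemma cmodD x y : cmod (x + y) <= cmod x + cmod y.
Proof. exact: le_normcD. Qed.

Lemma cmodN x : cmod (- x) = cmod x. Proof. exact: normcN. Qed.

Lemma cmodB x y : cmod (x - y) <= cmod x + cmod y.
Proof. by rewrite -(cmodN y) cmodD. Qed.

Lemma cmodV x : cmod x^-1 = (cmod x)^-1. Proof. exact: Normc.normcV. Qed.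

Lemma cmod_ge0 x : 0 <= cmod x.
Proof. by case: x => a b; exact: sqrtr_ge0. Qed.

Lemma cmod_conj x : cmod (x^*) = cmod x.
Proof. by case: x => a b; rewrite /Normc.normc /= sqrrN. Qed.

Lemma ler_Re_cmod x : `|complex.Re x| <= cmod x.
Proof.
case: x => a b; rewrite /Normc.normc /= -sqrtr_sqr ler_wsqrtr //.
by rewrite lerDl sqr_ge0.
Qed.

Lemma ler_Im_cmod x : `|complex.Im x| <= cmod x.
Proof.
case: x => a b; rewrite /Normc.normc /= -sqrtr_sqr ler_wsqrtr //.
by rewrite lerDr sqr_ge0.
Qed.

Lemma cmod_le_ReIm x : cmod x <= `|complex.Re x| + `|complex.Im x|.
Proof.
case: x => a b; rewrite /Normc.normc /=.
rewrite -[leRHS]ger0_norm ?addr_ge0// -sqrtr_sqr ler_wsqrtr //.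
rewrite sqrrD !real_normK ?num_real// addrAC lerDl.
by rewrite mulrn_wge0// mulr_ge0.
Qed.

Lemma cmod_prod (J : finType) (F : J -> R[i]) :
  cmod (\prod_j F j) = \prod_j cmod (F j).
Proof. by apply: (big_morph _ cmodM); exact: Normc.normc1. Qed.

End Modulus.

(** * Finite differences of set functions *)

Section FiniteDifferences.
Variables (I : finType) (U : zmodType).
Implicit Types (phi psi : {set I} -> U) (V W X Y : {set I}) (s : seq I).

Fixpoint fdiff s phi : {set I} -> U :=
  if s is a :: s' then fdiff s' (fun V => phi V - phi (a |: V)) else phi.

Lemma fdiff_ext X s V phi psi : {subset s <= X} -> V \subset X ->
  (forall W, W \subset X -> phi W = psi W) -> fdiff s phi V = fdiff s psi V.
Proof.
elim: s phi psi => [|a s IH] phi psi sX VX e /=; first exact: e.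
apply: IH => // [x xs|W WX]; first by apply: sX; rewrite inE xs orbT.
by rewrite !e // finset.subUset finset.sub1set WX sX ?inE ?eqxx.
Qed.

Lemma fdiffD s phi psi V :
  fdiff s (fun W => phi W + psi W) V = fdiff s phi V + fdiff s psi V.
Proof.
elim: s phi psi => [//|a s IH] phi psi /=; rewrite -IH.
by congr (fdiff s _ V); apply/funext => W; rewrite opprD addrACA.
Qed.

Lemma fdiffN s phi V : fdiff s (fun W => - phi W) V = - fdiff s phi V.
Proof.
elim: s phi => [//|a s IH] phi /=; rewrite -IH.
by congr (fdiff s _ V); apply/funext => W; rewrite opprB opprK addrC.
Qed.

Lemma fdiff_shift s a phi V :
  fdiff s (fun W => phi (a |: W)) V = fdiff s phi (a |: V).
Proof.
elim: s phi => [//|b s IH] phi /=; rewrite -IH.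
by congr (fdiff s _ V); apply/funext => W; rewrite finset.setUCA.
Qed.

Lemma fdiff_cons a s phi V :
  fdiff (a :: s) phi V = fdiff s phi V - fdiff s phi (a |: V).
Proof. by rewrite /= fdiffD fdiffN fdiff_shift. Qed.

End FiniteDifferences.

Lemma fdiff_morph (I : finType) (U U' : zmodType) (f : {additive U -> U'})
    s (phi : {set I} -> U) V :
  fdiff s (fun W => f (phi W)) V = f (fdiff s phi V).
Proof.
elim: s phi => [//|a s IH] phi /=; rewrite -IH.
by congr (fdiff s _ V); apply/funext => W; rewrite raddfB.
Qed.

Section Control.
Variables (R : realType) (I : finType) (theta : R).
Hypothesis theta0 : 0 <= theta.
Hypothesis theta1 : theta <= 1.
Implicit Types (phi psi : {set I} -> R[i]) (V W X Y : {set I}) (s : seq I).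

(** The notion of smallness that survives products and reciprocals: every
    difference in a new row is worth one more factor [theta]. *)
Definition controlled X (k : nat) (C : R) phi : Prop :=
  forall s V, uniq s -> {subset s <= X :\: V} -> V \subset X ->
  cmod (fdiff s phi V) <= C * theta ^+ (k + size s).

Lemma controlled_subset X Y k C phi :
  Y \subset X -> controlled X k C phi -> controlled Y k C phi.
Proof.
move=> YX H s V us sY VY; apply: H => //; last exact: fintype.subset_trans YX.
by move=> x /sY; rewrite !inE => /andP[-> /(fintype.subsetP YX)].
Qed.

Lemma controlled_weaken X k l C D phi : 0 <= C -> (l <= k)%N -> C <= D ->
  controlled X k C phi -> controlled X l D phi.
Proof.
move=> C0 lk CD H s V us sX VX; apply: (le_trans (H s V us sX VX)).
apply: ler_pM => //; first exact: exprn_ge0.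
by apply: ler_wiXn2l => //; rewrite leq_add2r.
Qed.

Lemma controlled_ext X k C phi psi :
  (forall V, V \subset X -> phi V = psi V) ->
  controlled X k C phi -> controlled X k C psi.
Proof.
move=> e H s V us sX VX; rewrite -(fdiff_ext (X := X) (phi := phi)) //; first exact: H.
by move=> x /sX; rewrite inE => /andP[].
Qed.

Lemma controlledN X k C phi :
  controlled X k C phi -> controlled X k C (fun V => - phi V).
Proof. by move=> H s V us sX VX; rewrite fdiffN cmodN; exact: H. Qed.

Lemma controlled_diff X k C phi a : a \in X -> controlled X k C phi ->
  controlled (X :\ a) k.+1 C (fun V => phi V - phi (a |: V)).
Proof.
move=> aX H s V us sX VX; have := H (a :: s) V.
rewrite /= addnS addSn; apply.
- by rewrite us andbT; apply/negP => /sX; rewrite !inE eqxx andbF.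
- move=> x; rewrite inE => /orP[/eqP->|/sX]; last first.
    by rewrite !inE => /andP[-> /andP[_ ->]].
  rewrite inE aX andbT; apply/negP => /(fintype.subsetP VX).
  by rewrite !inE eqxx.
- by apply: (fintype.subset_trans VX); rewrite finset.subD1set.
Qed.

Lemma controlled_shift X k C phi a : a \in X -> controlled X k C phi ->
  controlled (X :\ a) k C (fun V => phi (a |: V)).
Proof.
move=> aX H s V us sX VX; rewrite fdiff_shift; apply: H => //.
  move=> x /sX; rewrite !inE => /andP[/negbTE -> /andP[/negbTE -> ->]] //.
rewrite finset.subUset finset.sub1set aX; apply: (fintype.subset_trans VX).
by rewrite finset.subD1set.
Qed.

Lemma fdiff_head_in s a X V : uniq (a :: s) -> {subset a :: s <= X :\: V} ->
  V \subset X ->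
  [/\ a \in X, {subset s <= (X :\ a) :\: V} & V \subset X :\ a].
Proof.
move=> /= /andP[nas us] sX VX; have := sX a; rewrite inE eqxx => /(_ isT).
rewrite inE => /andP[aV aX]; split=> //.
  move=> x xs; have := sX x; rewrite !inE xs orbT => /(_ isT) /andP[-> ->].
  by rewrite andbT; apply: contraNneq nas => <-.
by rewrite finset.subsetD1 VX.
Qed.

(** The product rule: the difference of a product is a difference of one
    factor times a value of the other one, which leaves two terms for each of
    the [size s] differences. *)
Lemma controlled_mul_aux s : forall X V k l C D phi psi, 0 <= C -> 0 <= D ->
  uniq s -> {subset s <= X :\: V} -> V \subset X ->
  controlled X k C phi -> controlled X l D psi ->
  cmod (fdiff s (fun W => phi W * psi W) V) <=
  2 ^+ size s * (C * D) * theta ^+ (k + l + size s).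
Proof.
elim: s => [|a s IH] X V k l C D phi psi C0 D0 us sX VX H1 H2.
  rewrite /= addn0 expr0 mul1r exprD cmodM mulrACA.
  have := H1 [::] V isT (fun x => ltac:(by [])) VX.
  have := H2 [::] V isT (fun x => ltac:(by [])) VX.
  by rewrite /= !addn0 => h2 h1; apply: ler_pM; rewrite ?cmod_ge0.
have [aX sX' VX'] := fdiff_head_in us sX VX.
have us' : uniq s by case/andP: us.
rewrite /= (_ : (fun _ => _) = (fun W => (phi W - phi (a |: W)) * psi W +
   phi (a |: W) * (psi W - psi (a |: W)))); last first.
  by apply/funext => W; ring.
rewrite fdiffD; apply: (le_trans (cmodD _ _)).
have h1 := IH _ _ k.+1 l C D _ _ C0 D0 us' sX' VX'
  (controlled_diff aX H1) (controlled_subset (finset.subD1set _ a) H2).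
have h2 := IH _ _ k l.+1 C D _ _ C0 D0 us' sX' VX'
  (controlled_shift aX H1) (controlled_diff aX H2).
apply: (le_trans (lerD h1 h2)).
have -> : 2 ^+ size (a :: s) = 2 ^+ size s + 2 ^+ size s :> R.
  by rewrite /= exprS; ring.
by rewrite /= !addSn !addnS !addSn !mulrDl.
Qed.

Lemma controlled_mul n X k l C D phi psi : 0 <= C -> 0 <= D ->
  (#|X| <= n)%N -> controlled X k C phi -> controlled X l D psi ->
  controlled X (k + l) (2 ^+ n * (C * D)) (fun W => phi W * psi W).
Proof.
move=> C0 D0 nX H1 H2 s V us sX VX.
apply: (le_trans (controlled_mul_aux C0 D0 us sX VX H1 H2)).
rewrite ler_wpM2r ?exprn_ge0// ler_wpM2r ?mulr_ge0//.
rewrite ler_weXn2l ?ler1n//; apply: leq_trans nX.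
rewrite -(card_uniqP us); apply: subset_leq_card.
by apply/fintype.subsetP => x /sX; rewrite inE => /andP[].
Qed.

End Control.

(** The reciprocal [1/phi] is differentiated by
    [1/phi V - 1/phi (aV) = - (phi V - phi (aV)) / (phi V * phi (aV))],
    whose right-hand side involves one row less. *)
Lemma controlled_inv (R : realType) (n : nat) (c C : R) : 0 < c -> 0 <= C ->
  exists2 C' : R, 0 <= C' & forall (I : finType) (theta : R) (X : {set I}) phi m,
  0 <= theta -> theta <= 1 ->
  (#|X| <= n)%N -> (forall V : {set I}, V \subset X -> c <= cmod (phi V)) ->
  controlled theta X 1 C (fun V => phi V - m) ->
  controlled theta X 0 C' (fun V => (phi V)^-1).
Proof.
move=> c0 C0; elim: n => [|n [C' C'0 IH]].
  exists c^-1 => [|I theta X phi m th0 th1 X0 cphi _ [|a s] V us sX VX].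
  - by rewrite invr_ge0 ltW.
  - by rewrite /= expr0 mulr1 cmodV lef_pV2 ?posrE ?cphi// (lt_le_trans c0) ?cphi.
  - have := sX a; rewrite inE eqxx => /(_ isT); rewrite inE => /andP[_].
    by move: X0; rewrite leqn0 finset.cards_eq0 => /eqP ->; rewrite inE.
pose K := 2 ^+ n * (C * (2 ^+ n * (C' * C'))).
have K0 : 0 <= K by rewrite !mulr_ge0 ?exprn_ge0.
exists (c^-1 + K) => [|I theta X phi m th0 th1 Xn cphi H [|a s] V us sX VX].
- by rewrite addr_ge0// invr_ge0 ltW.
- rewrite /= expr0 mulr1 cmodV (le_trans (y := c^-1)) ?lerDl//.
  by rewrite lef_pV2 ?posrE ?cphi// (lt_le_trans c0) ?cphi.
have [aX sX' VX'] := fdiff_head_in us sX VX.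
have us' : uniq s by case/andP: us.
have Xn' : (#|X :\ a| <= n)%N by move: Xn; rewrite (finset.cardsD1 a) aX.
have sub := finset.subD1set X a.
have aW (W : {set I}) : W \subset X :\ a -> a |: W \subset X.
  by move=> WX; rewrite finset.subUset finset.sub1set aX (fintype.subset_trans WX).
have phi0 (W : {set I}) : W \subset X -> phi W != 0.
  move=> WX; apply/eqP => e; have := cphi _ WX.
  by rewrite e cmod0 leNgt c0.
have H1 : controlled theta (X :\ a) 0 C' (fun V => (phi V)^-1).
  apply: (IH I theta _ phi m) => //; last exact: controlled_subset H.
  by move=> W WX; apply: cphi; exact: fintype.subset_trans sub.
have H2 : controlled theta (X :\ a) 0 C' (fun V => (phi (a |: V))^-1).
  apply: (IH I theta _ (fun V => phi (a |: V)) m) => //.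
    by move=> W WX; apply: cphi; exact: aW.
  exact: (controlled_shift aX H).
have H3 := controlled_mul th0 C'0 C'0 Xn' H1 H2.
have H4 := controlled_mul th0 C0 (mulr_ge0 (exprn_ge0 _ (ler0n _ 2)) (mulr_ge0 C'0 C'0)) Xn'
   (controlledN (controlled_diff aX H)) H3.
have := controlled_weaken th0 th1 K0 (leqnSn 1) (_ : K <= c^-1 + K) H4.
rewrite lerDr invr_ge0 ltW// => /(_ isT) H5.
have {H5} := controlled_ext _ H5.
move=> /(_ (fun V => (phi V)^-1 - (phi (a |: V))^-1)) H5.
have := H5 _ s V us' sX' VX'; rewrite !add1n /= add0n; apply.
move=> W WX; have := phi0 _ (aW _ WX); have := phi0 _ (fintype.subset_trans WX sub).
by move=> h1 h2; field; rewrite h1 h2.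
Qed.

(** * Finite differences of resolvent entries *)

(** An abstraction of the entries of the resolvents of the minors: removing one
    more row changes the entries by the Schur complement formula. *)
Definition schur_family (K : fieldType) (I : finType)
    (G : {set I} -> I -> I -> K) : Prop :=
  forall (V : {set I}) a x y, a \notin V -> x \notin a |: V -> y \notin a |: V ->
  G V a a != 0 ->
  G (a |: V) x y = G V x y - G V x a * G V a y / G V a a.

Section SchurFamily.
Variable R : realType.

Let mx_close (I : finType) (G : {set I} -> I -> I -> R[i]) (m : R[i]) (r : R) (V : {set I}) :=
  forall x y, x \notin V -> y \notin V ->
  cmod (G V x y - (x == y)%:R * m) <= r.

Let diag_lb (I : finType) (G : {set I} -> I -> I -> R[i]) m (V : {set I}) a c r :
  mx_close G m r V -> a \notin V -> c <= cmod m -> r <= c / 2 ->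
  c / 2 <= cmod (G V a a).
Proof.
move=> HG aV cm rc; have := HG a a aV aV; rewrite eqxx mul1r => h.
have : cmod m <= cmod (G V a a) + cmod (G V a a - m).
  by rewrite {1}(_ : m = G V a a - (G V a a - m)) ?cmodB//; ring.
by lra.
Qed.

(** Each removal changes an entry by the product of two off-diagonal entries
    divided by a diagonal one, which is of order [theta ^+ 2]; as at most [n] rows
    are removed, the constants stay bounded. *)
Lemma schur_family_close (n : nat) (c : R) : 0 < c ->
  exists2 K : R, 1 <= K & forall (I : finType) (theta : R)
    (G : {set I} -> I -> I -> R[i]) m (V : {set I}),
  0 <= theta -> theta <= 1 -> K * theta <= c / 2 -> c <= cmod m ->
  schur_family G -> mx_close G m theta finset.set0 -> (#|V| <= n)%N ->
  mx_close G m (K * theta) V.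
Proof.
move=> c0; elim: n => [|n [K K1 IH]].
  exists 1 => // I th G m V th0 th1 _ cm HG H0.
  by rewrite leqn0 finset.cards_eq0 mul1r => /eqP ->.
have q0 : 0 <= K ^+ 2 / (c / 2) by rewrite divr_ge0 ?sqr_ge0 ?divr_ge0 ?ltW.
exists (K + K ^+ 2 / (c / 2)) => [|I th G m V th0 th1 Kth cm HG H0 Vn].
  by rewrite (le_trans K1)// lerDl.
have Kth' : K * th <= c / 2.
  by apply: le_trans Kth; rewrite ler_wpM2r// lerDl.
have K0 : 0 <= K by rewrite (le_trans ler01).
have IHV (W : {set I}) : (#|W| <= n)%N -> mx_close G m (K * th) W by exact: IH.
have [Vn'|] := leqP #|V| n.
  move=> x y xV yV; apply: (le_trans (IHV V Vn' x y xV yV)).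
  by rewrite ler_wpM2r// lerDl.
move=> nV; have [a aV] : exists a, a \in V.
  by apply/finset.set0Pn; rewrite -card_gt0; exact: leq_trans nV.
have Vn' : (#|V :\ a| <= n)%N by move: Vn; rewrite (finset.cardsD1 a) aV.
have aV' : a \notin V :\ a by rewrite !inE eqxx.
move=> x y; rewrite -(finset.setD1K aV) => xV yV.
have lb := diag_lb (IHV _ Vn') aV' cm Kth'.
have xV' : x \notin V :\ a by apply: contraNN xV; rewrite !inE => ->; rewrite orbT.
have yV' : y \notin V :\ a by apply: contraNN yV; rewrite !inE => ->; rewrite orbT.
rewrite HG //; last first.
  by apply/eqP => e; move: lb; rewrite e cmod0; apply/negP; rewrite -ltNge divr_gt0.
rewrite addrAC; apply: (le_trans (cmodB _ _)); rewrite mulrDl lerD//.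
  exact: IHV.
have xa : x == a = false.
  by apply: contraNF xV => /eqP ->; rewrite !inE eqxx.
have ay : a == y = false.
  by apply: contraNF yV => /eqP <-; rewrite !inE eqxx.
have h1 := IHV _ Vn' x a xV' aV'.
have h2 := IHV _ Vn' a y aV' yV'.
move: h1 h2; rewrite xa ay !mul0r !subr0 => h1 h2.
rewrite !cmodM cmodV; apply: (@le_trans _ _ ((K * th) * (K * th) / (c / 2))).
  rewrite !ler_pM ?mulr_ge0 ?invr_ge0 ?cmod_ge0//.
  by rewrite lef_pV2 ?posrE ?divr_gt0// (lt_le_trans _ lb) ?divr_gt0.
rewrite [leRHS]mulrAC ler_wpM2r ?invr_ge0 ?divr_ge0 ?(ltW c0)//.
by rewrite mulrACA -expr2 ler_wpM2l ?sqr_ge0// ler_piMl.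
Qed.

(** Differentiating [G x y] in the row [a] gives [G x a * G a y / G a a], which
    contains one small entry more; the further differences follow from the
    rules for products and reciprocals. *)
Lemma schur_family_controlled (n : nat) (c K : R) : 0 < c -> 0 <= K ->
  exists2 C : R, 0 <= C & forall (I : finType) (theta : R)
    (G : {set I} -> I -> I -> R[i]) m (X : {set I}) x y,
  0 <= theta -> theta <= 1 -> K * theta <= c / 2 -> c <= cmod m ->
  schur_family G -> (#|X| <= n)%N ->
  (forall V : {set I}, V \subset X -> mx_close G m (K * theta) V) ->
  x \notin X -> y \notin X ->
  controlled theta X 1 C (fun V => G V x y - (x == y)%:R * m).
Proof.
move=> c0 K0; elim: n => [|n [C C0 IH]].
  exists K => // I th G m X x y th0 th1 Kth cm HG X0 Hcl xX yX [|a s] V us sX VX.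
    rewrite /= addn0 expr1; apply: Hcl => //.
      by apply: contraNN xX; apply/fintype.subsetP.
    by apply: contraNN yX; apply/fintype.subsetP.
  have := sX a; rewrite inE eqxx => /(_ isT); rewrite inE => /andP[_].
  by move: X0; rewrite leqn0 finset.cards_eq0 => /eqP ->; rewrite inE.
have c20 : 0 < c / 2 by rewrite divr_gt0.
have [C' C'0 Hinv] := controlled_inv n c20 C0.
pose L := 2 ^+ n * ((2 ^+ n * (C * C)) * C').
have CC0 : 0 <= 2 ^+ n * (C * C) by rewrite !mulr_ge0 ?exprn_ge0.
have L0 : 0 <= L by rewrite !mulr_ge0 ?exprn_ge0.
exists (K + L) => [|I th G m X x y th0 th1 Kth cm HG Xn Hcl xX yX].
  by rewrite addr_ge0.
have nin (V : {set I}) z : V \subset X -> z \notin X -> z \notin V.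
  by move=> VX; apply: contraNN; apply/fintype.subsetP.
move=> [|a s] V us sX VX.
  rewrite /= addn0 expr1.
  apply: (le_trans (Hcl V VX x y (nin _ _ VX xX) (nin _ _ VX yX))).
  by rewrite ler_wpM2r// lerDl.
have [aX sX' VX'] := fdiff_head_in us sX VX.
have us' : uniq s by case/andP: us.
have Xn' : (#|X :\ a| <= n)%N by move: Xn; rewrite (finset.cardsD1 a) aX.
have sub := finset.subD1set X a.
have subX (W : {set I}) : W \subset X :\ a -> W \subset X.
  by move=> WX; exact: fintype.subset_trans sub.
have aNX : a \notin X :\ a by rewrite !inE eqxx.
have xNX : x \notin X :\ a by apply: nin xX; exact: sub.
have yNX : y \notin X :\ a by apply: nin yX; exact: sub.
have IH' u v : u \notin X :\ a -> v \notin X :\ a ->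
    controlled th (X :\ a) 1 C (fun V => G V u v - (u == v)%:R * m).
  by move=> uX vX; apply: IH => // W WX; apply: Hcl; exact: subX.
have aNW (W : {set I}) : W \subset X :\ a -> a \notin W.
  by move=> WX; apply: contraNN aNX; apply/fintype.subsetP.
have lb (W : {set I}) : W \subset X :\ a -> c / 2 <= cmod (G W a a).
  by move=> WX; apply: (diag_lb (Hcl W (subX W WX))) => //; exact: aNW.
have xa : x == a = false by apply: contraNF xX => /eqP ->.
have ay : a == y = false by apply: contraNF yX => /eqP <-.
have Hxa := IH' x a xNX aNX; have Hay := IH' a y aNX yNX.
have Haa := IH' a a aNX aNX.
have e0 b (f : {set I} -> R[i]) : b = false ->
    (fun V => f V - b%:R * m) = f.
  by move=> ->; apply/funext => W; rewrite mul0r subr0.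
rewrite (e0 _ (fun V => G V x a) xa) in Hxa.
rewrite (e0 _ (fun V => G V a y) ay) in Hay.
have Hi := Hinv I th (X :\ a) (fun V => G V a a) _ th0 th1 Xn' lb Haa.
have H2 := controlled_mul th0 CC0 C'0 Xn' (controlled_mul th0 C0 C0 Xn' Hxa Hay) Hi.
have LK : L <= K + L by rewrite lerDr.
have H3 := controlled_weaken th0 th1 L0 (leqnn _) LK H2.
have H4 : controlled th (X :\ a) (1 + 1 + 0) (K + L) (fun V =>
    (G V x y - (x == y)%:R * m) - (G (a |: V) x y - (x == y)%:R * m)).
  apply: controlled_ext H3 => W WX.
  have lbW := lb W WX.
  rewrite HG //; first by ring.
  - exact: aNW.
  - by rewrite in_setU1 xa /=; apply: nin xX; exact: subX.
  - by rewrite in_setU1 eq_sym ay /=; apply: nin yX; exact: subX.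
  - apply/eqP => e; move: lbW; rewrite e cmod0; apply/negP.
    by rewrite -ltNge.
by have := H4 s V us' sX' VX'; rewrite addn0 addSn.
Qed.

End SchurFamily.

(** * Resolvents of Hermitian matrices and of their minors *)

Section Resolvent.
Variables (R : realType) (N : nat).
Implicit Types (h A : 'M[R[i]]_N) (z : R[i]) (V : {set 'I_N}).

Definition is_hermitian h := forall k l, h l k = (h k l)^*.

Definition resolvent z h : 'M[R[i]]_N := invmx (h - z%:M).

Definition zero_rows V h : 'M[R[i]]_N :=
  \matrix_(k, l) if (k \in V) || (l \in V) then 0 else h k l.

Lemma zero_rows_hermitian V h : is_hermitian h -> is_hermitian (zero_rows V h).
Proof.
by move=> H k l; rewrite !mxE orbC; case: ifP => _; rewrite ?rmorph0 // -H.
Qed.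

Lemma zero_rows0 h : zero_rows finset.set0 h = h.
Proof. by apply/matrixP => k l; rewrite !mxE !inE. Qed.

Lemma zero_rowsU1 a V h :
  zero_rows (a |: V) h = zero_rows [set a]%SET (zero_rows V h).
Proof.
apply/matrixP => k l; rewrite !mxE !inE.
by case: (k == a); case: (l == a); case: (k \in V); case: (l \in V).
Qed.

Lemma mul_conjE z : z^* * z = (cmod z ^+ 2)%:C.
Proof.
case: z => a b; rewrite /Normc.normc sqr_sqrtr ?addr_ge0 ?sqr_ge0//.
by apply/eqP; rewrite eq_complex /=; apply/andP; split; apply/eqP; ring.
Qed.

(** The quadratic form of a Hermitian matrix is real, so only [- z] contributes
    to the imaginary part. *)
Lemma Im_quadratic_form h z (v : 'rV[R[i]]_N) : is_hermitian h ->
  complex.Im (\sum_l (v *m (h - z%:M)) 0 l * (v 0 l)^*) =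
  - (complex.Im z * \sum_l cmod (v 0 l) ^+ 2).
Proof.
move=> hh; rewrite mulmxBr mul_mx_scalar.
under eq_bigr do rewrite !mxE mulrBl.
rewrite big_split /= raddfD /=.
set q := \sum_i (_ * _); have qq : q^* = q.
  rewrite rmorph_sum /= /q.
  under eq_bigr => l _ do rewrite rmorphM rmorph_sum /= mulr_suml.
  under [RHS]eq_bigr => l _ do rewrite mulr_suml.
  rewrite exchange_big /=; apply: eq_bigr => k _; apply: eq_bigr => l _.
  by rewrite rmorphM /= conjcK -hh; ring.
have -> : complex.Im q = 0.
  by move: qq; case: (q) => a b /= [] /eqP; rewrite eq_sym -addr_eq0 -mulr2n
    mulrn_eq0 /= => /eqP.
rewrite add0r sumrN raddfN /=; congr (- _).
under eq_bigr => l _ do rewrite -mulrA [v 0 l * _]mulrC mul_conjE.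
rewrite -mulr_sumr -rmorph_sum /=.
by case: z => a b /=; rewrite mulr0 add0r.
Qed.

Lemma resolvent_unitmx h z : is_hermitian h -> 0 < complex.Im z ->
  h - z%:M \in unitmx.
Proof.
move=> hh z0; rewrite unitmxE unitfE; apply/det0P => -[v v0 vh].
have := Im_quadratic_form z v hh.
rewrite vh big1 => [|l _]; last by rewrite mxE mul0r.
move/eqP; rewrite eq_sym oppr_eq0 mulf_eq0 gt_eqF //= psumr_eq0 => [|l _]; last first.
  exact: sqr_ge0.
move/allP => H; move/eqP: v0; apply; apply/rowP => l; rewrite mxE.
have := H l (mem_index_enum l); rewrite /= sqrf_eq0 => /eqP.
exact: Normc.eq0_normc.
Qed.

(** For the row [v] of the resolvent with index [x], the quadratic form at [v] is
    the conjugate of [v x], so [eta * |v|^2] is at most [|v x|]. *)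
Lemma cmod_resolvent h z x y : is_hermitian h -> 0 < complex.Im z ->
  cmod (resolvent z h x y) <= (complex.Im z)^-1.
Proof.
move=> hh z0; pose v := row x (resolvent z h).
have := Im_quadratic_form z v hh.
rewrite -row_mul mulVmx ?resolvent_unitmx// (bigD1 x) //= big1 => [|l lx]; last first.
  by rewrite !mxE eq_sym (negbTE lx) mul0r.
rewrite !mxE eqxx mul1r addr0 => e.
have le1 w : complex.Im z * cmod (v 0 w) ^+ 2 <= cmod (v 0 x).
  apply: (@le_trans _ _ (complex.Im z * \sum_l cmod (v 0 l) ^+ 2)).
    rewrite ler_wpM2l ?(ltW z0)// [leRHS](bigD1 w) //= lerDl sumr_ge0// => l _.
    exact: sqr_ge0.
  rewrite -[leLHS]opprK -e -cmod_conj mxE; apply: le_trans (ler_Im_cmod _).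
  by rewrite -normrN ler_norm.
have le2 : cmod (v 0 x) <= (complex.Im z)^-1.
  have := le1 x; rewrite expr2 mulrA; have := cmod_ge0 (v 0 x).
  rewrite le_eqVlt => /orP[/eqP <- _|p]; first by rewrite invr_ge0 ltW.
  by rewrite -[X in _ <= X -> _]mul1r ler_pM2r// mulrC -ler_pdivlMr// mul1r.
have -> : resolvent z h x y = v 0 y by rewrite mxE.
have := le_trans (le1 y) le2.
rewrite mulrC -ler_pdivlMr // -expr2 ler_sqr ?nnegrE ?cmod_ge0 ?invr_ge0 ?(ltW z0)//.
Qed.

(** Schur's complement formula. As the removed row and column are replaced by
    zeros, the resolvent of the minor has the diagonal entry [- z^-1] there. *)
Lemma resolvent_minor A z a x y : is_hermitian A -> 0 < complex.Im z ->
  resolvent z A a a != 0 -> x != a -> y != a ->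
  resolvent z (zero_rows [set a]%SET A) x y =
  resolvent z A x y - resolvent z A x a * resolvent z A a y / resolvent z A a a.
Proof.
move=> hA z0 Gaa xa ya; set G := resolvent z A.
pose K : 'M[R[i]]_N := \matrix_(i, j)
  if (i == a) || (j == a) then (if i == j then - z^-1 else 0)
  else G i j - G i a * G a j / G a a.
have zn0 : z != 0 by apply/eqP => e; move: z0; rewrite e ltxx.
have AG : (A - z%:M) *m G = 1%:M by rewrite mulmxV ?resolvent_unitmx.
have KE : (zero_rows [set a]%SET A - z%:M) *m K = 1%:M.
  apply/matrixP => i j; rewrite mxE [RHS]mxE.
  have [ia|ia] := eqVneq i a.
    rewrite (bigD1 i) //= big1 => [|s si]; last first.
      by rewrite !mxE !inE ia eqxx /= -ia eq_sym (negbTE si) subr0 mul0r.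
    rewrite !mxE !inE ia !eqxx /= sub0r addr0 mulr1n.
    by case: eqP => _; rewrite ?mulr0 // mulNr mulrN divff // opprK.
  have [ja|ja] := eqVneq j a.
    have -> : (i == j) = false by rewrite ja (negbTE ia).
    rewrite big1 // => s _.
    rewrite !mxE !inE ja eqxx (negbTE ia) /= orbT.
    have [->|sa] := eqVneq s a; last by rewrite mulr0.
    by rewrite (negbTE ia) subr0 mul0r.
  transitivity (\sum_s ((A - z%:M) i s * G s j -
      (A - z%:M) i s * G s a * (G a j / G a a))).
    apply: eq_bigr => s _; rewrite !mxE !inE (negbTE ia) (negbTE ja) /= orbF.
    have [->|sa] := eqVneq s a.
      by rewrite (negbTE ia) subr0 mul0r /= -mulrA [G a a * _]mulrC divfK// subrr.
    by rewrite mulrBr !mulrA.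
  rewrite sumrB -mulr_suml.
  have -> : \sum_i0 (A - z%:M) i i0 * G i0 j = ((A - z%:M) *m G) i j by rewrite mxE.
  have -> : \sum_i0 (A - z%:M) i i0 * G i0 a = ((A - z%:M) *m G) i a by rewrite mxE.
  by rewrite AG !mxE (negbTE ia) mul0r subr0.
have -> : resolvent z (zero_rows [set a]%SET A) = K.
  rewrite /resolvent -[LHS]mulmx1 -KE mulmxA mulVmx ?mul1mx//.
  by case: (mulmx1_unit KE).
by rewrite mxE (negbTE xa) (negbTE ya).
Qed.

Lemma resolvent_schur_family h z : is_hermitian h -> 0 < complex.Im z ->
  schur_family (fun V x y => resolvent z (zero_rows V h) x y).
Proof.
move=> hh z0 V a x y aV; rewrite !in_setU1 !negb_or.
move=> /andP[xa _] /andP[ya _] Gaa; rewrite zero_rowsU1 resolvent_minor //.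
exact: zero_rows_hermitian.
Qed.

Definition max_deviation (m : R[i]) z h : R :=
  \big[Num.max/0]_(x < N) \big[Num.max/0]_(y < N)
    cmod (resolvent z h x y - (x == y)%:R * m).

Lemma le_max_deviation m z h x y :
  cmod (resolvent z h x y - (x == y)%:R * m) <= max_deviation m z h.
Proof.
rewrite /max_deviation; apply: le_trans (le_bigmax _ _ x).
exact: (le_bigmax _ (fun y => cmod (resolvent z h x y - (x == y)%:R * m)) y).
Qed.

End Resolvent.

(** * Monomials in resolvent entries *)

Section Monomials.
Variables (R : realType) (Delta : admissible_graph).

Definition mx_monomial (N : nat) (m z : R[i])
    (a : {ffun gsum Delta -> 'I_N}) (mu : {ffun gext Delta -> 'I_N})
    (h : 'M[R[i]]_N) : R[i] :=
  \prod_(e : gedge Delta)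
    (if gstar e then ((resolvent z h)^t*)%sesqui - (m^*)%:M
     else resolvent z h - m%:M)
      (vertex_index a mu (gsrc e)) (vertex_index a mu (gtgt e)).

Lemma monomialE d (T : measurableType d) (N : nat) (H : T -> 'M[R[i]]_N)
    z a mu t :
  monomial (Delta := Delta) H z a mu t = mx_monomial (msc z) z a mu (H t).
Proof. by []. Qed.

Lemma mx_monomial_entryE N (m z : R[i]) (h : 'M[R[i]]_N) (b : bool) x y :
  (if b then ((resolvent z h)^t*)%sesqui - (m^*)%:M
     else resolvent z h - m%:M) x y =
  if b then (resolvent z h y x - (y == x)%:R * m)^*
  else resolvent z h x y - (x == y)%:R * m.
Proof.
case: b; rewrite !mxE ?[_%:R * m]mulr_natl //.
by rewrite rmorphB rmorphMn eq_sym.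
Qed.

Lemma fdiff_cst (I : finType) (U : zmodType) (c : U) s (V : {set I}) :
  fdiff s (fun=> c) V = if s is [::] then c else 0.
Proof. by elim: s c => [//|a s IH] c; rewrite /= subrr IH; case: (s). Qed.

(** The product rule over the edges: every edge is small to first order and gains
    [theta] with each difference in a row that is not one of its indices. *)
Lemma mx_monomial_controlled (n : nat) (c : R) : 0 < c ->
  exists C theta0 : R, [/\ 0 <= C, 0 < theta0 &
  forall N (m z : R[i]) (h : 'M[R[i]]_N)
    (a : {ffun gsum Delta -> 'I_N}) (mu : {ffun gext Delta -> 'I_N})
    (X : {set 'I_N}) (theta : R),
  0 <= theta <= theta0 -> is_hermitian h -> 0 < complex.Im z -> c <= cmod m ->
  max_deviation m z h <= theta -> (#|X| <= n)%N ->
  (forall i, a i \notin X) -> (forall j, mu j \notin X) ->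
  controlled theta X (deg Delta) C
    (fun V : {set 'I_N} => mx_monomial m z a mu (zero_rows V h))].
Proof.
move=> c0.
have [K K1 HK] := schur_family_close n c0.
have K0 : 0 <= K by exact: le_trans K1.
have [C C0 HC] := schur_family_controlled n c0 K0.
pose B := fix B k := if k is k'.+1 then 2 ^+ n * (C * B k') else 1 : R.
have B0 k : 0 <= B k.
  by elim: k => [|k IH] /=; rewrite ?ler01// !mulr_ge0 ?exprn_ge0.
exists (B (deg Delta)), (Num.min 1 (c / 2 / K)); split => //.
  by rewrite lt_min ltr01 !divr_gt0// (lt_le_trans ltr01).
move=> N m z h a mu X th; rewrite le_min => /and3P[th0 th1 thK] hh z0 cm Lth Xn aX muX.
have Kth : K * th <= c / 2.
  by move: thK; rewrite ler_pdivlMr ?(lt_le_trans ltr01)// mulrC.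
have HG := resolvent_schur_family hh z0.
have cl (V : {set 'I_N}) : V \subset X -> forall x y, x \notin V -> y \notin V ->
    cmod (resolvent z (zero_rows V h) x y - (x == y)%:R * m) <= K * th.
  move=> VX; apply: (HK _ th (fun V => resolvent z (zero_rows V h))) => //.
    move=> x y _ _; rewrite zero_rows0; apply: le_trans Lth.
    exact: le_max_deviation.
  by apply: leq_trans Xn; exact: subset_leq_card.
have uX v : vertex_index a mu v \notin X by case: v.
have ctl x y : x \notin X -> y \notin X ->
   controlled th X 1 C (fun V => resolvent z (zero_rows V h) x y - (x == y)%:R * m).
  by move=> xX yX; apply: (HC _ th (fun V => resolvent z (zero_rows V h))).
rewrite /deg cardE -/(enum (gedge Delta)).
have -> : (fun V => mx_monomial m z a mu (zero_rows V h)) =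
  fun V => \prod_(e <- enum (gedge Delta))
    (if gstar e then
       (resolvent z (zero_rows V h) (vertex_index a mu (gtgt e)) (vertex_index a mu (gsrc e))
         - (vertex_index a mu (gtgt e) == vertex_index a mu (gsrc e))%:R * m)^*
     else resolvent z (zero_rows V h) (vertex_index a mu (gsrc e)) (vertex_index a mu (gtgt e))
         - (vertex_index a mu (gsrc e) == vertex_index a mu (gtgt e))%:R * m).
  apply/funext => V; rewrite /mx_monomial big_enum /=.
  by apply: eq_bigr => e _; rewrite mx_monomial_entryE.
elim: (enum _) => [|e r IH].
  move=> s V us sX VX; under [X in fdiff _ X]funext do rewrite big_nil.
  rewrite fdiff_cst; case: s us sX => [|b s] _ _.
    by rewrite cmod1 expr0 mulr1.
  by rewrite cmod0 mulr_ge0// exprn_ge0.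
have ctl' : controlled th X 1 C (fun V =>
    (if gstar e then
       (resolvent z (zero_rows V h) (vertex_index a mu (gtgt e)) (vertex_index a mu (gsrc e))
         - (vertex_index a mu (gtgt e) == vertex_index a mu (gsrc e))%:R * m)^*
     else resolvent z (zero_rows V h) (vertex_index a mu (gsrc e)) (vertex_index a mu (gtgt e))
         - (vertex_index a mu (gsrc e) == vertex_index a mu (gtgt e))%:R * m)).
  case: (gstar e); last exact: ctl.
  move=> s V us sX VX; rewrite (fdiff_morph (@conjc R)) cmod_conj.
  exact: ctl.
have := controlled_mul th0 C0 (B0 (size r)) Xn ctl' IH.
by rewrite add1n; apply: controlled_ext => V _; rewrite big_cons.
Qed.

Lemma cmod_mx_monomial N (m z : R[i]) a mu (h : 'M[R[i]]_N) :
  is_hermitian h -> 0 < complex.Im z ->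
  cmod (mx_monomial m z a mu h) <= ((complex.Im z)^-1 + cmod m) ^+ deg Delta.
Proof.
move=> hh z0; rewrite cmod_prod.
have e0 x y : cmod (resolvent z h x y - (x == y)%:R * m) <= (complex.Im z)^-1 + cmod m.
  apply: (le_trans (cmodB _ _)); rewrite lerD ?cmod_resolvent//.
  by case: (x == y); rewrite ?mul1r// mul0r cmod0 cmod_ge0.
rewrite /deg -prodr_const; apply: ler_prod => e _; rewrite cmod_ge0 /=.
by rewrite mx_monomial_entryE; case: ifP => _; rewrite ?cmod_conj.
Qed.

End Monomials.

(** * Bounded random variables *)

Section BoundedRandomVariables.
Context {R : realType} {d : measure_display} {T : measurableType d}.
Variable P : probability T R.
Implicit Types f g : T -> R.

Definition bounded_rv f : Prop :=
  measurable_fun setT f /\ exists C : R, forall x, `|f x| <= C.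

Definition expect f : R := Rintegral P setT f.

Lemma bounded_rv_integrable f : bounded_rv f -> P.-integrable setT (EFin \o f).
Proof.
move=> [mf [C fC]]; apply: measurable_bounded_integrable => //.
  by apply: le_lt_trans (probability_le1 _ _) _ => //; rewrite ltry.
exists C; split; first exact: num_real.
by move=> M CM x _ /=; rewrite (le_trans (fC x))// ltW.
Qed.

Lemma bounded_rv_cst c : bounded_rv (fun=> c).
Proof. by split; [exact: measurable_cst|exists `|c|]. Qed.

Lemma bounded_rvD f g : bounded_rv f -> bounded_rv g ->
  bounded_rv (fun x => f x + g x).
Proof.
move=> [mf [C fC]] [mg [D gD]]; split; first exact: measurable_funD.
by exists (C + D) => x; rewrite (le_trans (ler_normD _ _))// lerD.
Qed.

Lemma bounded_rvM f g : bounded_rv f -> bounded_rv g ->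
  bounded_rv (fun x => f x * g x).
Proof.
move=> [mf [C fC]] [mg [D gD]]; split; first exact: measurable_funM.
by exists (C * D) => x; rewrite normrM ler_pM.
Qed.

Lemma bounded_rvZ c f : bounded_rv f -> bounded_rv (fun x => c * f x).
Proof. by move=> bf; apply: bounded_rvM => //; exact: bounded_rv_cst. Qed.

Lemma bounded_rvB f g : bounded_rv f -> bounded_rv g ->
  bounded_rv (fun x => f x - g x).
Proof.
move=> bf bg; have := bounded_rvD bf (bounded_rvZ (-1) bg).
by congr bounded_rv; apply/funext => x; rewrite mulN1r.
Qed.

Lemma bounded_rv_norm f : bounded_rv f -> bounded_rv (fun x => `|f x|).
Proof.
move=> [mf [C fC]]; split; first exact: measurableT_comp.
by exists C => x; rewrite normr_id.
Qed.

Lemma bounded_rvX n f : bounded_rv f -> bounded_rv (fun x => f x ^+ n).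
Proof.
move=> bf; elim: n => [|n IH].
  rewrite [X in bounded_rv X](_ : _ = fun=> 1); first exact: bounded_rv_cst.
  by apply/funext => x; rewrite expr0.
rewrite [X in bounded_rv X](_ : _ = fun x => f x * f x ^+ n); first exact: bounded_rvM.
by apply/funext => x; rewrite exprS.
Qed.

Lemma bounded_rv_sum (I : Type) (r : seq I) (p : pred I) (F : I -> T -> R) :
  (forall i, p i -> bounded_rv (F i)) ->
  bounded_rv (fun x => \sum_(i <- r | p i) F i x).
Proof.
move=> bF; elim: r => [|i r IH].
  rewrite [X in bounded_rv X](_ : _ = fun=> 0); first exact: bounded_rv_cst.
  by apply/funext => x; rewrite big_nil.
rewrite [X in bounded_rv X](_ : _ = fun x =>
  (if p i then F i x else 0) + \sum_(j <- r | p j) F j x); last first.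
  by apply/funext => x; rewrite big_cons; case: ifP; rewrite ?add0r.
apply: bounded_rvD => //; case pi: (p i); first exact: bF.
exact: bounded_rv_cst.
Qed.

Lemma bounded_rv_prod (I : Type) (r : seq I) (p : pred I) (F : I -> T -> R) :
  (forall i, p i -> bounded_rv (F i)) ->
  bounded_rv (fun x => \prod_(i <- r | p i) F i x).
Proof.
move=> bF; elim: r => [|i r IH].
  rewrite [X in bounded_rv X](_ : _ = fun=> 1); first exact: bounded_rv_cst.
  by apply/funext => x; rewrite big_nil.
rewrite [X in bounded_rv X](_ : _ = fun x =>
  (if p i then F i x else 1) * \prod_(j <- r | p j) F j x); last first.
  by apply/funext => x; rewrite big_cons; case: ifP; rewrite ?mul1r.
apply: bounded_rvM => //; case pi: (p i); first exact: bF.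
exact: bounded_rv_cst.
Qed.

Lemma bounded_rv_fdiff (I : finType) (phi : {set I} -> T -> R) s V :
  (forall V, bounded_rv (phi V)) ->
  bounded_rv (fun x => fdiff s (fun W => phi W x) V).
Proof.
elim: s phi => [|a s IH] phi bphi /=; first exact: bphi.
by apply: (IH (fun W x => phi W x - phi (a |: W) x)) => W; exact: bounded_rvB.
Qed.

Lemma expect_cst c : expect (fun=> c) = c.
Proof.
transitivity (c * fine (P setT)); first exact: Rintegral_cst.
by rewrite probability_setT mulr1.
Qed.

Lemma expectD f g : bounded_rv f -> bounded_rv g ->
  expect (fun x => f x + g x) = expect f + expect g.
Proof. by move=> bf bg; apply: RintegralD => //; exact: bounded_rv_integrable. Qed.

Lemma expectB f g : bounded_rv f -> bounded_rv g ->
  expect (fun x => f x - g x) = expect f - expect g.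
Proof. by move=> bf bg; apply: RintegralB => //; exact: bounded_rv_integrable. Qed.

Lemma expectZ c f : bounded_rv f -> expect (fun x => c * f x) = c * expect f.
Proof. by move=> bf; apply: RintegralZl => //; exact: bounded_rv_integrable. Qed.

Lemma ler_expect f g : bounded_rv f -> bounded_rv g ->
  (forall x, f x <= g x) -> expect f <= expect g.
Proof.
by move=> bf bg fg; apply: le_Rintegral => //; exact: bounded_rv_integrable.
Qed.

Lemma expect_ge0 f : (forall x, 0 <= f x) -> 0 <= expect f.
Proof. by move=> f0; apply: Rintegral_ge0 => x _; exact: f0. Qed.

Lemma ler_norm_expect f : bounded_rv f -> `|expect f| <= expect (fun x => `|f x|).
Proof. by move=> bf; apply: le_normr_Rintegral => //; exact: bounded_rv_integrable. Qed.

Lemma expect_sum (I : Type) (r : seq I) (p : pred I) (F : I -> T -> R) :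
  (forall i, p i -> bounded_rv (F i)) ->
  expect (fun x => \sum_(i <- r | p i) F i x) = \sum_(i <- r | p i) expect (F i).
Proof.
move=> bF; elim: r => [|i r IH].
  rewrite big_nil -[RHS](expect_cst 0); congr expect.
  by apply/funext => x; rewrite big_nil.
have br := bounded_rv_sum r bF; rewrite big_cons -IH.
have [pi|pi] := boolP (p i); last first.
  by congr expect; apply/funext => x; rewrite big_cons (negbTE pi).
rewrite -expectD//; last exact: bF.
by congr expect; apply/funext => x; rewrite big_cons pi.
Qed.

(** Jensen's inequality, by integration of the tangent of [t ^ p] at the mean of
    [|f|]. *)
Lemma expect_jensen p f : bounded_rv f ->
  `|expect f| ^+ p <= expect (fun x => `|f x| ^+ p).
Proof.
move=> bf; case: p => [|p].
  rewrite expr0 -{1}(expect_cst 1) le_eqVlt; apply/orP; left; apply/eqP.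
  by congr expect; apply/funext => x; rewrite expr0.
have bn := bounded_rv_norm bf.
pose c := expect (fun x => `|f x|); have c0 : 0 <= c by exact: expect_ge0.
apply: (@le_trans _ _ (c ^+ p.+1)).
  by rewrite ler_pXn2r ?nnegrE// ler_norm_expect.
have tangent (y : R) : 0 <= y -> c ^+ p.+1 + p.+1%:R * c ^+ p * (y - c) <= y ^+ p.+1.
  move=> y0; elim: (p) => [|q IH]; first by rewrite expr0 expr1; lra.
  have := ler_wpM2l y0 IH; rewrite -exprS; apply: le_trans; rewrite -subr_ge0.
  set e := (X in 0 <= X); have -> : e = q.+1%:R * c ^+ q * (y - c) ^+ 2.
    by rewrite /e -[q.+2%:R]natr1 [c ^+ q.+2]exprS [c ^+ q.+1]exprS; ring.
  by rewrite mulr_ge0 ?sqr_ge0// mulr_ge0 ?exprn_ge0.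
have := ler_expect (bounded_rvD (bounded_rv_cst (c ^+ p.+1))
   (bounded_rvZ (p.+1%:R * c ^+ p) (bounded_rvB bn (bounded_rv_cst c))))
   (bounded_rvX p.+1 bn) (fun x => tangent _ (normr_ge0 (f x))).
rewrite expectD ?expect_cst ?expectZ ?expectB ?expect_cst ?subrr ?mulr0 ?addr0 //.
- exact: bounded_rv_cst.
- by apply: bounded_rvB => //; exact: bounded_rv_cst.
- exact: bounded_rv_cst.
- apply: bounded_rvZ; apply: bounded_rvB => //; exact: bounded_rv_cst.
Qed.

End BoundedRandomVariables.

(** * Conditional expectations as averages over resampled rows *)

(** [repl S h h'] stands for the sample [h] in which the rows in [S] have been
    replaced by those of an independent sample [h']. *)
Record resampling (R : realType) (d : measure_display) (T : measurableType d)
    (P : probability T R) (I : finType) (repl : {set I} -> T -> T -> T) : Prop :=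
  Resampling {
  resample_measurable : forall S,
    measurable_fun setT (fun u : T * T => repl S u.1 u.2);
  resample_law : forall S (A : set T), measurable A ->
    (P \x P)%E ((fun u : T * T => repl S u.1 u.2) @^-1` A) = P A;
  resample_absorb : forall S h h' h'', repl S (repl S h h') h'' = repl S h h'';
  resampleU : forall S S' h h' h'',
    repl S' (repl S h h') h'' = repl (S :|: S') h (repl S' h' h'')
}.

Section Resampling.
Context {R : realType} {d : measure_display} {T : measurableType d}.
Variables (P : probability T R) (I : finType) (repl : {set I} -> T -> T -> T).
Hypothesis HR : resampling P repl.
Implicit Types (f g : T -> R) (S : {set I}) (s : seq I).

Definition row_average S f : T -> R := fun h => expect P (fun h' => f (repl S h h')).

Definition row_fluct a f : T -> R := fun h => f h - row_average [set a]%SET f h.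

Definition row_flucts s f : T -> R := foldr row_fluct f s.

Definition row_free_of a f := forall h h', f (repl [set a]%SET h h') = f h.

Lemma bounded_rv_repl S h f : bounded_rv f -> bounded_rv (fun h' => f (repl S h h')).
Proof.
move=> [mf [C fC]]; split; last by exists C => x; exact: fC.
apply: measurableT_comp => //.
have mr := resample_measurable HR S.
exact: (measurableT_comp mr (pair1_measurable h)).
Qed.

Let bounded_rv_repl2 S f : bounded_rv f ->
  bounded_rv (fun u : T * T => f (repl S u.1 u.2)).
Proof.
move=> [mf [C fC]]; split; last by exists C => x; exact: fC.
exact: (measurableT_comp mf (resample_measurable HR S)).
Qed.

Let row_average_fubini S f : bounded_rv f ->
  EFin \o row_average S f = fubini_F P (fun u : T * T => (f (repl S u.1 u.2))%:E).
Proof.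
move=> bf; apply/funext => h; rewrite /row_average /expect /Rintegral /fubini_F /= fineK//.
apply: integrable_fin_num => //.
exact: (bounded_rv_integrable P (bounded_rv_repl S h bf)).
Qed.

Lemma bounded_rv_row_average S f : bounded_rv f -> bounded_rv (row_average S f).
Proof.
move=> bf; split.
  apply/measurable_EFinP; rewrite row_average_fubini//; apply: measurable_fubini_F.
  exact: (bounded_rv_integrable (P \x P)%E (bounded_rv_repl2 S bf)).
have [_ [C fC]] := bf; exists C => h.
have br := bounded_rv_repl S h bf.
apply: (le_trans (ler_norm_expect P br)).
rewrite -[leRHS](expect_cst P); apply: ler_expect => //.
  exact: bounded_rv_norm.
exact: bounded_rv_cst.
Qed.

(** The resampled sample has the law of the original one. *)
Lemma expect_row_average S f : bounded_rv f -> expect P (row_average S f) = expect P f.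
Proof.
move=> bf; rewrite /expect /Rintegral; congr fine.
rewrite -[LHS]/(\int[P]_x (EFin \o row_average S f) x)%E row_average_fubini//.
rewrite integral12_prod_meas1; last first.
  exact: (bounded_rv_integrable (P \x P)%E (bounded_rv_repl2 S bf)).
have mr := resample_measurable HR S.
have := @integral_pushforward _ _ _ _ R _ mr (P \x P)%E setT (EFin \o f).
rewrite preimage_setT => /= <- //.
- by apply: eq_measure_integral => A mA _; exact: resample_law.
- by apply/measurable_EFinP; case: bf.
- exact: (bounded_rv_integrable (P \x P)%E (bounded_rv_repl2 S bf)).
Qed.

(** By [resampleU], resampling twice is resampling the union of the rows from a
    sample that is itself resampled, and that one has the original law. *)
Lemma row_average_row_average S S' f : bounded_rv f ->
  row_average S (row_average S' f) = row_average (S :|: S') f.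
Proof.
move=> bf; apply/funext => h.
rewrite [RHS]/row_average -(expect_row_average S' (bounded_rv_repl (S :|: S') h bf)).
rewrite /row_average; congr (expect P _); apply/funext => h'; congr (expect P _).
by apply/funext => h''; rewrite (resampleU HR).
Qed.

Lemma row_averageC S S' f : bounded_rv f ->
  row_average S (row_average S' f) = row_average S' (row_average S f).
Proof. by move=> bf; rewrite !row_average_row_average// finset.setUC. Qed.

Lemma row_averageB S f g : bounded_rv f -> bounded_rv g ->
  row_average S (fun x => f x - g x) = (fun x => row_average S f x - row_average S g x).
Proof.
move=> bf bg; apply/funext => h; rewrite /row_average expectB//; exact: bounded_rv_repl.
Qed.

Lemma row_free_of_row_average a f : row_free_of a (row_average [set a]%SET f).
Proof.
move=> h h'; rewrite /row_average; congr (expect P _); apply/funext => h''.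
by rewrite (resample_absorb HR).
Qed.

Lemma row_average_row_free a f : row_free_of a f -> row_average [set a]%SET f = f.
Proof.
move=> fa; apply/funext => h; rewrite /row_average.
by under [X in expect P X]eq_fun do rewrite fa; rewrite expect_cst.
Qed.

Lemma bounded_rv_row_fluct a f : bounded_rv f -> bounded_rv (row_fluct a f).
Proof. by move=> bf; apply: bounded_rvB => //; exact: bounded_rv_row_average. Qed.

Lemma bounded_rv_row_flucts s f : bounded_rv f -> bounded_rv (row_flucts s f).
Proof. by move=> bf; elim: s => //= a s; exact: bounded_rv_row_fluct. Qed.

Lemma row_average_row_fluctC S a f : bounded_rv f ->
  row_average S (row_fluct a f) = row_fluct a (row_average S f).
Proof.
move=> bf; rewrite /row_fluct (row_averageB S bf (bounded_rv_row_average [set a]%SET bf)).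
by rewrite row_averageC.
Qed.

Lemma row_fluctC a b f : bounded_rv f ->
  row_fluct a (row_fluct b f) = row_fluct b (row_fluct a f).
Proof.
move=> bf; have bp := bounded_rv_row_average _ bf.
rewrite /row_fluct (row_averageB _ bf (bp [set b]%SET)).
rewrite (row_averageB _ bf (bp [set a]%SET)).
by rewrite (row_averageC [set a]%SET)//; apply/funext => h; ring.
Qed.

Lemma row_flucts_row_fluctC s a f : bounded_rv f ->
  row_flucts s (row_fluct a f) = row_fluct a (row_flucts s f).
Proof.
move=> bf; elim: s => //= b s ->; rewrite row_fluctC//; exact: bounded_rv_row_flucts.
Qed.

Lemma row_flucts_row_averageC s S f : bounded_rv f ->
  row_flucts s (row_average S f) = row_average S (row_flucts s f).
Proof.
move=> bf; elim: s => //= b s ->; rewrite row_average_row_fluctC//; exact: bounded_rv_row_flucts.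
Qed.

Lemma row_fluctsC s s' f : bounded_rv f ->
  row_flucts s (row_flucts s' f) = row_flucts s' (row_flucts s f).
Proof.
move=> bf; elim: s => //= b s ->; rewrite -row_flucts_row_fluctC//; exact: bounded_rv_row_flucts.
Qed.

Lemma row_average_row_fluct a f : bounded_rv f ->
  row_average [set a]%SET (row_fluct a f) = fun=> 0.
Proof.
move=> bf; rewrite /row_fluct row_averageB//; last exact: bounded_rv_row_average.
by rewrite row_average_row_average// finset.setUid; apply/funext => h; rewrite subrr.
Qed.

Lemma row_average_row_flucts a s f : bounded_rv f ->
  a \in s -> row_average [set a]%SET (row_flucts s f) = fun=> 0.
Proof.
move=> bf; elim: s => //= b s IH; rewrite inE => /orP[/eqP->|/IH].
  by rewrite row_average_row_fluct//; exact: bounded_rv_row_flucts.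
rewrite row_average_row_fluctC => [->|]; last exact: bounded_rv_row_flucts.
by apply/funext => h; rewrite /row_fluct /row_average expect_cst subrr.
Qed.

Lemma row_fluctsB s f g : bounded_rv f -> bounded_rv g ->
  row_flucts s (fun x => f x - g x) = (fun x => row_flucts s f x - row_flucts s g x).
Proof.
move=> bf bg; elim: s => //= a s ->; apply/funext => h.
rewrite /row_fluct row_averageB; [by ring|exact: bounded_rv_row_flucts..].
Qed.

(** Subtracting quantities that do not depend on the row [a] is invisible to
    [row_fluct a], so [row_flucts s] sees only the iterated difference of [phi]. *)
Lemma row_flucts_fdiff (phi : {set I} -> T -> R) s (V : {set I}) :
  (forall W : {set I}, bounded_rv (phi W)) ->
  (forall (W : {set I}) a, a \in W -> row_free_of a (phi W)) ->
  row_flucts s (phi V) = row_flucts s (fun h => fdiff s (fun W => phi W h) V).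
Proof.
move=> bphi phifree; elim: s => [//|a s IH].
under [X in _ = row_flucts _ X]eq_fun do rewrite fdiff_cons.
have bf W := bounded_rv_fdiff s W bphi.
rewrite row_fluctsB// /= -IH; apply/funext => h.
rewrite -[LHS]subr0; congr (_ - _); apply/esym.
rewrite -row_flucts_row_fluctC//; set g := row_fluct a _; have -> : g = fun=> 0.
  apply/funext => k; rewrite /g /row_fluct row_average_row_free ?subrr// => k1 k2.
  rewrite -!fdiff_shift; congr (fdiff s _ V); apply/funext => W.
  by apply: phifree; rewrite !inE eqxx.
elim: s {IH bf g} h => //= b s IH h; rewrite /row_fluct IH /row_average.
by under [X in expect P X]eq_fun do rewrite IH; rewrite expect_cst subrr.
Qed.

Lemma expect_row_fluct_mul a f g : bounded_rv f -> bounded_rv g -> row_free_of a g ->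
  expect P (fun x => row_fluct a f x * g x) = 0.
Proof.
move=> bf bg ga; have bq := bounded_rv_row_fluct a bf.
rewrite -(expect_row_average [set a]%SET); last exact: bounded_rvM.
rewrite (_ : row_average _ _ = fun=> 0) ?expect_cst//; apply/funext => h.
rewrite /row_average; under [X in expect P X]eq_fun do rewrite ga mulrC.
rewrite expectZ; last exact: bounded_rv_repl.
have := congr1 (fun k => k h) (row_average_row_fluct a bf); rewrite /row_average => ->.
by rewrite mulr0.
Qed.

End Resampling.

(** * The sample space of the entries on and above the diagonal *)

Section SampleSpace.
Variables (R : realType) (N : nat).

Definition sample : Type := 'M[R[i]]_N.
HB.instance Definition _ := Choice.on sample.
HB.instance Definition _ := isPointed.Build sample (0 : 'M[R[i]]_N).

Definition upper_rectangle (J : {set 'I_N * 'I_N})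
    (B : 'I_N * 'I_N -> set (measurableTypeR R * measurableTypeR R)) :
    set sample :=
  [set h : 'M[R[i]]_N | forall k, k \in J -> B k (to_plane (h k.1 k.2))].

Definition upper_indices : {set 'I_N * 'I_N} :=
  [set k : 'I_N * 'I_N | (k.1 <= k.2)%N]%SET.

(** Only the entries on and above the diagonal are independent, so only they
    generate the sigma-algebra; the rectangles form a pi-system. *)
Definition upper_rectangles : set (set sample) :=
  [set A | exists2 B, forall k, measurable (B k) &
                      A = upper_rectangle upper_indices B].

Definition sample_space := g_sigma_algebraType upper_rectangles.

Lemma upper_rectangles_setI : setI_closed upper_rectangles.
Proof.
move=> _ _ [B mB ->] [B' mB' ->]; exists (fun k => B k `&` B' k).
  by move=> k; exact: measurableI.
apply/seteqP; split => h /=.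
  by move=> [H1 H2] k kJ; split; [exact: H1|exact: H2].
by move=> H; split => k kJ; have [] := H k kJ.
Qed.

Lemma upper_rectangle_measurable (J : {set 'I_N * 'I_N}) B : J \subset upper_indices ->
  (forall k, k \in J -> measurable (B k)) ->
  measurable (upper_rectangle J B : set sample_space).
Proof.
move=> JU mB; apply: sub_sigma_algebra.
exists (fun k => if k \in J then B k else setT).
  by move=> k; case: ifP => [/mB|_]; last exact: measurableT.
apply/seteqP; split => h /= H k kJ; first by case: ifP => // /H.
by have := H k (fintype.subsetP JU _ kJ); rewrite kJ.
Qed.

Lemma measurable_sample_coord (k : 'I_N * 'I_N) : k \in upper_indices ->
  measurable_fun setT (fun h : sample_space =>
    to_plane ((h : 'M[R[i]]_N) k.1 k.2)).
Proof.
move=> kU _ B mB; rewrite setTI.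
have := @upper_rectangle_measurable [set k]%SET (fun=> B) _ (fun _ _ => mB).
rewrite finset.sub1set => /(_ kU); congr measurable.
apply/seteqP; split => h /=; first by apply; rewrite inE.
by move=> Bh k'; rewrite inE => /eqP ->.
Qed.

Lemma measurable_to_sample d (X : measurableType d) (F : X -> sample_space) :
  (forall k, k \in upper_indices ->
    measurable_fun setT (fun x => to_plane ((F x : 'M[R[i]]_N) k.1 k.2))) ->
  measurable_fun setT F.
Proof.
move=> mF; apply: (@measurability _ _ X sample_space setT F upper_rectangles) => [|].
  by [].
move=> _ [_ [B mB ->] <-]; rewrite setTI.
rewrite (_ : _ @^-1` _ = \bigcap_(k in [set k | k \in upper_indices])
    ((fun x => to_plane ((F x : 'M[R[i]]_N) k.1 k.2)) @^-1` B k)); last first.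
  by apply/seteqP; split.
apply: fin_bigcap_measurable; first exact: finite_finset.
by move=> k kU; rewrite -[X in measurable X]setTI; apply: mF.
Qed.

Definition replace_rows (S : {set 'I_N}) (h h' : sample) : sample :=
  (\matrix_(k, l) if (k \in S) || (l \in S) then (h' : 'M[R[i]]_N) k l
                  else (h : 'M[R[i]]_N) k l)%R.

Lemma measurable_replace_rows S :
  measurable_fun setT
    (fun u : sample_space * sample_space => replace_rows S u.1 u.2 : sample_space).
Proof.
apply: measurable_to_sample => k kU.
have mc := measurable_sample_coord kU.
have [kS|kS] := boolP ((k.1 \in S) || (k.2 \in S)).
  rewrite (_ : (fun x => _) = fun u : sample_space * sample_space =>
     to_plane ((u.2 : 'M[R[i]]_N) k.1 k.2)); last first.
    by apply/funext => u; rewrite mxE kS.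
  exact: (measurableT_comp mc measurable_snd).
rewrite (_ : (fun x => _) = fun u : sample_space * sample_space =>
   to_plane ((u.1 : 'M[R[i]]_N) k.1 k.2)); last first.
  by apply/funext => u; rewrite mxE (negbTE kS).
exact: (measurableT_comp mc measurable_fst).
Qed.

End SampleSpace.

Arguments replace_rows {R N} S h h'.

Section SampleLaw.
Context {R : realType} {d : measure_display} {T : measurableType d}.
Variables (P : probability T R) (N : nat) (X : {mfun T >-> sample_space R N}).
Hypothesis indepX : mutually_independent P (upper_indices N)
  (fun k t => (X t : 'M[R[i]]_N) k.1 k.2).

Let law : probability (sample_space R N) R := distribution P X.

Let law_rectangle (J : {set 'I_N * 'I_N}) B : J \subset upper_indices N ->
  (forall k, k \in J -> measurable (B k)) ->
  law (upper_rectangle J B) =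
  (\prod_(k in J) P [set t | B k (to_plane ((X t : 'M[R[i]]_N) k.1 k.2))])%E.
Proof. by move=> JU mB; exact: indepX. Qed.

(** Since the entries are independent, exchanging the rows in [S] for
    independent copies does not change the joint law. *)
Lemma sample_resampling : resampling law (@replace_rows R N).
Proof.
split.
- exact: measurable_replace_rows.
- move=> S A mA.
  have mr := @measurable_replace_rows R N S.
  pose F : {mfun (sample_space R N * sample_space R N)%type >-> sample_space R N} :=
    HB.pack (fun u : sample_space R N * sample_space R N =>
               replace_rows S u.1 u.2 : sample_space R N)
            (isMeasurableFun.Build _ _ _ _ _ mr).
  rewrite -[LHS]/(distribution (law \x law)%E F A).
  apply: (@measure_unique _ R (sample_space R N) (@upper_rectangles R N) (fun=> setT) _ _ _ _ (distribution (law \x law)%E F) law) => //.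
  - exact: upper_rectangles_setI.
  - move=> _; exists (fun=> setT) => [k|]; first exact: measurableT.
    by apply/seteqP; split.
  - by rewrite bigcup_const //; exists 0%N.
  - move=> _ [B mB ->].
    pose J := [set k in upper_indices N | (k.1 \in S) || (k.2 \in S)]%SET.
    have JU : J \subset upper_indices N.
      by apply/fintype.subsetP => k; rewrite inE => /andP[].
    have JU' : upper_indices N :\: J \subset upper_indices N by exact: finset.subsetDl.
    rewrite [RHS]law_rectangle//.
    rewrite (big_setID J) /= (finset.setIidPr JU).
    rewrite -!law_rectangle// muleC.
    rewrite -(@product_measure1E _ _ _ _ R law law) //; last 2 first.
    - exact: upper_rectangle_measurable.
    - exact: upper_rectangle_measurable.
    rewrite -[LHS]/((law \x law)%E _); congr ((law \x law)%E _).
    apply/seteqP; split => -[h h'] /=.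
      move=> H; split => k kJ.
        have kU := fintype.subsetP JU' _ kJ; have := H k kU; rewrite mxE ifF//.
        by move: kJ; rewrite finset.in_setD andbC kU inE kU => /negbTE.
      have kU := fintype.subsetP JU _ kJ; have := H k kU; rewrite mxE ifT//.
      by move: kJ; rewrite inE kU.
    move=> [H1 H2] k kU; rewrite mxE; case: ifP => kS.
      by apply: H2; rewrite inE kU.
    by apply: H1; rewrite finset.in_setD kU inE kU kS.
  - by move=> k; apply: le_lt_trans (probability_le1 _ _) _ => //; rewrite ltry.
- move=> S h h' h''; apply/matrixP => k l; rewrite !mxE.
  by case: (_ || _).
- move=> S S' h h' h''; apply/matrixP => k l; rewrite !mxE !inE.
  by case: (k \in S); case: (l \in S); case: (k \in S'); case: (l \in S').
Qed.

End SampleLaw.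

(** * Measurability of resolvent monomials *)

Section ComplexMeasurable.
Context {R : realType} {d : measure_display} {X : measurableType d}.
Implicit Types f g : X -> R[i].

Definition cmeasurable f : Prop :=
  measurable_fun setT (fun x => complex.Re (f x)) /\
  measurable_fun setT (fun x => complex.Im (f x)).

Lemma cmeasurable_to_plane f :
  cmeasurable f <-> measurable_fun setT (fun x => to_plane (f x)).
Proof.
split=> [[mr mi]|mf]; first exact: (measurable_fun_pair mr mi).
by split; [exact: (measurableT_comp measurable_fst mf)|
           exact: (measurableT_comp measurable_snd mf)].
Qed.

Lemma cmeasurable_cst c : cmeasurable (fun=> c).
Proof. by split; exact: measurable_cst. Qed.

Lemma cmeasurableD f g : cmeasurable f -> cmeasurable g ->
  cmeasurable (fun x => f x + g x).
Proof.
move=> [fr fi] [gr gi]; split.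
  rewrite (_ : (fun x => _) = fun x => complex.Re (f x) + complex.Re (g x)).
    exact: measurable_funD.
  by apply/funext => x; rewrite raddfD.
rewrite (_ : (fun x => _) = fun x => complex.Im (f x) + complex.Im (g x)).
  exact: measurable_funD.
by apply/funext => x; rewrite raddfD.
Qed.

Lemma cmeasurableM f g : cmeasurable f -> cmeasurable g ->
  cmeasurable (fun x => f x * g x).
Proof.
move=> [fr fi] [gr gi]; split.
  rewrite (_ : (fun x => _) = fun x => complex.Re (f x) * complex.Re (g x) -
     complex.Im (f x) * complex.Im (g x)).
    by apply: measurable_funB; exact: measurable_funM.
  by apply/funext => x; case: (f x) => a b; case: (g x).
rewrite (_ : (fun x => _) = fun x => complex.Re (f x) * complex.Im (g x) +
     complex.Im (f x) * complex.Re (g x)).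
  by apply: measurable_funD; exact: measurable_funM.
by apply/funext => x; case: (f x) => a b; case: (g x).
Qed.

Lemma cmeasurable_conj f : cmeasurable f -> cmeasurable (fun x => (f x)^*).
Proof.
move=> [fr fi]; split.
  rewrite (_ : (fun x => _) = fun x => complex.Re (f x)) //.
  by apply/funext => x; case: (f x).
rewrite (_ : (fun x => _) = fun x => - complex.Im (f x)).
  exact: measurable_funN.
by apply/funext => x; case: (f x).
Qed.

Lemma cmeasurableB f g : cmeasurable f -> cmeasurable g ->
  cmeasurable (fun x => f x - g x).
Proof.
move=> mf mg; have := cmeasurableD mf (cmeasurableM (cmeasurable_cst (-1)) mg).
by congr cmeasurable; apply/funext => x; rewrite mulN1r.
Qed.

Lemma cmeasurableV f : cmeasurable f -> cmeasurable (fun x => (f x)^-1).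
Proof.
move=> [fr fi].
have mn : measurable_fun setT
    (fun x => (complex.Re (f x) ^+ 2 + complex.Im (f x) ^+ 2) `^ (-1)).
  apply: (measurableT_comp (@measurable_powR R (-1))).
  by apply: measurable_funD; exact: measurable_funX.
have e x : (complex.Re (f x) ^+ 2 + complex.Im (f x) ^+ 2) `^ (-1) =
    (complex.Re (f x) ^+ 2 + complex.Im (f x) ^+ 2)^-1.
  by rewrite powR_inv1// addr_ge0 ?sqr_ge0.
split.
  rewrite (_ : (fun x => _) = fun x => complex.Re (f x) *
    (complex.Re (f x) ^+ 2 + complex.Im (f x) ^+ 2) `^ (-1)).
    exact: measurable_funM.
  by apply/funext => x; rewrite e; case: (f x).
rewrite (_ : (fun x => _) = fun x => - (complex.Im (f x) *
    (complex.Re (f x) ^+ 2 + complex.Im (f x) ^+ 2) `^ (-1))).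
  by apply: measurable_funN; exact: measurable_funM.
by apply/funext => x; rewrite e; case: (f x).
Qed.

Lemma cmeasurable_sum (I : Type) (r : seq I) (p : pred I) (F : I -> X -> R[i]) :
  (forall i, cmeasurable (F i)) ->
  cmeasurable (fun x => \sum_(i <- r | p i) F i x).
Proof.
move=> mF; elim: r => [|i r IH].
  rewrite [X in cmeasurable X](_ : _ = fun=> 0); first exact: cmeasurable_cst.
  by apply/funext => x; rewrite big_nil.
rewrite [X in cmeasurable X](_ : _ = fun x =>
  (if p i then F i x else 0) + \sum_(j <- r | p j) F j x); last first.
  by apply/funext => x; rewrite big_cons; case: ifP; rewrite ?add0r.
by apply: cmeasurableD => //; case: (p i) => //; exact: cmeasurable_cst.
Qed.

Lemma cmeasurable_prod (I : Type) (r : seq I) (p : pred I) (F : I -> X -> R[i]) :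
  (forall i, cmeasurable (F i)) ->
  cmeasurable (fun x => \prod_(i <- r | p i) F i x).
Proof.
move=> mF; elim: r => [|i r IH].
  rewrite [X in cmeasurable X](_ : _ = fun=> 1); first exact: cmeasurable_cst.
  by apply/funext => x; rewrite big_nil.
rewrite [X in cmeasurable X](_ : _ = fun x =>
  (if p i then F i x else 1) * \prod_(j <- r | p j) F j x); last first.
  by apply/funext => x; rewrite big_cons; case: ifP; rewrite ?mul1r.
by apply: cmeasurableM => //; case: (p i) => //; exact: cmeasurable_cst.
Qed.

Lemma cmeasurable_det n (A : X -> 'M[R[i]]_n) :
  (forall k l, cmeasurable (fun x => A x k l)) ->
  cmeasurable (fun x => \det (A x)).
Proof.
move=> mA; rewrite /determinant; apply: cmeasurable_sum => s.
apply: cmeasurableM; first exact: cmeasurable_cst.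
by apply: cmeasurable_prod => k; exact: mA.
Qed.

Lemma cmeasurable_resolvent n (A : X -> 'M[R[i]]_n) z k l :
  (forall k l, cmeasurable (fun x => A x k l)) ->
  (forall x, is_hermitian (A x)) -> 0 < complex.Im z ->
  cmeasurable (fun x => resolvent z (A x) k l).
Proof.
move=> mA hA z0.
have mAz k' l' : cmeasurable (fun x => (A x - z%:M) k' l').
  rewrite (_ : (fun x => _) = fun x => A x k' l' - z *+ (k' == l')).
    by apply: cmeasurableB => //; exact: cmeasurable_cst.
  by apply/funext => x; rewrite !mxE.
rewrite (_ : (fun x => _) = fun x => (\det (A x - z%:M))^-1 *
   ((-1) ^+ (l + k) * \det (row' l (col' k (A x - z%:M))))).
  apply: cmeasurableM; first by apply: cmeasurableV; exact: cmeasurable_det.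
  apply: cmeasurableM; first exact: cmeasurable_cst.
  apply: cmeasurable_det => k' l'.
  rewrite (_ : (fun x => _) = fun x => (A x - z%:M) (lift l k') (lift k l')) //.
  by apply/funext => x; rewrite !mxE.
apply/funext => x.
by rewrite /resolvent /invmx resolvent_unitmx// !mxE.
Qed.

End ComplexMeasurable.

(** * Hermitian matrices read off from a sample *)

Section Hermitize.
Variables (R : realType) (N : nat).
Implicit Types h : sample R N.

Definition hermitize h : 'M[R[i]]_N :=
  \matrix_(k, l) let h' := (h : 'M[R[i]]_N) in
    if (k < l)%N then h' k l else
    if k == l then (complex.Re (h' k l))%:C else (h' l k)^*.

Lemma hermitize_hermitian h : is_hermitian (hermitize h).
Proof.
move=> k l; rewrite !mxE /= -!val_eqE /=; case: (ltngtP l k) => kl //.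
- by rewrite conjcK.
- have -> : k = l by apply/val_inj.
  by rewrite conjc_real.
Qed.

Lemma hermitize_id (h : 'M[R[i]]_N) : is_hermitian h -> hermitize h = h.
Proof.
move=> hh; apply/matrixP => k l; rewrite !mxE /=; case: ifP => // _.
case: eqP => [->|_]; last by rewrite -hh.
have := hh l l; case: (h l l) => a b [] /eqP.
by rewrite -addr_eq0 -mulr2n mulrn_eq0 /= => /eqP ->.
Qed.

Lemma cmeasurable_hermitize k l :
  cmeasurable (fun h : sample_space R N => hermitize h k l).
Proof.
have mc (k' l' : 'I_N) : (k' <= l')%N ->
    cmeasurable (fun h : sample_space R N => (h : 'M[R[i]]_N) k' l').
  move=> kl; apply/cmeasurable_to_plane.
  by apply: (@measurable_sample_coord R N (k', l')); rewrite inE.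
have [kl|lk|kl] := ltngtP k l.
- rewrite (_ : (fun h => _) = fun h : sample_space R N => (h : 'M[R[i]]_N) k l).
    exact/mc/ltnW.
  by apply/funext => h; rewrite mxE /= kl.
- rewrite (_ : (fun h => _) = fun h : sample_space R N => ((h : 'M[R[i]]_N) l k)^*).
    by apply: cmeasurable_conj; exact/mc/ltnW.
  apply/funext => h; rewrite mxE /= ltnNge (ltnW lk) /=.
  by rewrite (negbTE (_ : k != l)) // -val_eqE /= neq_ltn lk orbT.
- have {kl}-> : k = l by apply/val_inj.
  rewrite (_ : (fun h => _) = fun h : sample_space R N =>
    (complex.Re ((h : 'M[R[i]]_N) l l))%:C).
    by split; [case: (mc l l (leqnn _))|exact: measurable_cst].
  by apply/funext => h; rewrite mxE /= ltnn eqxx.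
Qed.

Lemma cmeasurable_zero_rows (V : {set 'I_N}) k l :
  cmeasurable (fun h : sample_space R N => zero_rows V (hermitize h) k l).
Proof.
have [c|c] := boolP ((k \in V) || (l \in V)).
  rewrite (_ : (fun h => _) = fun=> 0); first exact: cmeasurable_cst.
  by apply/funext => h; rewrite mxE c.
rewrite (_ : (fun h => _) = fun h : sample_space R N => hermitize h k l).
  exact: cmeasurable_hermitize.
by apply/funext => h; rewrite mxE (negbTE c).
Qed.

Lemma zero_rows_replace (V : {set 'I_N}) a h h' : a \in V ->
  zero_rows V (hermitize (replace_rows [set a]%SET h h')) =
  zero_rows V (hermitize h).
Proof.
move=> aV; apply/matrixP => k l; rewrite mxE [RHS]mxE.
case: ifPn => //; rewrite negb_or => /andP[kV lV].
have ka : (k == a) = false by apply: contraNF kV => /eqP ->.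
have la : (l == a) = false by apply: contraNF lV => /eqP ->.
by rewrite !mxE /= !mxE !inE ka la.
Qed.

Variables (Delta : admissible_graph) (m z : R[i]).
Hypothesis z0 : 0 < complex.Im z.

Lemma cmeasurable_mx_monomial a mu (V : {set 'I_N}) :
  cmeasurable (fun h : sample_space R N =>
    mx_monomial (Delta := Delta) m z a mu (zero_rows V (hermitize h))).
Proof.
rewrite /mx_monomial; apply: cmeasurable_prod => e.
have mr k l : cmeasurable (fun h : sample_space R N =>
    resolvent z (zero_rows V (hermitize h)) k l).
  apply: cmeasurable_resolvent => // [k' l'|h].
    exact: cmeasurable_zero_rows.
  by apply: zero_rows_hermitian; exact: hermitize_hermitian.
have me k l : cmeasurable (fun h : sample_space R N =>
    resolvent z (zero_rows V (hermitize h)) k l - (k == l)%:R * m).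
  by apply: cmeasurableB => //; exact: cmeasurable_cst.
rewrite (_ : (fun h => _) = fun h : sample_space R N => if gstar e then
    (resolvent z (zero_rows V (hermitize h)) (vertex_index a mu (gtgt e))
       (vertex_index a mu (gsrc e)) - (vertex_index a mu (gtgt e) ==
       vertex_index a mu (gsrc e))%:R * m)^*
    else resolvent z (zero_rows V (hermitize h)) (vertex_index a mu (gsrc e))
       (vertex_index a mu (gtgt e)) - (vertex_index a mu (gsrc e) ==
       vertex_index a mu (gtgt e))%:R * m).
  by case: (gstar e) => //; exact: cmeasurable_conj.
by apply/funext => h; rewrite mx_monomial_entryE.
Qed.

Lemma bounded_rv_mx_monomial (pi : R[i] -> R) a mu (V : {set 'I_N}) :
  pi = @complex.Re R \/ pi = @complex.Im R ->
  bounded_rv (fun h : sample_space R N =>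
    pi (mx_monomial (Delta := Delta) m z a mu (zero_rows V (hermitize h)))).
Proof.
have [mr mi] := cmeasurable_mx_monomial a mu V.
move=> Hpi; split; first by case: Hpi => ->.
exists (((complex.Im z)^-1 + cmod m) ^+ deg Delta) => h.
have hh := zero_rows_hermitian V (hermitize_hermitian h).
have := cmod_mx_monomial m a mu hh z0; apply: le_trans.
by case: Hpi => ->; [exact: ler_Re_cmod|exact: ler_Im_cmod].
Qed.

End Hermitize.

(** * Versions of the conditional expectations *)

Section ConditionalExpectation.
Context {R : realType} {d : measure_display} {T : measurableType d}.
Variables (P : probability T R) (F : set (set T)).
Hypothesis sF : sigma_algebra setT F.
Hypothesis Fm : F `<=` measurable.

Let measurable_sub (Y : T -> R) :
  (forall B : set (measurableTypeR R), measurable B -> F (Y @^-1` B)) ->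
  measurable_fun setT Y.
Proof. by move=> FY _ B mB; rewrite setTI; apply: Fm; exact: FY. Qed.

Let lt_sub (Y Z : T -> R) :
  (forall B : set (measurableTypeR R), measurable B -> F (Y @^-1` B)) ->
  (forall B : set (measurableTypeR R), measurable B -> F (Z @^-1` B)) ->
  F [set t | Z t < Y t].
Proof.
move=> FY FZ; have FE : <<s F >> = F by exact: sigma_algebra_id.
have mY : @measurable_fun _ _ (g_sigma_algebraType F) R setT Y.
  by move=> _ B mB; rewrite setTI /measurable /= FE; exact: FY.
have mZ : @measurable_fun _ _ (g_sigma_algebraType F) R setT Z.
  by move=> _ B mB; rewrite setTI /measurable /= FE; exact: FZ.
have := measurable_fun_ltr mZ mY measurableT (Y := [set true]) I.
by rewrite setTI /measurable /= FE.
Qed.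

(** The set where [Z < Y] belongs to [F], and [Y] and [Z] have the same integral
    over it. *)
Let cond_exp_le (X Y Z : T -> R) : is_cond_exp P F X Y -> is_cond_exp P F X Z ->
  {ae P, forall t, Y t <= Z t}.
Proof.
move=> [_ iY FY eY] [_ iZ FZ eZ]; pose A := [set t | Z t < Y t].
have FA : F A by exact: lt_sub.
have mA : measurable A by exact: Fm.
have iYA : P.-integrable A (EFin \o Y) by exact: integrableS iY.
have iZA : P.-integrable A (EFin \o Z) by exact: integrableS iZ.
have mD : measurable_fun A (fun t => (Y t - Z t)%:E).
  apply/measurable_EFinP; apply: measurable_funTS.
  by apply: measurable_funB; exact: measurable_sub.
have : (\int[P]_(t in A) `|(Y t - Z t)%:E| = 0)%E.
  transitivity (\int[P]_(t in A) ((Y t)%:E - (Z t)%:E))%E.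
    apply: eq_integral => t /set_mem At.
    by rewrite -EFinB gee0_abs// lee_fin subr_ge0 ltW.
  rewrite integralB//; have fZ : (\int[P]_(t in A) (Z t)%:E)%E \is a fin_num.
    exact: integrable_fin_num.
  by rewrite eY// -eZ// subee.
move=> /(ae_eq_integral_abs _ mA mD); apply: filterS => t /= h.
rewrite leNgt; apply/negP => Zt; have /(_ Zt) := h.
by move=> [] /eqP; rewrite subr_eq0 gt_eqF.
Qed.

Lemma cond_exp_unique (X Y Z : T -> R) : is_cond_exp P F X Y ->
  is_cond_exp P F X Z -> {ae P, forall t, Y t = Z t}.
Proof.
move=> HY HZ; have := cond_exp_le HZ HY; have := cond_exp_le HY HZ.
by apply: filterS2 => t YZ ZY; apply/eqP; rewrite eq_le YZ ZY.
Qed.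

Lemma cond_exp_ae (X Z : T -> R) : is_cond_exp P F X Z ->
  measurable_fun setT (cond_exp P F X) /\
  {ae P, forall t, cond_exp P F X t = Z t}.
Proof.
move=> HZ; have HX : is_cond_exp P F X (cond_exp P F X).
  exact: (@xgetI _ _ [set Y | is_cond_exp P F X Y] Z).
split; last exact: cond_exp_unique HX HZ.
by case: HX => _ _ FX _; exact: measurable_sub.
Qed.

End ConditionalExpectation.

Section PartialExpectation.
Context {R : realType} {d : measure_display} {T : measurableType d}.
Variables (P : probability T R) (N : nat) (H : T -> 'M[R[i]]_N).
Hypothesis HH : random_hermitian P H.

Let hermH t : is_hermitian (H t).
Proof.
move=> k l; have := rh_hermitian HH t => /matrixP /(_ l k).
by rewrite !mxE.
Qed.

Lemma measurable_sample : measurable_fun setT (H : T -> sample_space R N).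
Proof.
by apply: measurable_to_sample => k _; exact: (rh_measurable HH).
Qed.

Definition sample_rv : {mfun T >-> sample_space R N} :=
  HB.pack (H : T -> sample_space R N) (isMeasurableFun.Build _ _ _ _ _ measurable_sample).

Definition sample_law : probability (sample_space R N) R :=
  distribution P sample_rv.

Lemma sample_law_resampling : resampling sample_law (@replace_rows R N).
Proof. exact: (@sample_resampling _ _ _ P N sample_rv (rh_independent HH)). Qed.

Lemma hermitize_sample t : hermitize (H t) = H t.
Proof. exact: hermitize_id. Qed.

Let row_zeroed (i : 'I_N) (h : sample R N) : sample R N :=
  \matrix_(k, l) if (k == i) || (l == i) then 0 else (h : 'M[R[i]]_N) k l.

Let measurable_row_zeroed i :
  measurable_fun setT (row_zeroed i : sample_space R N -> sample_space R N).
Proof.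
apply: measurable_to_sample => k kU; apply/cmeasurable_to_plane.
have [c|c] := boolP ((k.1 == i) || (k.2 == i)).
  rewrite (_ : (fun h => _) = fun=> 0); first exact: cmeasurable_cst.
  by apply/funext => h; rewrite mxE c.
rewrite (_ : (fun h => _) = fun h : sample_space R N => (h : 'M[R[i]]_N) k.1 k.2).
  by apply/cmeasurable_to_plane; exact: measurable_sample_coord.
by apply/funext => h; rewrite mxE (negbTE c).
Qed.

Let minorE i t : minor H i t = row_zeroed i (H t).
Proof. by []. Qed.

Let hermitize_minor i t : hermitize (minor H i t) = minor H i t.
Proof.
apply: hermitize_id => k l; rewrite !mxE orbC; case: ifP => _.
  by rewrite rmorph0.
exact: hermH.
Qed.

Let sigma_minor (i : 'I_N) := sigma_mx (minor H i).

Let sigma_minorP i : sigma_algebra setT (sigma_minor i).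
Proof. exact: smallest_sigma_algebra. Qed.

(** The sigma-algebra of the minor is generated by its entries, below the
    diagonal too; these are recovered from the sample because the minor is
    Hermitian. *)
Let sigma_minor_preimage i (A : set T) :
  sigma_minor i A <->
  exists2 C : set (sample_space R N), measurable C & A = minor H i @^-1` C.
Proof.
split; last first.
  pose T' := g_sigma_algebraType [set A | exists k l
     (B : set (measurableTypeR R * measurableTypeR R)),
        measurable B /\ A = [set t | B (to_plane (minor H i t k l))]].
  have sub : @upper_rectangles R N `<=`
      image_set_system setT (minor H i) (sigma_minor i).
    move=> _ [B mB ->]; rewrite /image_set_system /= setTI.
    rewrite -[sigma_minor i _]/(measurable (_ : set T')).
    rewrite (_ : _ @^-1` _ = \bigcap_(k in [set k | k \in upper_indices N])
      ((fun t => to_plane (minor H i t k.1 k.2)) @^-1` B k)); last first.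
      by apply/seteqP; split.
    apply: fin_bigcap_measurable; first exact: finite_finset.
    by move=> k kU; apply: sub_sigma_algebra; exists k.1, k.2, (B k).
  move=> [C mC ->].
  have := smallest_sub (sigma_algebra_image (minor H i) (sigma_minorP i)) sub mC.
  by rewrite /image_set_system /= setTI.
have := @sigma_algebra_preimage T _ measurable setT
  (minor H i : T -> sample_space R N) (sigma_algebra_measurable _).
move=> /smallest_sub h /h {}h; suff : preimage_set_system setT
    (minor H i : T -> sample_space R N) measurable A.
  by move=> [C mC <-]; exists C => //; rewrite setTI.
apply: h => _ [k [l [B [mB ->]]]].
exists [set h : sample_space R N | B (to_plane (hermitize h k l))].
  have /cmeasurable_to_plane mc := @cmeasurable_hermitize R N k l.
  by rewrite -[X in measurable X]setTI; exact: mc.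
rewrite setTI; apply/seteqP; split => t /=; by rewrite hermitize_minor.
Qed.

Let sigma_minor_measurable i : sigma_minor i `<=` measurable.
Proof.
move=> A /sigma_minor_preimage [C mC ->].
rewrite -[X in measurable X]setTI.
exact: (measurableT_comp (@measurable_row_zeroed i) measurable_sample).
Qed.

Let replace_row_zeroed i (h h' : sample R N) :
  replace_rows [set i]%SET (row_zeroed i h) h' = replace_rows [set i]%SET h h'.
Proof. by apply/matrixP => k l; rewrite !mxE !inE; case: (_ || _). Qed.

Let row_zeroed_replace i (h h' : sample R N) :
  row_zeroed i (replace_rows [set i]%SET h h') = row_zeroed i h.
Proof. by apply/matrixP => k l; rewrite !mxE !inE; case: (_ || _). Qed.

Lemma expect_sample_law (f : sample_space R N -> R) : bounded_rv f ->
  expect sample_law f = expect P (fun t => f (H t)).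
Proof.
move=> bf; rewrite /expect /Rintegral; congr fine.
rewrite -[LHS]/(\int[pushforward P sample_rv]_x (EFin \o f) x)%E.
have := @integral_pushforward _ _ _ _ R _ measurable_sample P setT (EFin \o f).
rewrite preimage_setT => -> //.
- by apply/measurable_EFinP; case: bf.
- apply: (@bounded_rv_integrable _ _ _ P (fun t => f (H t))).
  case: bf => mf [C fC]; split; last by exists C => t.
  exact: (measurableT_comp mf measurable_sample).
Qed.

(** Averaging over a resampled row is a version of the conditional expectation
    given the minor: on a set of the form [minor^-1 C] both integrals become
    expectations under the law of the sample, where they agree because the
    indicator of [C] does not see the row [i]. *)
Lemma is_cond_exp_row_average i (Y : T -> R) (f : sample_space R N -> R) :
  bounded_rv f -> measurable_fun setT Y -> {ae P, forall t, Y t = f (H t)} ->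
  is_cond_exp P (sigma_minor i) Y
    (fun t => row_average sample_law (@replace_rows R N) [set i]%SET f (H t)).
Proof.
move=> bf mY YE; have HR := sample_law_resampling.
set g := row_average _ _ _ f; have bg : bounded_rv g by exact: bounded_rv_row_average.
have bH (k : sample_space R N -> R) : bounded_rv k -> bounded_rv (fun t => k (H t)).
  move=> [mk [C kC]]; split; last by exists C => t.
  exact: (measurableT_comp mk measurable_sample).
have YE' : ae_eq P setT (EFin \o Y) (fun t => (f (H t))%:E).
  by apply: filterS YE => t /= ->.
have mf : measurable_fun setT (fun t => (f (H t))%:E).
  by apply/measurable_EFinP; case: (bH f bf).
have iY : P.-integrable setT (EFin \o Y).
  have /integrableP [_ i2] := bounded_rv_integrable P (bH f bf).
  apply/integrableP; split; first exact/measurable_EFinP.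
  rewrite (ae_eq_integral (fun t => `|(f (H t))%:E|%E)) //.
  - by apply: measurableT_comp => //; exact/measurable_EFinP.
  - exact: measurableT_comp.
  - by apply: filterS YE => t /= ->.
split => //.
- exact: (bounded_rv_integrable P (bH g bg)).
- move=> B mB; apply/sigma_minor_preimage; exists (g @^-1` B).
    by rewrite -[X in measurable X]setTI; case: bg => mg _; exact: mg.
  have gE t : g (minor H i t) = g (H t).
    rewrite minorE /g /row_average; congr expect; apply/funext => h'.
    by rewrite replace_row_zeroed.
  by apply/seteqP; split => t /=; rewrite gE.
- move=> A /sigma_minor_preimage [C mC ->].
  have mA : measurable (minor H i @^-1` C).
    by apply: (@sigma_minor_measurable i); apply/sigma_minor_preimage; exists C.
  rewrite [RHS](ae_eq_integral (fun t => (f (H t))%:E))//; last 3 first.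
  - by apply: measurable_funTS; exact/measurable_EFinP.
  - exact: measurable_funTS.
  - by apply: filterS YE' => t /= + _ => /(_ I).
  pose chi (h : sample_space R N) : R := \1_C (row_zeroed i h).
  have bchi : bounded_rv chi.
    split; last by exists 1 => h; rewrite /chi indicE; case: (_ \in _);
      rewrite ?normr1 ?normr0.
    have mI : measurable_fun setT (\1_C : sample_space R N -> R).
      exact: measurable_indic.
    exact: (measurableT_comp mI (@measurable_row_zeroed i)).
  have chiE (k : sample_space R N -> R) : bounded_rv k ->
      (\int[P]_(t in minor H i @^-1` C) (k (H t))%:E)%E =
      (expect sample_law (fun h => chi h * k h))%:E.
    move=> bk; have bck := bounded_rvM bchi bk.
    rewrite expect_sample_law//= /expect /Rintegral fineK; last first.
      by apply: integrable_fin_num => //; exact: (bounded_rv_integrable P (bH _ bck)).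
    rewrite [LHS]integral_mkcond; apply: eq_integral => t _.
    rewrite patchE /chi indicE; have [tC|tC] := boolP (t \in _).
      by rewrite mem_set ?mul1r//; move/set_mem: tC.
    rewrite memNset ?mul0r//; move/negP: tC; apply: contra_not.
    by move=> ?; exact: mem_set.
  rewrite !chiE//; congr EFin.
  rewrite -[RHS](expect_row_average HR [set i]%SET (bounded_rvM bchi bf)); congr expect.
  apply/funext => h; rewrite /g /row_average.
  rewrite -(expectZ sample_law (chi h)); last exact: (bounded_rv_repl HR).
  by congr expect; apply/funext => h'; rewrite /chi row_zeroed_replace.
Qed.

Lemma cond_exp_minor i (Y : T -> R) (f : sample_space R N -> R) :
  bounded_rv f -> measurable_fun setT Y -> {ae P, forall t, Y t = f (H t)} ->
  measurable_fun setT (cond_exp P (sigma_mx (minor H i)) Y) /\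
  {ae P, forall t, cond_exp P (sigma_mx (minor H i)) Y t =
    row_average sample_law (@replace_rows R N) [set i]%SET f (H t)}.
Proof.
move=> bf mY YE; apply: cond_exp_ae.
- exact: sigma_minorP.
- exact: sigma_minor_measurable.
- exact: is_cond_exp_row_average.
Qed.

(** The iterated fluctuations in the definition of the averages are computed,
    up to null sets, by the operators acting on functions of the sample. *)
Lemma foldr_partial_fluct (I : Type) (a : I -> 'I_N) (s : seq I)
    (Y : T -> R[i]) (f1 f2 : sample_space R N -> R) :
  cmeasurable Y -> bounded_rv f1 -> bounded_rv f2 ->
  {ae P, forall t, complex.Re (Y t) = f1 (H t)} ->
  {ae P, forall t, complex.Im (Y t) = f2 (H t)} ->
  let Z := foldr (fun i X => partial_fluct P H (a i) X) Y s in
  let Q := row_flucts sample_law (@replace_rows R N) [seq a i | i <- s] in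
  [/\ cmeasurable Z, {ae P, forall t, complex.Re (Z t) = Q f1 (H t)} &
      {ae P, forall t, complex.Im (Z t) = Q f2 (H t)}].
Proof.
move=> mY b1 b2 e1 e2; elim: s => [//|i s [[mr mi] er ei]] /=.
have HR := sample_law_resampling.
have [mr' er'] := cond_exp_minor (a i) (bounded_rv_row_flucts HR _ b1) mr er.
have [mi' ei'] := cond_exp_minor (a i) (bounded_rv_row_flucts HR _ b2) mi ei.
split.
- by apply: cmeasurableB; split.
- by apply: filterS2 er er' => t; rewrite /partial_fluct raddfB /= => -> ->.
- by apply: filterS2 ei ei' => t; rewrite /partial_fluct raddfB /= => -> ->.
Qed.

End PartialExpectation.

(** * A lower bound for the Stieltjes transform of the semicircle law *)

Section SemicircleIntegral.
Variables (R : realType) (E eta : R).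
Hypothesis eta0 : 0 < eta.

Let mu := @lebesgue_measure R.

Let semicircle (x : R) := Num.sqrt (4 - x ^+ 2).
Let den (x : R) := (x - E) ^+ 2 + eta ^+ 2.

Let den_gt0 x : 0 < den x.
Proof. by rewrite ltr_wpDl ?sqr_ge0 ?exprn_gt0. Qed.

Let continuous_den : continuous den.
Proof.
move=> x; apply: cvgD; last exact: cvg_cst.
apply: (@continuous_comp _ _ _ (fun y => y - E) (fun y => y ^+ 2)).
  by apply: cvgB; [exact: cvg_id|exact: cvg_cst].
exact: exprn_continuous.
Qed.

Let continuous_denV : continuous (fun x => (den x)^-1).
Proof.
move=> x; apply: cvgV; last exact: continuous_den.
by rewrite gt_eqF.
Qed.

Let continuous_semicircle : continuous semicircle.
Proof.
have c4 : continuous (fun y : R => 4 - y ^+ 2).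
  by move=> x; apply: cvgB; [exact: cvg_cst|exact: exprn_continuous].
move=> x; exact: (continuous_comp (c4 x) (@sqrt_continuous R _)).
Qed.

Let integrable_continuous (f : R -> R) a b : continuous f ->
  mu.-integrable `[a, b] (EFin \o f).
Proof.
move=> cf; apply: continuous_compact_integrable; first exact: segment_compact.
exact: continuous_subspaceT.
Qed.

Let Rintegral_ge_subitv (f : R -> R) A B a b c : continuous f ->
  (forall x, A <= x <= B -> 0 <= f x) -> a <= b -> A <= a -> b <= B ->
  (forall x, a <= x <= b -> c <= f x) ->
  c * (b - a) <= Rintegral mu `[A, B] f.
Proof.
move=> cf f0 ab Aa bB fc.
have sub : `[a, b] `<=` `[A, B].
  by move=> x /=; rewrite !in_itv /= => /andP[h1 h2]; apply/andP; split; lra.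
have mab : measurable `[a, b]%classic by exact: measurable_itv.
have muab : mu `[a, b]%classic = (b - a)%:E.
  rewrite /mu lebesgue_measure_itv /= lte_fin; case: ltP => // ba.
  by congr EFin; apply/esym/eqP; rewrite subr_eq0 eq_le ab ba.
have -> : c * (b - a) = Rintegral mu `[A, B] ((fun=> c) \_ `[a, b]).
  rewrite -Rintegral_mkcondr (setIidr sub).
  transitivity (c * fine (mu `[a, b]%classic)); first by rewrite muab.
  by apply/esym; exact: Rintegral_cst.
apply: le_Rintegral => //.
- have h0 : mu.-integrable `[a, b] (EFin \o (fun=> c)).
    by apply: integrable_continuous => x; exact: cvg_cst.
  have h : mu.-integrable setT ((EFin \o (fun=> c)) \_ `[a, b]).
    exact: ((integrable_mkcond (mu := mu) (EFin \o (fun=> c)) mab).1 h0).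
  rewrite restrict_EFin in h.
  by apply: (integrableS _ _ _ h) => //; exact: measurable_itv.
- exact: integrable_continuous.
- move=> x xI; rewrite /patch; case: ifPn => [|_].
    by rewrite inE /= in_itv /= => /fc.
  by apply: f0; move: xI; rewrite /= in_itv.
Qed.

Let Rintegral_halves (f : R -> R) : continuous f ->
  Rintegral mu `[-2, 2] f = Rintegral mu `[-2, 0] f + Rintegral mu `[0, 2] f.
Proof.
move=> cf; have if2 := @integrable_continuous f (-2) 2 cf.
have := @Rintegral_itvB R f (BLeft (-2)) (BRight 2) 0 if2.
rewrite !bnd_simp => /(_ (ltac:(lra)) (ltac:(lra))) e.
rewrite -[X in _ + X]Rintegral_itv_obnd_cbnd -?e; first by ring.
apply: (integrableS _ _ _ (@integrable_continuous f 0 2 cf)).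
- exact: measurable_itv.
- exact: measurable_itv.
- by move=> x /=; rewrite !in_itv /= => /andP[/ltW -> ->].
Qed.

Lemma semicircle_Im_integral : -1 <= E <= 1 -> eta <= 10 ->
  1 / 20 <= Rintegral mu `[-2, 2] (fun x => semicircle x * (eta / den x)).
Proof.
move=> /andP[E1 E2] eta10.
have -> : 1 / 20 = (2 * eta)^-1 * ((E + eta / 20) - (E - eta / 20)).
  by field; rewrite gt_eqF.
have e0 : 0 < eta := eta0.
have ab : E - eta / 20 <= E + eta / 20 by lra.
have Aa : -2 <= E - eta / 20 by lra.
have bB : E + eta / 20 <= 2 by lra.
apply: (Rintegral_ge_subitv _ _ ab Aa bB).
- move=> x; apply: cvgM; first exact: continuous_semicircle.
  by apply: cvgM; [exact: cvg_cst|exact: continuous_denV].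
- move=> x _; rewrite mulr_ge0 ?sqrtr_ge0// divr_ge0 ?(ltW eta0) ?(ltW (den_gt0 _))//.
- move=> x /andP[x1 x2].
  have s1 : 1 <= semicircle x.
    rewrite -[leLHS]sqrtr1 ler_wsqrtr//.
    have : (3 / 2 - x) * (3 / 2 + x) >= 0 by apply: mulr_ge0; lra.
    by nra.
  have d2 : den x <= 2 * eta ^+ 2.
    rewrite /den; have : (eta / 20 - (x - E)) * (eta / 20 + (x - E)) >= 0.
      by apply: mulr_ge0; lra.
    by have := sqr_ge0 eta; rewrite !expr2; lra.
  rewrite -[leLHS]mul1r ler_pM//; first by rewrite invr_ge0; lra.
  rewrite ler_pdivlMr ?den_gt0// mulrC ler_pdivrMr; last by lra.
  by apply: (le_trans d2); rewrite expr2; lra.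
Qed.

Let q (sigma x : R) := sigma * (E - x) / den x.

Let continuous_q sigma : continuous (q sigma).
Proof.
move=> x; apply: cvgM; last exact: continuous_denV.
by apply: cvgM; [exact: cvg_cst|apply: cvgB; [exact: cvg_cst|exact: cvg_id]].
Qed.

Let primitive_q sigma (x : R) :
  is_derive x 1 (fun y => - (sigma / 2) * ln (den y)) (q sigma x).
Proof.
have dd : is_derive x 1 den (2 * (x - E)).
  rewrite /den; apply: is_derive_eq.
  by rewrite /GRing.scale /=; ring.
have dl := @is_derive1_comp R (@ln R) den x _ _ (is_derive1_ln (den_gt0 x)) dd.
have := @is_deriveZ _ _ _ _ (- (sigma / 2)) _ _ _ dl.
move=> /is_derive_eq; apply.
by rewrite /GRing.scale /= /q; field; rewrite gt_eqF.
Qed.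

Let integral_q_ge0 sigma a : 0 <= sigma * (E - a - 1) ->
  0 <= Rintegral mu `[a, a + 2] (q sigma).
Proof.
move=> Ha; pose F y := - (sigma / 2) * ln (den y).
have cF : continuous F.
  move=> x; apply: differentiable_continuous; apply/derivable1_diffP.
  by have [] := primitive_q sigma x.
have := @continuous_FTC2 R (q sigma) F a (a + 2).
rewrite ltrDl ltr0n => /(_ isT) H.
rewrite /Rintegral H.
- rewrite -EFinB /= /F.
  have dE : den a - den (a + 2) = 4 * (E - a - 1) by rewrite /den; ring.
  rewrite (_ : _ - _ = sigma / 2 * (ln (den a) - ln (den (a + 2)))); last by ring.
  have [s0|s0] := leP 0 sigma.
    move: s0; rewrite le_eqVlt => /orP[/eqP <-|s0]; first by rewrite mul0r mul0r.
    rewrite mulr_ge0 ?divr_ge0 ?(ltW s0)// subr_ge0 ler_ln ?posrE//.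
    rewrite -subr_ge0 dE; move: Ha; rewrite pmulr_rge0//; lra.
  rewrite -mulrNN mulr_ge0//; first by lra.
  rewrite opprB subr_ge0 ler_ln ?posrE//.
  by rewrite -subr_le0 dE; move: Ha; rewrite nmulr_rge0//; lra.
- exact: continuous_subspaceT.
- split.
  + by move=> x _; have [] := primitive_q sigma x.
  + exact: cvg_at_right_filter (cF a).
  + exact: cvg_at_left_filter (cF (a + 2)).
- by move=> x _; rewrite derive1E; have [_ ->] := primitive_q sigma x.
Qed.

(** For [E >= 1] the integrand is positive on the half [-2, 0]. On [0, 2], where
    [E - x] may change sign, the density is compared with its value at [E]: it
    decreases, so [(semicircle x - semicircle E) * (E - x)] is nonnegative, and
    what remains has the primitive [- (1 / 2) * ln (den x)], whose increment is
    nonnegative because [E] lies to the right of the midpoint [1]. The case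
    [E <= - 1] is the mirror image, with [sigma = - 1]. *)
Lemma semicircle_Re_integral sigma : sigma = 1 \/ sigma = -1 ->
  1 <= sigma * E -> -10 <= E <= 10 -> eta <= 10 ->
  1 / 480 <= Rintegral mu `[-2, 2] (fun x => semicircle x * q sigma x).
Proof.
have e0 : 0 < eta := eta0.
move=> sigma1 sE /andP[E1 E2] eta10.
have cf : continuous (fun x => semicircle x * q sigma x).
  by move=> x; apply: cvgM; [exact: continuous_semicircle|exact: continuous_q].
have far A : 0 <= sigma * (E - A - 1) -> (sigma = 1 /\ A = 0) \/ (sigma = -1 /\ A = -2) ->
   0 <= Rintegral mu `[A, A + 2] (fun x => semicircle x * q sigma x).
  move=> HA sA; apply: (@le_trans _ _ (Rintegral mu `[A, A + 2]
      (fun x => semicircle E * q sigma x))).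
    rewrite RintegralZl//; last exact: integrable_continuous.
    by rewrite mulr_ge0 ?sqrtr_ge0 ?integral_q_ge0.
  apply: le_Rintegral => //.
  - apply: integrable_continuous => x.
    by apply: cvgM; [exact: cvg_cst|exact: continuous_q].
  - exact: integrable_continuous.
  - move=> x /=; rewrite in_itv /= => xA; rewrite -subr_ge0 -mulrBl /q mulrA.
    rewrite divr_ge0 ?(ltW (den_gt0 _))//.
    have [|] := leP 0 (sigma * (E - x)) => sx.
      rewrite mulr_ge0// subr_ge0 ler_wsqrtr//.
      by case: sA => -[s_ A_]; move: sx sE xA; rewrite s_ A_ => ? ? /andP[? ?]; nra.
    rewrite -mulrNN mulr_ge0// ?oppr_ge0 ?(ltW sx)// subr_le0 ler_wsqrtr//.
    by case: sA => -[s_ A_]; move: sx sE xA; rewrite s_ A_ => ? ? /andP[? ?]; nra.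
have near A : (sigma = 1 /\ A = -2) \/ (sigma = -1 /\ A = 0) ->
   1 / 480 <= Rintegral mu `[A, A + 2] (fun x => semicircle x * q sigma x).
  move=> sA; rewrite (_ : 1 / 480 = 240^-1 * (A + 3 / 2 - (A + 1))); last by field.
  have pos x : A <= x <= A + 2 -> 0 <= sigma * (E - x).
    by case: sA => -[s_ A_]; move: sE; rewrite s_ A_ => ? /andP[? ?]; lra.
  apply: Rintegral_ge_subitv => //; try lra.
    move=> x xA; rewrite mulr_ge0 ?sqrtr_ge0// /q divr_ge0 ?(ltW (den_gt0 _))//.
    exact: pos.
  move=> x /andP[x1 x2].
  have s1 : 1 <= semicircle x.
    rewrite -[leLHS]sqrtr1 ler_wsqrtr//.
    by case: sA => -[s_ A_]; move: x1 x2; rewrite A_ => ? ?; nra.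
  rewrite -[leLHS]mul1r.
  apply: ler_pM; [exact: ler01|by rewrite invr_ge0 ler0n|exact: s1|].
  rewrite /q ler_pdivlMr; last exact: den_gt0.
  rewrite ler_pdivrMl; last by rewrite ltr0n.
  have : den x <= 240.
    rewrite /den; have : eta ^+ 2 <= 100 by nra.
    suff : (x - E) ^+ 2 <= 140 by lra.
    have : 0 <= (23 / 2 - (x - E)) * (23 / 2 + (x - E)).
      apply: mulr_ge0; case: sA => -[s_ A_]; move: x1 x2 sE; rewrite s_ A_ => ? ? ?; lra.
    by rewrite expr2; lra.
  have : 1 <= sigma * (E - x).
    by case: sA => -[s_ A_]; move: x1 x2 sE; rewrite s_ A_ => ? ? ?; lra.
  by lra.
rewrite Rintegral_halves//; case: sigma1 => s_; subst sigma.
- have h1 : 0 <= 1 * (E - 0 - 1) by lra.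
  have := far 0 h1 (or_introl (conj erefl erefl)).
  have := near (-2) (or_introl (conj erefl erefl)).
  by rewrite add0r (_ : -2 + 2 = 0); [lra|ring].
- have h1 : 0 <= -1 * (E - -2 - 1) by lra.
  have := far (-2) h1 (or_intror (conj erefl erefl)).
  have := near 0 (or_intror (conj erefl erefl)).
  by rewrite add0r (_ : -2 + 2 = 0); [lra|ring].
Qed.

Lemma semicircle_Re_integrable :
  mu.-integrable `[-2, 2] (EFin \o (fun x => semicircle x * ((x - E) / den x))).
Proof.
apply: integrable_continuous => x; apply: cvgM; first exact: continuous_semicircle.
apply: cvgM; last exact: continuous_denV.
by apply: cvgB; [exact: cvg_id|exact: cvg_cst].
Qed.

End SemicircleIntegral.

Lemma cmod_msc_lb (R : realType) : exists2 c : R, 0 < c & forall z : R[i],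
  -10 <= complex.Re z <= 10 -> 0 < complex.Im z <= 10 -> c <= cmod (msc z).
Proof.
exists ((2 * pi)^-1 / 480).
  by apply: divr_gt0; rewrite ?ltr0n// invr_gt0 mulr_gt0 ?ltr0n// pi_gt0.
case=> E eta E10 /andP[eta0 eta10]; rewrite /= in E10 eta0 eta10.
have pi2 : 0 <= (2 * pi : R)^-1 by rewrite invr_ge0 mulr_ge0 ?pi_ge0.
rewrite /msc cmodM; apply: ler_pM.
- exact: pi2.
- by rewrite invr_ge0 ler0n.
- by rewrite /Normc.normc /= expr0n /= addr0 sqrtr_sqr ler_norm.
have intE (x : R) : (Num.sqrt (4 - x ^+ 2))%:C / (x%:C - (E +i* eta)) =
   (Num.sqrt (4 - x ^+ 2) * ((x - E) / ((x - E) ^+ 2 + eta ^+ 2))) +i*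
   (Num.sqrt (4 - x ^+ 2) * (eta / ((x - E) ^+ 2 + eta ^+ 2))).
  have d0 : (x - E) ^+ 2 + eta ^+ 2 != 0.
    by rewrite gt_eqF// ltr_wpDl ?sqr_ge0 ?exprn_gt0.
  apply/eqP; rewrite eq_complex /= !sub0r !sqrrN mulNr opprK !mul0r subr0 addr0.
  by rewrite !eqxx.
case/andP: (E10) => E1 E2.
set I := cintegral _ _ _.
have ReI : complex.Re I = Rintegral (@lebesgue_measure R) `[-2, 2]
   (fun x => Num.sqrt (4 - x ^+ 2) * ((x - E) / ((x - E) ^+ 2 + eta ^+ 2))).
  by apply: eq_Rintegral => x _; rewrite intE.
have ImI : complex.Im I = Rintegral (@lebesgue_measure R) `[-2, 2]
   (fun x => Num.sqrt (4 - x ^+ 2) * (eta / ((x - E) ^+ 2 + eta ^+ 2))).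
  by apply: eq_Rintegral => x _; rewrite intE.
have [Em|Em] := ltP E (-1).
  apply: le_trans (ler_Re_cmod I); rewrite ReI; apply: le_trans (ler_norm _).
  have := @semicircle_Re_integral R E eta eta0 (-1) (or_intror erefl).
  move=> /(_ (ltac:(lra)) E10 eta10); rewrite div1r => h.
  apply: (le_trans h); rewrite le_eqVlt; apply/orP; left; apply/eqP.
  by apply: eq_Rintegral => x _; rewrite mulN1r opprB.
have [Ep|Ep] := ltP 1 E.
  apply: le_trans (ler_Re_cmod I); rewrite ReI -normrN; apply: le_trans (ler_norm _).
  have := @semicircle_Re_integral R E eta eta0 1 (or_introl erefl).
  move=> /(_ (ltac:(lra)) E10 eta10); rewrite div1r => h.
  apply: (le_trans h); rewrite le_eqVlt; apply/orP; left; apply/eqP.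
  transitivity (Rintegral (@lebesgue_measure R) `[-2, 2] (fun x => -1 *
     (Num.sqrt (4 - x ^+ 2) * ((x - E) / ((x - E) ^+ 2 + eta ^+ 2))))).
    by apply: eq_Rintegral => x _; ring.
  rewrite RintegralZl ?mulN1r//; exact: semicircle_Re_integrable.
apply: le_trans (ler_Im_cmod I); rewrite ImI; apply: le_trans (ler_norm _).
have h := @semicircle_Im_integral R E eta eta0 (ltac:(apply/andP; split; lra)) eta10.
by apply: le_trans h; lra.
Qed.

(** * Moment bounds and expectations of products *)

Section Moments.
Context {R : realType} {d : measure_display} {T : measurableType d}.
Variables (P : probability T R) (I : finType) (repl : {set I} -> T -> T -> T).
Hypothesis HR : resampling P repl.
Variables (p : nat) (psi : R).
Hypotheses (p_gt0 : (0 < p)%N) (psi_gt0 : 0 < psi) (psi_le1 : psi <= 1).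
Implicit Types (f g : T -> R) (A : R) (L s : seq I) (near : pred I).

Let avg := row_average P repl.
Let fluct := row_fluct P repl.
Let flucts := row_flucts P repl.

(** [A] bounds the norm of [f] in [L^p]. *)
Definition moment_le f A : Prop := expect P (fun x => `|f x| ^+ p) <= A ^+ p.

Let bounded_rv_moment f : bounded_rv f -> bounded_rv (fun x => `|f x| ^+ p).
Proof. by move=> bf; apply: bounded_rvX; exact: bounded_rv_norm. Qed.

Lemma moment_le_trans f A B : 0 <= A -> A <= B -> moment_le f A -> moment_le f B.
Proof.
move=> A0 AB; move/le_trans; apply.
by rewrite lerXn2r ?nnegrE ?(le_trans A0 AB).
Qed.

Lemma moment_le_row_average S f A : bounded_rv f -> moment_le f A -> moment_le (avg S f) A.
Proof.
move=> bf; apply: le_trans.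
rewrite -(expect_row_average HR S (bounded_rv_moment bf)); apply: ler_expect.
- by apply: bounded_rv_moment; exact: bounded_rv_row_average.
- by apply: bounded_rv_row_average => //; exact: bounded_rv_moment.
- by move=> h; exact: (expect_jensen P p (bounded_rv_repl HR S h bf)).
Qed.

Lemma moment_le_row_fluct a f A : 0 <= A -> bounded_rv f -> moment_le f A ->
  moment_le (fluct a f) (4 * A).
Proof.
move=> A0 bf mf; have mP := moment_le_row_average [set a]%SET bf mf.
have bp := bounded_rv_row_average HR [set a]%SET bf.
have h (x y : R) : `|x - y| ^+ p <= 2 ^+ p * (`|x| ^+ p + `|y| ^+ p).
  have le2 : `|x - y| <= 2 * Num.max `|x| `|y|.
    apply: (le_trans (ler_normB _ _)).
    rewrite mulr2n mulrDl mul1r lerD// le_max lexx ?orbT//.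
  apply: (@le_trans _ _ ((2 * Num.max `|x| `|y|) ^+ p)).
    by rewrite lerXn2r ?nnegrE// mulr_ge0// le_max normr_ge0.
  rewrite exprMn ler_wpM2l ?exprn_ge0//; case: (leP `|x| `|y|) => _.
    by rewrite lerDr exprn_ge0.
  by rewrite lerDl exprn_ge0.
have b1 := bounded_rv_moment bf; have b2 := bounded_rv_moment bp.
have b3 := bounded_rvZ (2 ^+ p) (bounded_rvD b1 b2).
apply: (le_trans (ler_expect P (bounded_rv_moment (bounded_rv_row_fluct HR a bf)) b3
  (fun x => h _ _))).
rewrite expectZ; last exact: bounded_rvD.
rewrite expectD//; apply: (@le_trans _ _ (2 ^+ p * (A ^+ p + A ^+ p))).
  by rewrite ler_wpM2l ?exprn_ge0// lerD.
rewrite (_ : 4 = 2 * 2); last by ring.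
rewrite -mulrA [leRHS]exprMn ler_wpM2l ?exprn_ge0// exprMn.
rewrite -mulr2n -[leLHS]mulr_natl ler_wpM2r ?exprn_ge0//.
by case: (p) p_gt0 => // q _; rewrite exprS ler_peMr ?exprn_ege1// ler1n.
Qed.

Lemma moment_le_row_flucts s f A : 0 <= A -> bounded_rv f -> moment_le f A ->
  moment_le (flucts s f) (4 ^+ size s * A).
Proof.
move=> A0 bf mf; elim: s => [|a s IH] /=; first by rewrite expr0 mul1r.
rewrite exprS -mulrA; apply: moment_le_row_fluct => //.
  by rewrite mulr_ge0 ?exprn_ge0.
exact: bounded_rv_row_flucts.
Qed.

(** All the functions obtained from [f] by applying, for each row of [L],
    either the average or the fluctuation operator are bounded in [L^p] by [A],
    with an extra factor [psi] for each fluctuation in a row that is not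
    [near]. In the application the [near] rows are those among the indices of the
    monomial, where a fluctuation gains nothing. *)
Fixpoint fluct_bounded near L f A : Prop :=
  if L is a :: L' then
    fluct_bounded near L' (avg [set a]%SET f) A /\
    fluct_bounded near L' (fluct a f) (if near a then A else A * psi)
  else moment_le f A.

Lemma fluct_bounded_weaken near L f A B : 0 <= A -> A <= B ->
  fluct_bounded near L f A -> fluct_bounded near L f B.
Proof.
elim: L f A B => [|a L IH] f A B A0 AB /=; first exact: moment_le_trans.
move=> [h1 h2]; split; first exact: IH h1.
case: ifP h2 => _ h2; first exact: IH h2.
apply: IH h2; first exact: mulr_ge0 (ltW psi_gt0).
by rewrite ler_pM2r.
Qed.

(** Averages do not increase moments and fluctuations at most by the factor 4, so
    only the fluctuations in rows that are not [near] have to be kept, and these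
    commute past the other operators. *)
Lemma fluct_bounded_moments near L f A : 0 <= A -> bounded_rv f -> uniq L ->
  (forall s, uniq s -> {subset s <= L} -> (forall x, x \in s -> ~~ near x) ->
     moment_le (flucts s f) (A * psi ^+ size s)) ->
  fluct_bounded near L f (4 ^+ size L * A).
Proof.
elim: L f A => [|a L IH] f A A0 bf uL Hs.
  have := Hs [::] isT (fun x => ltac:(by [])) (fun x => ltac:(by [])).
  by rewrite /= !expr0 mulr1 mul1r.
move: uL => /= /andP[aL uL].
have bP := bounded_rv_row_average HR [set a]%SET bf; have bQ := bounded_rv_row_fluct HR a bf.
have sL s : {subset s <= L} -> {subset s <= a :: L}.
  by move=> h x /h; rewrite inE => ->; rewrite orbT.
have le4 : 4 ^+ size L * A <= 4 ^+ (size L).+1 * A.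
  by rewrite ler_wpM2r// ler_weXn2l// ler1n.
have A4 : 0 <= 4 ^+ size L * A by rewrite mulr_ge0 ?exprn_ge0.
split.
  apply: fluct_bounded_weaken A4 le4 _; apply: IH => // s us ss sn.
  rewrite /flucts /avg row_flucts_row_averageC//; apply: moment_le_row_average; first exact: bounded_rv_row_flucts.
  by apply: Hs => //; exact: sL.
case: ifPn => na.
  rewrite exprSr -mulrA; apply: IH => //; first by rewrite mulr_ge0.
  move=> s us ss sn; rewrite /flucts /fluct row_flucts_row_fluctC// -mulrA.
  apply: moment_le_row_fluct.
  - by rewrite mulr_ge0 ?exprn_ge0 ?(ltW psi_gt0).
  - exact: bounded_rv_row_flucts.
  - by apply: Hs => //; exact: sL.
have Ap : 0 <= A * psi by exact: mulr_ge0 (ltW psi_gt0).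
apply: (@fluct_bounded_weaken _ _ _ (4 ^+ size L * (A * psi))).
- by rewrite mulr_ge0 ?exprn_ge0.
- by rewrite mulrA ler_wpM2r ?(ltW psi_gt0).
apply: IH => // s us ss sn; rewrite /flucts /fluct row_flucts_row_fluctC//.
rewrite -mulrA -exprS; apply: (Hs (a :: s)).
- by rewrite /= us andbT; apply: contraNN aL => /ss.
- by move=> x; rewrite inE => /orP[/eqP->|/ss]; rewrite inE ?eqxx// => ->; rewrite orbT.
- by move=> x; rewrite inE => /orP[/eqP->|/sn].
Qed.

(** A substitute for the inequality of the means, with the constant [p]: the product is at
    most the [p]-th power of its largest factor. *)
Let prod_le_sum_pow (y : 'I_p -> R) : (forall k, 0 <= y k) ->
  \prod_k y k <= \sum_k y k ^+ p.
Proof.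
move=> y0; pose k0 : 'I_p := Ordinal p_gt0.
case: (@arg_maxP _ _ _ k0 predT y) => // k _ kmax.
rewrite [leRHS](bigD1 k) //= -[leLHS]addr0 lerD//.
  rewrite -[p in X in _ <= X]card_ord -prodr_const.
  by apply: ler_prod => l _; rewrite y0 /=; exact: kmax.
by apply: sumr_ge0 => l _; rewrite exprn_ge0.
Qed.

Lemma expect_prod_moments (f : 'I_p -> T -> R) (A : 'I_p -> R) :
  (forall k, 0 < A k) -> (forall k, bounded_rv (f k)) ->
  (forall k, moment_le (f k) (A k)) ->
  `|expect P (fun x => \prod_k f k x)| <= p%:R * \prod_k A k.
Proof.
move=> A0 bf mf.
have bprod : bounded_rv (fun x => \prod_k f k x) by apply: bounded_rv_prod.
apply: (le_trans (ler_norm_expect P bprod)).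
pose c := \prod_k A k; have c0 : 0 < c by exact: prodr_gt0.
have b1 k : bounded_rv (fun x => (A k ^+ p)^-1 * `|f k x| ^+ p).
  by apply: bounded_rvZ; exact: bounded_rv_moment.
have b2 : bounded_rv (fun x => \sum_k (A k ^+ p)^-1 * `|f k x| ^+ p).
  by apply: bounded_rv_sum.
apply: (@le_trans _ _ (expect P (fun x => c * \sum_k (A k ^+ p)^-1 * `|f k x| ^+ p))).
  apply: ler_expect; [exact: bounded_rv_norm|exact: bounded_rvZ|].
  move=> x; rewrite normr_prod.
  have -> : \prod_k `|f k x| = c * \prod_k (`|f k x| / A k).
    by rewrite /c -big_split /=; apply: eq_bigr => k _; rewrite mulrC divfK// gt_eqF.
  rewrite ler_pM2l//; apply: (le_trans (prod_le_sum_pow _)).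
    by move=> k; rewrite divr_ge0// ltW.
  by apply: ler_sum => k _; rewrite expr_div_n mulrC.
rewrite expectZ// expect_sum// mulrC ler_pM2r//.
rewrite -[p in leRHS]card_ord -sumr_const; apply: ler_sum => k _.
rewrite expectZ; last exact: bounded_rv_moment.
by rewrite ler_pdivrMl ?exprn_gt0// mulr1 mf.
Qed.

(** If the row [a] is integrated out of every factor but the one that is centred
    with respect to it, the expectation vanishes. So in the expansion of the
    product over the rows of [L], for every row at least one factor other than
    its owner fluctuates, and contributes a factor [psi]. *)
Lemma expect_prod_fluct L (f : 'I_p -> T -> R) (A : 'I_p -> R)
    (near : 'I_p -> pred I) :
  (forall k, 0 < A k) -> (forall k, bounded_rv (f k)) ->
  (forall a, a \in L -> exists2 k0 : 'I_p, avg [set a]%SET (f k0) = (fun=> 0) &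
     forall k, k != k0 -> ~~ near k a) ->
  (forall k, fluct_bounded (near k) L (f k) (A k)) ->
  `|expect P (fun x => \prod_k f k x)| <=
  p%:R * 2 ^+ (p * size L) * (\prod_k A k) * psi ^+ size L.
Proof.
elim: L f A => [|a L IH] f A A0 bf own good.
  by rewrite /= muln0 !expr0 !mulr1; apply: expect_prod_moments.
have [k0 Pk0 near0] := own a (mem_head _ _).
pose g (b : {ffun 'I_p -> bool}) k := if b k then fluct a (f k) else avg [set a]%SET (f k).
have bg b k : bounded_rv (g b k).
  by rewrite /g; case: ifP => _; [exact: bounded_rv_row_fluct|exact: bounded_rv_row_average].
have bgp b (D : pred 'I_p) : bounded_rv (fun x => \prod_(k | D k) g b k x).
  exact: bounded_rv_prod.
have -> : (fun x => \prod_k f k x) = (fun x => \sum_b \prod_k g b k x).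
  apply/funext => x; rewrite (eq_bigr (fun k => \sum_(b : bool)
      if b then fluct a (f k) x else avg [set a]%SET (f k) x)); last first.
    by move=> k _; rewrite big_bool /= /fluct /row_fluct subrK.
  rewrite bigA_distr_bigA /=; apply: eq_bigr => b _; apply: eq_bigr => k _.
  by rewrite /g; case: ifP.
rewrite expect_sum//; apply: (le_trans (ler_norm_sum _ _ _)).
set B := p%:R * 2 ^+ (p * size L) * (\prod_k A k) * psi ^+ (size L).+1.
have B0 : 0 <= B.
  by rewrite !mulr_ge0 ?exprn_ge0 ?(ltW psi_gt0)//; apply: prodr_ge0 => k _; exact: ltW.
suff Hb b : `|expect P (fun x => \prod_k g b k x)| <= B.
  apply: (@le_trans _ _ (\sum_(b : {ffun 'I_p -> bool}) B)).
    by apply: ler_sum.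
  have e2 : (2 ^ p)%:R = 2 ^+ p :> R by rewrite natrX.
  rewrite sumr_const card_ffun card_bool card_ord -[leLHS]mulr_natl e2 /B /=.
  by rewrite mulnS exprD le_eqVlt; apply/orP; left; apply/eqP; ring.
have split0 x : \prod_k g b k x = g b k0 x * \prod_(k | k != k0) g b k x.
  by rewrite (bigD1 k0).
have [b0|b0] := boolP (b k0); last first.
  rewrite (_ : (fun x => _) = fun=> 0) ?expect_cst ?normr0//.
  by apply/funext => x; rewrite split0 {1}/g (negbTE b0) Pk0 mul0r.
have [/existsP[k1 /andP[k10 b1]]|none] := boolP [exists k, (k != k0) && b k]; last first.
  rewrite (_ : (fun x => _) = fun x => fluct a (f k0) x *
      \prod_(k | k != k0) g b k x); last first.
    by apply/funext => x; rewrite split0 {1}/g b0.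
  rewrite (expect_row_fluct_mul HR)// ?normr0// => h h'; apply: eq_bigr => k kk0.
  have -> : g b k = avg [set a]%SET (f k).
    rewrite /g ifF//; apply: contraNF none => bk; apply/existsP; exists k.
    by rewrite kk0.
  exact: row_free_of_row_average.
pose A' k := if b k && ~~ near k a then A k * psi else A k.
have A'0 k : 0 < A' k by rewrite /A'; case: ifP => _; rewrite ?mulr_gt0.
have := IH (g b) A' A'0 (bg b) _ _ => /(_ _ _)/le_trans; apply.
- move=> a' a'L; have [|k2 Pk2 near2] := own a'.
    by rewrite inE a'L orbT.
  exists k2 => //; rewrite /g; case: ifP => _.
    rewrite /avg /fluct (row_average_row_fluctC HR)// -/(avg [set a']%SET (f k2)) Pk2.
    by apply/funext => h; rewrite /row_fluct /row_average expect_cst subrr.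
  rewrite /avg (row_averageC HR)// -/(avg [set a']%SET (f k2)) Pk2.
  by apply/funext => h; rewrite /row_average expect_cst.
- move=> k; have [gP gQ] := good k; rewrite /g /A'; case: (b k) => //=.
  by move: gQ; case: (near k a).
rewrite /B exprS; have cA : 0 <= p%:R * 2 ^+ (p * size L) :> R.
  by rewrite mulr_ge0 ?exprn_ge0.
rewrite [leRHS]mulrA ler_wpM2r ?exprn_ge0 ?(ltW psi_gt0)// -[leRHS]mulrA ler_wpM2l//.
rewrite (bigD1 k1) //= [in leRHS](bigD1 k1) //= {1}/A' b1 near0//= mulrAC.
rewrite ler_pM2r// ler_pM2l//; apply: ler_prod => k _; rewrite ltW ?A'0//=.
rewrite /A'; case: ifP => // _.
by rewrite ger_pMr.
Qed.

End Moments.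

(** * Sums over coinciding indices *)

Section Weights.
Variables (R : realType) (V : finType) (N : nat) (M : R).
Variable w : {ffun V -> 'I_N} -> R.
Hypotheses (M_gt0 : 0 < M) (w_ge0 : forall a, 0 <= w a).
Hypothesis w_fix : forall (I : {set V}) (b : {ffun V -> 'I_N}),
  \sum_(a : {ffun V -> 'I_N} | injectiveb a && [forall i in I, a i == b i]) w a
  <= M ^- #|I|.
Implicit Types (a b : {ffun V -> 'I_N}) (Y : {set 'I_N}).

Definition hits Y a : {set V} := [set i | a i \in Y]%SET.

(** The indices in [I] have [#|Y| ^ #|I|] possible values in [Y], and fixing them
    divides the total weight by [M] for each index. *)
Let sum_hits_in (y0 : 'I_N) (I : {set V}) Y :
  \sum_(a : {ffun V -> 'I_N} | injectiveb a && (hits Y a == I)) w a <= #|Y|%:R ^+ #|I| * M ^- #|I|.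
Proof.
pose h a : {ffun V -> 'I_N} := [ffun i => if i \in I then a i else y0].
rewrite (partition_big h (mem (pffun_on y0 (mem I) (mem Y)))) /=; last first.
  move=> a /andP[_ /eqP hI]; apply/pffun_onP; split.
    by apply/supportP => i iI; rewrite ffunE (negbTE iI).
  move=> y /fintype.imageP [i iI ->]; rewrite ffunE.
  have -> : i \in I = true by exact: iI.
  by move: iI; rewrite -hI inE.
rewrite -natrX -(card_pffun_on y0 (mem I) (mem Y)) mulr_natl -sumr_const.
apply: ler_sum => b _; apply: le_trans (w_fix I b).
rewrite big_mkcond [leRHS]big_mkcond /=; apply: ler_sum => a _.
case: ifP => [/andP[/andP[ia _] /eqP hb]|_]; last by case: ifP.
rewrite ifT// ia; apply/'forall_implyP => i iI.
by rewrite -hb ffunE iI.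
Qed.

Lemma sum_weight_hits (y0 : 'I_N) Y :
  \sum_(a : {ffun V -> 'I_N} | injectiveb a) w a * M ^+ #|hits Y a| <=
  2 ^+ #|V| * (1 + #|Y|%:R) ^+ #|V|.
Proof.
rewrite (partition_big (hits Y) predT) //=.
apply: (@le_trans _ _ (\sum_(I : {set V}) (1 + #|Y|%:R : R) ^+ #|V|)).
  apply: ler_sum => I _; apply: (@le_trans _ _ (#|Y|%:R ^+ #|I|)).
    have := sum_hits_in y0 I Y.
    rewrite ler_pdivlMr ?exprn_gt0// mulr_suml; apply: le_trans.
    by apply: ler_sum => a /andP[_ /eqP ->].
  apply: (@le_trans _ _ ((1 + #|Y|%:R) ^+ #|I|)).
    by rewrite lerXn2r ?nnegrE ?addr_ge0// lerDr.
  by rewrite ler_weXn2l ?max_card// lerDl.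
have e2 : (2 ^ #|V|)%:R = 2 ^+ #|V| :> R by rewrite natrX.
have cV : #|{set V}| = (2 ^ #|V|)%N.
  by rewrite -[LHS]finset.cardsT -finset.powersetT finset.card_powerset finset.cardsT.
by rewrite sumr_const cV -[leLHS]mulr_natl e2.
Qed.

Definition values (s : seq {ffun V -> 'I_N}) : {set 'I_N} :=
  [set v | has (fun a => [exists i, a i == v]) s]%SET.

Lemma card_values s : (#|values s| <= size s * #|V|)%N.
Proof.
elim: s => [|a s IH].
  by rewrite leqn0 finset.cards_eq0; apply/eqP/finset.setP => v; rewrite !inE.
have -> : values (a :: s) = (a @: [set: V] :|: values s)%SET.
  apply/finset.setP => v; rewrite !inE /=; congr (_ || _).
  apply/existsP/finset.imsetP => [[i /eqP <-]|[i _ ->]]; by exists i; rewrite ?inE.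
apply: (leq_trans (leq_card_setU _ _)); rewrite mulSn leq_add//.
by apply: (leq_trans (leq_imset_card _ _)); rewrite cardsT.
Qed.

(** Each index of an assignment that repeats a value of a previous one is
    compensated by a factor [M], which keeps the sum over all sequences bounded
    ([sum_seq_weight]). *)
Fixpoint seq_weight (s t : seq {ffun V -> 'I_N}) : R :=
  if t is a :: t' then
    (if injectiveb a then w a * M ^+ #|hits (values s) a| else 0) *
    seq_weight (rcons s a) t'
  else 1.

Lemma big_tuple_cons (A : finType) (n : nat) (F : n.+1.-tuple A -> R) :
  \sum_t F t = \sum_a \sum_(t : n.-tuple A) F [tuple of a :: t].
Proof.
rewrite pair_big /= (reindex (fun u : A * n.-tuple A => [tuple of u.1 :: u.2])) //=.
exists (fun t => (thead t, [tuple of behead t])) => [[a t] _|t _] /=.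
  by congr (_, _); apply/val_inj.
by rewrite /= -tuple_eta.
Qed.

Lemma sum_seq_weight (y0 : 'I_N) (p n : nat) s : (size s + n <= p)%N ->
  \sum_(t : n.-tuple {ffun V -> 'I_N}) seq_weight s t <=
  (2 ^+ #|V| * (1 + (p * #|V|)%:R) ^+ #|V|) ^+ n.
Proof.
set C := 2 ^+ #|V| * _; have C0 : 0 <= C by rewrite mulr_ge0 ?exprn_ge0 ?addr_ge0.
elim: n s => [|n IH] s sp.
  rewrite expr0 (big_pred1 [tuple]) ?lexx// => t; apply/esym/eqP.
  by rewrite [t]tuple0.
rewrite big_tuple_cons /=; under eq_bigr do rewrite -mulr_sumr.
apply: (@le_trans _ _ (\sum_(a : {ffun V -> 'I_N} | injectiveb a)
   (w a * M ^+ #|hits (values s) a|) * C ^+ n)).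
  rewrite [leRHS]big_mkcond; apply: ler_sum => a _; case: ifP => _; last by rewrite mul0r.
  rewrite ler_wpM2l ?mulr_ge0 ?exprn_ge0 ?(ltW M_gt0)//.
  by apply: IH; rewrite size_rcons addSnnS.
rewrite -mulr_suml exprS ler_wpM2r ?exprn_ge0//.
apply: (le_trans (sum_weight_hits y0 _)).
rewrite ler_wpM2l ?exprn_ge0// lerXn2r ?nnegrE ?addr_ge0// lerD2l ler_nat.
apply: (leq_trans (card_values s)); rewrite leq_mul2r orbC.
by rewrite (leq_trans (leq_addr n.+1 _)).
Qed.

Lemma seq_weightE s t : all (fun a => injectiveb a) t ->
  seq_weight s t = \prod_(k < size t)
    (w (tnth (in_tuple t) k) *
     M ^+ #|hits (values (s ++ take k t)) (tnth (in_tuple t) k)|).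
Proof.
elim: t s => [|a t IH] s /=; first by rewrite big_ord0.
move=> /andP[ia it]; rewrite ia big_ord_recl /= cats0; congr (_ * _).
rewrite IH//; apply: eq_bigr => k _.
by rewrite !(tnth_nth a) /= cat_rcons.
Qed.

End Weights.

Lemma expr_sum_tuple (R : realType) (A : finType) (X : A -> R) (n : nat) :
  (\sum_a X a) ^+ n = \sum_(t : n.-tuple A) \prod_(k < n) X (tnth t k).
Proof.
elim: n => [|n IH].
  rewrite expr0 (big_pred1 [tuple]) ?big_ord0// => t; apply/esym/eqP.
  by rewrite [t]tuple0.
rewrite exprS IH big_tuple_cons mulr_suml; apply: eq_bigr => a _.
rewrite mulr_sumr; apply: eq_bigr => t _; rewrite big_ord_recl tnth0.
by congr (_ * _); apply: eq_bigr => k _; rewrite tnthS.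
Qed.

Section LoneIndices.
Variables (V : finType) (N p : nat) (t : p.-tuple {ffun V -> 'I_N}) (F : {set V}).
Hypothesis t_inj : forall k, injective (tnth t k).

Let occurs_elsewhere (u : 'I_p * V) :=
  [exists l, (l != u.1) && [exists j, tnth t l j == tnth t u.1 u.2]].

Let repeated : {set 'I_p * V} :=
  [set u | tnth t u.1 u.2 \in values (take u.1 t)]%SET.

Let lone : {set 'I_p * V} := [set u | (u.2 \in F) && ~~ occurs_elsewhere u]%SET.

Definition lone_values : {set 'I_N} := [set tnth t u.1 u.2 | u in lone]%SET.

Lemma lone_valuesP v : v \in lone_values -> exists k0 i0,
  [/\ i0 \in F, tnth t k0 i0 = v & forall k j, k != k0 -> tnth t k j != v].
Proof.
move=> /finset.imsetP [[k0 i0]]; rewrite inE /= => /andP[iF lo] ->.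
exists k0, i0; split => // k j kk0; apply: contraNN lo => /eqP e.
by apply/existsP; exists k; rewrite kk0; apply/existsP; exists j; rewrite e.
Qed.

Lemma card_lone_values : (#|lone_values| <= p * #|F|)%N.
Proof.
apply: (leq_trans (leq_imset_card _ _)).
have <- : #|finset.setX [set: 'I_p] F| = (p * #|F|)%N.
  by rewrite finset.cardsX finset.cardsT card_ord.
apply: subset_leq_card; apply/fintype.subsetP => u.
by rewrite !inE => /andP[].
Qed.

Let repeatedP (u : 'I_p * V) :
  reflect (exists (l : 'I_p) (j : V), (l < u.1)%N /\ tnth t l j = tnth t u.1 u.2)
  (u \in repeated).
Proof.
have st : size (take u.1 t) = u.1 by rewrite size_take size_tuple ltn_ord.
rewrite !inE; apply: (iffP hasP) => [[a /(nthP (tnth t u.1)) [l]]|[l [j [lk e]]]].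
  rewrite st => lk; rewrite nth_take// => <- /existsP[j /eqP e].
  have lp : (l < p)%N by apply: ltn_trans lk (ltn_ord _).
  by exists (Ordinal lp), j; rewrite (tnth_nth (tnth t u.1)).
exists (tnth t l); last by apply/existsP; exists j; rewrite e.
apply/(nthP (tnth t u.1)); exists l; first by rewrite st.
by rewrite nth_take// -tnth_nth.
Qed.

(** A class of equal indices with [b >= 2] members contains [b - 1 >= b / 2]
    repetitions. *)
Lemma lone_count : (p * #|F| <= #|lone_values| +
   2 * \sum_(k < p) #|hits (values (take k t)) (tnth t k)|)%N.
Proof.
have -> : (\sum_(k < p) #|hits (values (take k t)) (tnth t k)| = #|repeated|)%N.
  transitivity (\sum_(k < p) \sum_(i | (k, i) \in repeated) 1)%N.
    apply: eq_bigr => k _; rewrite -sum1_card.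
    by apply: eq_bigl => i; rewrite !inE.
  rewrite -[RHS]sum1_card pair_big_dep /=.
  by apply: eq_bigl => -[k i].
have cl : #|lone_values| = #|lone|.
  rewrite /lone_values finset.card_in_imset // => -[k i] [l j].
  rewrite !inE /= => /andP[_ lo] _ e; have kl : l = k.
    apply: contraNeq lo => lk; apply/existsP; exists l; rewrite lk.
    by apply/existsP; exists j; rewrite e.
  by subst l; rewrite (t_inj e).
pose U : {set 'I_p * V} := [set u | (u.2 \in F) && occurs_elsewhere u]%SET.
have -> : (p * #|F| = #|lone| + #|U|)%N.
  have <- : #|finset.setX [set: 'I_p] F| = (p * #|F|)%N.
    by rewrite finset.cardsX finset.cardsT card_ord.
  rewrite -[LHS](finset.cardsID lone); congr (_ + _)%N; apply: eq_card => u.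
    by rewrite !inE; case: (_ \in F).
  by rewrite !inE; case: (_ \in F) => //=; rewrite ?andbT ?negbK ?andbF.
rewrite cl leq_add2l mul2n -addnn -[leqLHS](finset.cardsID repeated U) leq_add//.
  by apply: subset_leq_card; exact: finset.subsetIr.
(* The first member of a class is sent to one of the later members. *)
pose g (u : 'I_p * V) : 'I_p * V :=
  odflt u [pick v | (v.1 != u.1) && (tnth t v.1 v.2 == tnth t u.1 u.2)].
have gP u : u \in U :\: repeated ->
    [/\ (u.1 < (g u).1)%N & tnth t (g u).1 (g u).2 = tnth t u.1 u.2].
  rewrite finset.in_setD => /andP[nr]; rewrite inE => /andP[_ oc].
  rewrite /g; case: pickP => [v /andP[vu /eqP e]|none] /=; last first.
    have /existsP[l /andP[lu /existsP[j e]]] := oc.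
    by have := none (l, j); rewrite /= lu e.
  split => //; rewrite ltn_neqAle eq_sym vu leqNgt; apply: contraNN nr => vlt.
  by apply/repeatedP; exists v.1, v.2.
rewrite -(@finset.card_in_imset _ _ g); last first.
  move=> u v uU vU e; have [ug eu] := gP u uU; have [vg ev] := gP v vU.
  have euv : tnth t u.1 u.2 = tnth t v.1 v.2 by rewrite -eu -ev e.
  have uv : u.1 = v.1.
    apply/val_inj; case: (ltngtP u.1 v.1) => // lt.
      move: vU; rewrite finset.in_setD => /andP[/negP[]]; apply/repeatedP.
      by exists u.1, u.2.
    move: uU; rewrite finset.in_setD => /andP[/negP[]]; apply/repeatedP.
    by exists v.1, v.2.
  case: u v uv euv {uU vU e ug eu vg ev} => [k i] [l j] /= -> e.
  by rewrite (t_inj e).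
apply: subset_leq_card; apply/fintype.subsetP => _ /finset.imsetP [u uU ->].
by have [lt e] := gP u uU; apply/repeatedP; exists u.1, u.2.
Qed.

End LoneIndices.

(** For an adapted weight, restricting to pairwise distinct indices singles out
    the partition of [J] into singletons. *)
Lemma adapted_weight_fix (R : realType) (Delta : admissible_graph) (N : nat)
    (M : R) (w : {ffun gsum Delta -> 'I_N} -> R) :
  adapted_weight M w -> forall (I : {set gsum Delta}) (b : {ffun gsum Delta -> 'I_N}),
  \sum_(a : {ffun gsum Delta -> 'I_N} |
     injectiveb a && [forall i in I, a i == b i]) w a <= M ^- #|I|.
Proof.
move=> [w01 wa] I b; pose J := ~: I.
pose Pi := [set [set x] | x in J]%SET.
have PiE (a : {ffun gsum Delta -> 'I_N}) : injectiveb a -> preim_partition a J = Pi.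
  move=> /injectiveP ia; apply: finset.eq_in_imset => x xJ; apply/finset.setP => y.
  rewrite !inE; apply/andP/eqP => [[_ /eqP /ia //]|->]; split => //.
  by move: xJ; rewrite inE.
have cPi : #|Pi| = #|J| by rewrite finset.card_imset//; exact: finset.set1_inj.
have pPi : finset.partition Pi J.
  apply/and3P; split.
  - apply/eqP/finset.setP => x; apply/finset.bigcupP/idP => [[_ /finset.imsetP [y yJ ->]]|xJ].
      by rewrite inE => /eqP ->.
    by exists [set x]%SET; [exact: finset.imset_f|rewrite inE].
  - apply/finset.trivIsetP => _ _ /finset.imsetP [x _ ->] /finset.imsetP [y _ ->] xy.
    by rewrite finset.disjoints1 inE; apply: contraNN xy => /eqP ->.
  - by apply/finset.imsetP => -[x _ /esym/eqP]; rewrite -finset.cards_eq0 finset.cards1.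
have := wa J Pi pPi b; rewrite cPi.
have -> : #|J|%:Z - #|gsum Delta|%:Z = - #|I|%:Z.
  by rewrite -(finset.cardsC I) -/J PoszD; ring.
rewrite -exprnN; apply: le_trans.
rewrite [leLHS]big_mkcond [leRHS]big_mkcond; apply: ler_sum => a _.
have w0 : 0 <= w a by have /andP[] := w01 a.
case: ifP => [/andP[ia /'forall_implyP ab]|_]; last by case: ifP.
rewrite PiE// eqxx andbT ifT//; apply/'forall_implyP => i.
by rewrite /J finset.setCK; exact: ab.
Qed.

(** * The high moments of an average *)

Section MeasurableDeviation.
Variables (R : realType) (N : nat) (m z : R[i]).
Hypothesis z0 : 0 < complex.Im z.

Lemma measurable_cmod d (X : measurableType d) (f : X -> R[i]) :
  cmeasurable f -> measurable_fun setT (fun x => cmod (f x)).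
Proof.
move=> [fr fi].
have ms : measurable_fun setT (@Num.sqrt R).
  by apply: continuous_measurable_fun; exact: sqrt_continuous.
rewrite (_ : (fun x => _) = fun x =>
    Num.sqrt (complex.Re (f x) ^+ 2 + complex.Im (f x) ^+ 2)).
  apply: (measurableT_comp ms).
  by apply: measurable_funD; exact: measurable_funX.
by apply/funext => x; case: (f x).
Qed.

Lemma measurable_bigmax d (X : measurableType d) (I : Type) (r : seq I)
    (F : I -> X -> R) : (forall i, measurable_fun setT (F i)) ->
  measurable_fun setT (fun x => \big[Num.max/0]_(i <- r) F i x).
Proof.
move=> mF; elim: r => [|i r IH].
  rewrite [X in measurable_fun _ X](_ : _ = fun=> 0); first exact: measurable_cst.
  by apply/funext => x; rewrite big_nil.
rewrite [X in measurable_fun _ X](_ : _ =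
   fun x => Num.max (F i x) (\big[Num.max/0]_(i <- r) F i x)); last first.
  by apply/funext => x; rewrite big_cons.
exact: measurable_maxr.
Qed.

Lemma measurable_max_deviation :
  measurable_fun setT (fun h : sample_space R N => max_deviation m z (hermitize h)).
Proof.
rewrite /max_deviation; apply: measurable_bigmax => x; apply: measurable_bigmax => y.
apply: measurable_cmod; apply: cmeasurableB; last exact: cmeasurable_cst.
apply: cmeasurable_resolvent => // [k l|h]; first exact: cmeasurable_hermitize.
exact: hermitize_hermitian.
Qed.

Lemma measurable_lt d (X : measurableType d) (f : X -> R) r :
  measurable_fun setT f -> measurable [set x | r < f x].
Proof.
move=> mf; rewrite (_ : [set x | _] = f @^-1` `]r, +oo[); last first.
  by apply/seteqP; split => x /=; rewrite in_itv /= andbT.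
by rewrite -[X in measurable X]setTI; apply: mf => //; exact: measurable_itv.
Qed.

End MeasurableDeviation.

Lemma expect_indic (R : realType) d (T : measurableType d) (P : probability T R)
    (B : set T) : measurable B -> expect P (\1_B : T -> R) = fine (P B).
Proof.
by move=> mB; rewrite /expect /Rintegral integral_indic// setIT.
Qed.

Lemma bounded_rv_indic (R : realType) d (T : measurableType d) (B : set T) :
  measurable B -> bounded_rv (\1_B : T -> R).
Proof.
move=> mB; split; first exact: measurable_indic.
by exists 1 => x; rewrite indicE; case: (_ \in _); rewrite ?normr1 ?normr0.
Qed.

Lemma norm_fdiff (R : realType) (I : finType) (phi : {set I} -> R[i]) s V (K : R) :
  (forall W, cmod (phi W) <= K) -> cmod (fdiff s phi V) <= 2 ^+ size s * K.
Proof.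
move=> phiK; elim: s V => [|a s IH] V; first by rewrite expr0 mul1r; exact: phiK.
rewrite fdiff_cons; apply: (le_trans (cmodB _ _)).
by rewrite exprS -mulrA mulr2n mulrDl mul1r lerD.
Qed.

Section AverageMoments.
Variables (R : realType) (N : nat) (nu : probability (sample_space R N) R).
Hypothesis HR : resampling nu (@replace_rows R N).
Variables (Delta : admissible_graph) (F : {set gsum Delta}) (m z : R[i]).
Variables (p : nat) (C K psi Y : R).
Hypotheses (z0 : 0 < complex.Im z) (p_gt0 : (0 < p)%N).
Hypotheses (C_ge0 : 0 <= C) (psi_gt0 : 0 < psi) (psi_le1 : psi <= 1) (Y_ge1 : 1 <= Y).
Hypothesis entry_le : (complex.Im z)^-1 + cmod m <= K.
Local Notation n := (p * #|F|)%N.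
Local Notation D := (deg Delta).
Implicit Types (a : {ffun gsum Delta -> 'I_N}) (mu : {ffun gext Delta -> 'I_N}).

Hypothesis monomial_controlled : forall (h : 'M[R[i]]_N) a mu (X : {set 'I_N}),
  is_hermitian h -> max_deviation m z h <= Y * psi -> (#|X| <= n)%N ->
  (forall i, a i \notin X) -> (forall j, mu j \notin X) ->
  controlled (Y * psi) X D C
    (fun V : {set 'I_N} => mx_monomial m z a mu (zero_rows V h)).

Let bad : set (sample_space R N) :=
  [set h | Y * psi < max_deviation m z (hermitize h)].

(** On the bad event only the trivial bound [K] on the entries is available. *)
Hypothesis bad_small :
  (2 ^+ n * K ^+ D) ^+ p * fine (nu bad) <= (psi ^+ (D + n)) ^+ p.

Variables (pi : R[i] -> R).
Hypothesis piP : pi = @complex.Re R \/ pi = @complex.Im R.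

Let measurable_bad : measurable bad.
Proof. by apply: measurable_lt; exact: measurable_max_deviation. Qed.

Let Z a mu (V : {set 'I_N}) (h : sample_space R N) : R :=
  pi (mx_monomial m z a mu (zero_rows V (hermitize h))).

Let bounded_Z a mu V : bounded_rv (Z a mu V).
Proof. exact: bounded_rv_mx_monomial. Qed.

Let Y_gt0 : 0 < Y. Proof. exact: lt_le_trans ltr01 Y_ge1. Qed.

Let fdiff_pi a mu s h :
  `|fdiff s (fun V => Z a mu V h) finset.set0| <=
  cmod (fdiff s (fun V : {set 'I_N} =>
    mx_monomial m z a mu (zero_rows V (hermitize h))) finset.set0).
Proof.
case: piP => e; rewrite /Z e.
  by rewrite (fdiff_morph (@complex.Re R)) ler_Re_cmod.
by rewrite (fdiff_morph (@complex.Im R)) ler_Im_cmod.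
Qed.

Let A1 := 4 ^+ n * ((C + 1) * Y ^+ (D + n) * psi ^+ D).

Let A1_gt0 : 0 < A1.
Proof.
have C0 : 0 <= C := C_ge0.
by rewrite !mulr_gt0 ?exprn_gt0//; lra.
Qed.

(** Fluctuations in rows that the monomial does not mention: it may be replaced
    by its iterated difference, which is small unless the resolvent deviates
    from its limit. *)
Lemma moment_row_flucts a mu s : uniq s -> (size s <= n)%N ->
  (forall i, a i \notin s) -> (forall j, mu j \notin s) ->
  moment_le nu p (row_flucts nu (@replace_rows R N) s (Z a mu finset.set0))
    (A1 * psi ^+ size s).
Proof.
move=> us sn as_ mus.
rewrite (row_flucts_fdiff HR s finset.set0 (bounded_Z a mu)); last first.
  by move=> W b bW h h'; rewrite /Z zero_rows_replace.
set Df := (fun h : sample_space R N => _).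
have bD : bounded_rv Df by exact: bounded_rv_fdiff.
pose X : {set 'I_N} := [set x in s]%SET.
have cX : (#|X| <= n)%N by rewrite cardsE (card_uniqP us).
have C0 : 0 <= C := C_ge0.
have Yp0 : 0 < Y * psi by rewrite mulr_gt0.
have K0 : 0 <= K.
  by apply: le_trans entry_le; rewrite addr_ge0 ?cmod_ge0// invr_ge0 ltW.
pose good_bd := C * (Y * psi) ^+ (D + size s).
have good0 : 0 <= good_bd by rewrite mulr_ge0 ?exprn_ge0 ?(ltW Yp0).
pose bad_bd := 2 ^+ n * K ^+ D.
have bad0 : 0 <= bad_bd by rewrite mulr_ge0 ?exprn_ge0.
have ptw h : `|Df h| ^+ p <= good_bd ^+ p + bad_bd ^+ p * \1_bad h.
  have hh := hermitize_hermitian h.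
  have [hb|hb] := boolP (h \in bad).
    rewrite indicE hb mulr1; apply: (@le_trans _ _ (bad_bd ^+ p)); last first.
      by rewrite lerDr exprn_ge0.
    rewrite lerXn2r ?nnegrE//; apply: (le_trans (fdiff_pi a mu s h)).
    apply: (@le_trans _ _ (2 ^+ size s * K ^+ D)).
      apply: norm_fdiff => W; apply: (le_trans (cmod_mx_monomial _ _ _ _ z0)).
        exact: zero_rows_hermitian.
      by rewrite lerXn2r ?nnegrE ?addr_ge0 ?cmod_ge0 ?invr_ge0 ?(ltW z0).
    by rewrite ler_wpM2r ?exprn_ge0// ler_weXn2l// ler1n.
  rewrite indicE (negbTE hb) mulr0 addr0 lerXn2r ?nnegrE//.
  apply: (le_trans (fdiff_pi a mu s h)).
  have dev : max_deviation m z (hermitize h) <= Y * psi.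
    by rewrite leNgt; apply/negP => lt; move/negP: hb; apply; rewrite inE.
  apply: (monomial_controlled (X := X) hh dev cX).
  - by move=> i; rewrite inE.
  - by move=> j; rewrite inE.
  - exact: us.
  - by move=> x xs; rewrite !inE xs.
  - exact: finset.sub0set.
have B0 : 0 <= (C + 1) * Y ^+ (D + n) * psi ^+ D * psi ^+ size s.
  by rewrite !mulr_ge0 ?exprn_ge0 ?(ltW psi_gt0) ?(ltW Y_gt0)//; lra.
have mD : moment_le nu p Df ((C + 1) * Y ^+ (D + n) * psi ^+ D * psi ^+ size s).
  rewrite /moment_le; have bi := bounded_rv_indic R measurable_bad.
  apply: (le_trans (ler_expect nu (bounded_rvX p (bounded_rv_norm bD))
    (bounded_rvD (bounded_rv_cst (good_bd ^+ p)) (bounded_rvZ (bad_bd ^+ p) bi)) ptw)).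
  rewrite expectD ?expect_cst ?expectZ ?expect_indic//; last 2 first.
  - exact: bounded_rv_cst.
  - exact: bounded_rvZ.
  pose b2 := psi ^+ (D + n); have b20 : 0 <= b2 by rewrite exprn_ge0 ?(ltW psi_gt0).
  apply: (@le_trans _ _ (good_bd ^+ p + b2 ^+ p)); first by rewrite lerD2l.
  apply: (@le_trans _ _ ((good_bd + b2) ^+ p)).
    case: (p) p_gt0 => // q _; rewrite !exprS mulrDl lerD// ler_wpM2l//.
      by rewrite lerXn2r ?nnegrE ?addr_ge0// lerDl.
    by rewrite lerXn2r ?nnegrE ?addr_ge0// lerDr.
  rewrite lerXn2r ?nnegrE ?addr_ge0//.
  have Yn : 1 <= Y ^+ (D + n) by exact: exprn_ege1.
  have e1 : good_bd <= C * Y ^+ (D + n) * (psi ^+ D * psi ^+ size s).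
    rewrite /good_bd exprMn -exprD mulrA ler_wpM2r ?exprn_ge0 ?(ltW psi_gt0)//.
    by rewrite ler_wpM2l// ler_weXn2l// leq_add2l.
  have e2 : b2 <= Y ^+ (D + n) * (psi ^+ D * psi ^+ size s).
    rewrite -[leLHS]mul1r ler_pM// /b2 exprD ler_wpM2l ?exprn_ge0 ?(ltW psi_gt0)//.
    by rewrite ler_wiXn2l ?(ltW psi_gt0).
  apply: (le_trans (lerD e1 e2)); rewrite le_eqVlt; apply/orP; left; apply/eqP.
  by ring.
have := moment_le_row_flucts HR p_gt0 s B0 bD mD.
apply: moment_le_trans; first by rewrite mulr_ge0 ?exprn_ge0.
by rewrite /A1 -[leRHS]mulrA ler_wpM2r// ler_weXn2l// ler1n.
Qed.

Let rows a : seq 'I_N := [seq a i | i <- enum F].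

Let f mu a := row_flucts nu (@replace_rows R N) (rows a) (Z a mu finset.set0).

Definition valid_assignment mu a :=
  injectiveb a && [forall i, forall j, a i != mu j].

Let bounded_f mu a : bounded_rv (f mu a).
Proof. exact: bounded_rv_row_flucts. Qed.

Let A2 := 4 ^+ n * (4 ^+ #|F| * A1).

Let A2_gt0 : 0 < A2.
Proof. by rewrite mulr_gt0 ?exprn_gt0// mulr_gt0 ?exprn_gt0. Qed.

(** A lone value occurs among the indices of its owner only, so it is not [near]
    for any other factor. *)
Lemma expect_prod_fluctuations mu (t : p.-tuple {ffun gsum Delta -> 'I_N}) :
  (forall k, valid_assignment mu (tnth t k)) ->
  `|expect nu (fun h => \prod_k f mu (tnth t k) h)| <=
  p%:R * 2 ^+ (p * n) * A2 ^+ p * psi ^+ #|lone_values t F|.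
Proof.
move=> vt; pose L := enum (lone_values t F).
have sL : (size L <= n)%N by rewrite -cardE; exact: card_lone_values.
pose near (k : 'I_p) : pred 'I_N := fun v => [exists i, tnth t k i == v].
have := @expect_prod_fluct _ _ _ _ _ _ HR p psi p_gt0 psi_gt0 psi_le1 L
  (fun k => f mu (tnth t k)) (fun=> A2) near (fun=> A2_gt0)
  (fun k => bounded_f mu (tnth t k)).
rewrite prodr_const card_ord -cardE => H; apply: le_trans (H _ _) _.
- move=> v; rewrite mem_enum => /lone_valuesP [k0 [i0 [iF tv other]]].
  exists k0.
    apply: (row_average_row_flucts HR); first exact: bounded_Z.
    by rewrite -tv; apply/mapP; exists i0; rewrite ?mem_enum.
  move=> k kk0; apply/existsPn => j; exact: other.
- move=> k; have := @fluct_bounded_moments _ _ _ _ _ _ HR p psi p_gt0 psi_gt0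
    (near k) L (f mu (tnth t k)) (4 ^+ #|F| * A1).
  have A10 : 0 <= 4 ^+ #|F| * A1 by rewrite mulr_ge0 ?exprn_ge0// ltW.
  move=> /(_ A10 (bounded_f _ _) (enum_uniq _)) h.
  apply: (@fluct_bounded_weaken _ _ _ _ _ _ _ _ psi_gt0 _ _ _ (4 ^+ size L * (4 ^+ #|F| * A1))).
  - by rewrite mulr_ge0 ?exprn_ge0.
  - by rewrite ler_wpM2r// ler_weXn2l// ler1n.
  - apply: h => s us ss sn; rewrite /f (row_fluctsC HR)//.
    have ssz : (size s <= n)%N.
      by apply: leq_trans sL; exact: uniq_leq_size.
    have cR : size (rows (tnth t k)) = #|F| by rewrite size_map cardE.
    rewrite -mulrA -{1}cR; apply: (moment_le_row_flucts HR) => //.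
    + by rewrite mulr_ge0 ?exprn_ge0 ?(ltW psi_gt0) ?(ltW A1_gt0).
    + exact: bounded_rv_row_flucts.
    + apply: moment_row_flucts => //.
        by move=> i; apply/negP => /sn /existsPn /(_ i); rewrite eqxx.
      move=> j; apply/negP => /ss; rewrite mem_enum => /lone_valuesP [k0 [i0 [_ tv _]]].
      have /andP[_ /forallP /(_ i0) /forallP /(_ j)] := vt k0.
      by rewrite tv eqxx.
- rewrite ler_wpM2r ?exprn_ge0 ?(ltW psi_gt0)// ler_wpM2r ?exprn_ge0 ?(ltW A2_gt0)//.
  by rewrite ler_wpM2l// ler_weXn2l ?ler1n// leq_mul2l card_lone_values orbT.
Qed.

Variables (M : R) (w : {ffun gsum Delta -> 'I_N} -> R) (y0 : 'I_N).
Hypotheses (M_gt0 : 0 < M) (M_psi : 1 <= M * psi ^+ 2) (w_ge0 : forall a, 0 <= w a).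
Hypothesis w_fix : forall (I : {set gsum Delta}) (b : {ffun gsum Delta -> 'I_N}),
  \sum_(a : {ffun gsum Delta -> 'I_N} |
     injectiveb a && [forall i in I, a i == b i]) w a <= M ^- #|I|.

(** The real or the imaginary part of the average, as a function of the sample. *)
Definition fluct_average mu (h : sample_space R N) : R :=
  \sum_(a | valid_assignment mu a) w a * f mu a h.

Lemma bounded_rv_fluct_average mu : bounded_rv (fluct_average mu).
Proof. by apply: bounded_rv_sum => a _; exact: bounded_rvZ. Qed.

(** Each lone index contributes [psi] and each repeated one the factor
    [M^-1 <= psi ^+ 2] that the adapted weight loses when it is prescribed. *)
Lemma expect_fluct_average mu :
  expect nu (fun h => fluct_average mu h ^+ p) <=
  p%:R * 2 ^+ (p * n) * A2 ^+ p * psi ^+ n *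
  (2 ^+ #|gsum Delta| * (1 + (p * #|gsum Delta|)%:R) ^+ #|gsum Delta|) ^+ p.
Proof.
set B := p%:R * 2 ^+ (p * n) * A2 ^+ p.
have B0 : 0 <= B by rewrite !mulr_ge0 ?exprn_ge0 ?(ltW A2_gt0).
pose X a h := if valid_assignment mu a then w a * f mu a h else 0.
have bX a : bounded_rv (X a).
  rewrite /X; case: (valid_assignment mu a); last exact: bounded_rv_cst.
  exact: bounded_rvZ.
have bP (t : p.-tuple {ffun gsum Delta -> 'I_N}) :
    bounded_rv (fun h => \prod_k X (tnth t k) h) by exact: bounded_rv_prod.
have -> : (fun h => fluct_average mu h ^+ p) = fun h =>
    \sum_(t : p.-tuple {ffun gsum Delta -> 'I_N}) \prod_k X (tnth t k) h.
  apply/funext => h; rewrite -(expr_sum_tuple (fun a => X a h)); congr (_ ^+ p).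
  by rewrite /fluct_average big_mkcond.
rewrite expect_sum//.
have := @sum_seq_weight _ _ _ M w M_gt0 w_ge0 w_fix y0 p p [::] (leqnn _).
have Bp : 0 <= B * psi ^+ n by rewrite mulr_ge0 ?exprn_ge0 ?(ltW psi_gt0).
move=> /(ler_wpM2l Bp); apply: le_trans; rewrite mulr_sumr.
apply: ler_sum => t _.
have sw0 s (r : seq {ffun gsum Delta -> 'I_N}) : 0 <= seq_weight M w s r.
  elim: r s => [|a r IH] s /=; first exact: ler01.
  by rewrite mulr_ge0//; case: ifP => // _; rewrite mulr_ge0// exprn_ge0 ?(ltW M_gt0).
have [/forallP vt|/forallPn [k0 nv]] :=
    boolP [forall k, valid_assignment mu (tnth t k)]; last first.
  rewrite [X in expect _ X](_ : _ = fun=> 0); last first.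
    by apply/funext => h; rewrite (bigD1 k0) //= /X (negbTE nv) mul0r.
  by rewrite expect_cst mulr_ge0.
have it : all (fun a => injectiveb a) t.
  by apply/allP => a /tnthP [k ->]; have /andP[] := vt k.
have bf : bounded_rv (fun h => \prod_k f mu (tnth t k) h) by exact: bounded_rv_prod.
have -> : (fun h : sample_space R N => \prod_k X (tnth t k) h) = fun h =>
    (\prod_k w (tnth t k)) * \prod_k f mu (tnth t k) h.
  by apply/funext => h; rewrite -big_split; apply: eq_bigr => k _; rewrite /X vt.
rewrite expectZ//; have W0 : 0 <= \prod_k w (tnth t k) by exact: prodr_ge0.
apply: (le_trans (ler_wpM2l W0 (le_trans (ler_norm _) (expect_prod_fluctuations vt)))).
have -> : seq_weight M w [::] t = (\prod_k w (tnth t k)) *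
    M ^+ (\sum_(k < p) #|hits (values (take k t)) (tnth t k)|).
  rewrite (seq_weightE M w [::] it) -prodrXr -big_split /=.
  pose a0 := tnth t (Ordinal p_gt0).
  pose G k := w (nth a0 t k) * M ^+ #|hits (values (take k t)) (nth a0 t k)|.
  transitivity (\prod_(0 <= k < p) G k).
    rewrite -[p in RHS](size_tuple t) big_mkord; apply: eq_bigr => k _.
    by rewrite (tnth_nth a0).
  by rewrite big_mkord; apply: eq_bigr => k _; rewrite (tnth_nth a0).
set E := (\sum_(k < p) _)%N.
have psiE : psi ^+ #|lone_values t F| <= psi ^+ n * M ^+ E.
  apply: (@le_trans _ _ (psi ^+ #|lone_values t F| * (M * psi ^+ 2) ^+ E)).
    by rewrite ler_peMr ?exprn_ge0 ?exprn_ege1 ?(ltW psi_gt0).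
  rewrite exprMn -exprM [X in _ * X]mulrC mulrA -exprD.
  rewrite ler_wpM2r ?exprn_ge0 ?(ltW M_gt0)// ler_wiXn2l ?(ltW psi_gt0)//.
  apply: lone_count => k; apply/injectiveP.
  by have /andP[] := vt k.
have h := ler_wpM2l (mulr_ge0 B0 W0) psiE.
by rewrite -/B mulrA [X in X * _]mulrC; apply: (le_trans h); rewrite mulrACA.
Qed.

End AverageMoments.

(** * From moments to stochastic domination *)

Lemma le_measure_ae (R : realType) d (T : measurableType d) (P : probability T R)
    (A B : set T) : measurable A -> measurable B ->
  {ae P, forall t, A t -> B t} -> (P A <= P B)%E.
Proof.
move=> mA mB [N0 [mN0 N00 sub]].
apply: (@le_trans _ _ (P (B `|` N0))).
  apply: le_measure; rewrite ?inE//; first exact: measurableU.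
  move=> t At; have [Bt|nB] := pselect (B t); first by left.
  by right; apply: sub => /= /(_ At).
have h : (P (B `|` N0) <= P B + P N0)%E by exact: measureU2.
have N0P : P N0 = 0%E by exact: N00.
by move: h; rewrite N0P adde0.
Qed.

Lemma markov_bounded_rv (R : realType) d (T : measurableType d)
    (P : probability T R) (f : T -> R) (r : R) : bounded_rv f ->
  (forall x, 0 <= f x) -> 0 < r ->
  (P [set x | (r < f x)%R] <= (expect P f / r)%:E)%E.
Proof.
move=> bf f0 r0; have mB : measurable [set x | r < f x].
  by apply: measurable_lt; case: bf.
have bi := bounded_rv_indic R mB.
have := ler_expect P (bounded_rvZ r bi) bf.
rewrite expectZ// expect_indic// => h.
rewrite -[X in (X <= _)%E]fineK; last exact: fin_num_measure.
rewrite lee_fin ler_pdivlMr// mulrC; apply: h => x.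
rewrite indicE; have [|_] := boolP (x \in _); last by rewrite mulr0.
by rewrite inE /= mulr1 => /ltW.
Qed.

Section Tail.
Context {R : realType} {d : measure_display} {T : measurableType d}.
Variables (P : probability T R) (N : nat) (H : T -> 'M[R[i]]_N).
Hypothesis HH : random_hermitian P H.
Variables (Delta : admissible_graph) (F : {set gsum Delta}) (z : R[i]).
Hypothesis z0 : 0 < complex.Im z.
Variables (w : {ffun gsum Delta -> 'I_N} -> R) (mu : {ffun gext Delta -> 'I_N}).

Let X pi := fluct_average (sample_law HH) F (msc z) z pi w mu.

Let monomial_ae (a : {ffun gsum Delta -> 'I_N}) :
  let Y := foldr (fun i X => partial_fluct P H (a i) X)
    (monomial (Delta := Delta) H z a mu) (enum F) in
  let Q pi := row_flucts (sample_law HH) (@replace_rows R N)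
    [seq a i | i <- enum F] (fun h : sample_space R N =>
       pi (mx_monomial (Delta := Delta) (msc z) z a mu
             (zero_rows finset.set0 (hermitize h)))) in
  [/\ cmeasurable Y, {ae P, forall t, complex.Re (Y t) = Q (@complex.Re R) (H t)} &
      {ae P, forall t, complex.Im (Y t) = Q (@complex.Im R) (H t)}].
Proof.
have e t : monomial (Delta := Delta) H z a mu t =
    mx_monomial (msc z) z a mu (zero_rows finset.set0 (hermitize (H t))).
  by rewrite monomialE zero_rows0 (hermitize_sample HH).
have br := @bounded_rv_mx_monomial R N Delta (msc z) z z0 (@complex.Re R) a mu
  finset.set0 (or_introl erefl).
have bi := @bounded_rv_mx_monomial R N Delta (msc z) z z0 (@complex.Im R) a mu
  finset.set0 (or_intror erefl).
apply: foldr_partial_fluct => //.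
- have ms := measurable_sample HH; have [mr _] := br; have [mi _] := bi.
  split; under eq_fun do rewrite e.
    exact: (measurableT_comp mr ms).
  exact: (measurableT_comp mi ms).
- by apply: aeW => t; rewrite e.
- by apply: aeW => t; rewrite e.
Qed.

Let average_ae :
  [/\ cmeasurable (average P H F z w mu),
      {ae P, forall t, complex.Re (average P H F z w mu t) = X (@complex.Re R) (H t)} &
      {ae P, forall t, complex.Im (average P H F z w mu t) = X (@complex.Im R) (H t)}].
Proof.
have mono a := monomial_ae a.
split.
- rewrite /average; apply: cmeasurable_sum => a; have [mY _ _] := mono a.
  by apply: cmeasurableM => //; exact: cmeasurable_cst.
- have : {ae P, forall t (a : {ffun gsum Delta -> 'I_N}), complex.Re
      (foldr (fun i X => partial_fluct P H (a i) X)
      (monomial (Delta := Delta) H z a mu) (enum F) t) =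
      row_flucts (sample_law HH) (@replace_rows R N)
    [seq a i | i <- enum F] (fun h : sample_space R N =>
       complex.Re (mx_monomial (Delta := Delta) (msc z) z a mu
             (zero_rows finset.set0 (hermitize h)))) (H t)}.
    by apply: filter_forall => a; have [_ h _] := mono a.
  apply: filterS => t h; rewrite /average raddf_sum; apply: eq_bigr => a _.
  by rewrite -h; case: (foldr _ _ _ t) => x y /=; rewrite mul0r subr0.
- have : {ae P, forall t (a : {ffun gsum Delta -> 'I_N}), complex.Im
      (foldr (fun i X => partial_fluct P H (a i) X)
      (monomial (Delta := Delta) H z a mu) (enum F) t) =
      row_flucts (sample_law HH) (@replace_rows R N)
    [seq a i | i <- enum F] (fun h : sample_space R N =>
       complex.Im (mx_monomial (Delta := Delta) (msc z) z a mu
             (zero_rows finset.set0 (hermitize h)))) (H t)}.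
    by apply: filter_forall => a; have [_ _ h] := mono a.
  apply: filterS => t h; rewrite /average raddf_sum; apply: eq_bigr => a _.
  by rewrite -h; case: (foldr _ _ _ t) => x y /=; rewrite mul0r addr0.
Qed.

(** Markov's inequality for the sum of the powers of the real and of the imaginary
    part, one of which exceeds [r / 2] when the modulus exceeds [r]. *)
Lemma average_tail (q : nat) (r B : R) : (0 < q)%N -> 0 < r ->
  (forall pi, pi = @complex.Re R \/ pi = @complex.Im R ->
    expect (sample_law HH) (fun h => X pi h ^+ (2 * q)) <= B) ->
  (P [set t | (cmod (average P H F z w mu t) > r)%R] <=
     ((2 * B) / (r / 2) ^+ (2 * q))%:E)%E.
Proof.
move=> q0 r0 EB; have [mA eR eI] := average_ae.
have bX pi : pi = @complex.Re R \/ pi = @complex.Im R -> bounded_rv (X pi).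
  move=> pP; apply: bounded_rv_fluct_average => //.
  exact: sample_law_resampling.
have bR := bX _ (or_introl erefl); have bI := bX _ (or_intror erefl).
pose W h := X (@complex.Re R) h ^+ (2 * q) + X (@complex.Im R) h ^+ (2 * q).
have bW : bounded_rv W by apply: bounded_rvD; exact: bounded_rvX.
have e2 (x : R) : x ^+ (2 * q) = `|x| ^+ (2 * q).
  by rewrite !exprM real_normK ?num_real.
have W0 h : 0 <= W h by rewrite /W e2 [X in _ + X]e2 addr_ge0 ?exprn_ge0.
have s0 : 0 < (r / 2) ^+ (2 * q) by rewrite exprn_gt0 ?divr_gt0.
apply: (@le_trans _ _ (sample_law HH [set h | ((r / 2) ^+ (2 * q) < W h)%R])).
  rewrite -[X in (_ <= X)%E]/(P [set t | ((r / 2) ^+ (2 * q) < W (H t))%R]).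
  apply: le_measure_ae.
  - by apply: measurable_lt; exact: measurable_cmod.
  - have ms := measurable_sample HH; apply: (measurable_lt (f := fun t => W (H t))).
    by case: bW => mW _; exact: (measurableT_comp mW ms).
  apply: filterS2 eR eI => t hR hI /= lt; rewrite /W -hR -hI.
  have := lt_le_trans lt (cmod_le_ReIm _).
  rewrite (e2 (complex.Re _)) (e2 (complex.Im _)).
  set x := `|complex.Re _|; set y := `|complex.Im _| => lt2.
  have x0 : 0 <= x by exact: normr_ge0.
  have y0 : 0 <= y by exact: normr_ge0.
  have [xr|xr] := ltP (r / 2) x.
    rewrite ltr_wpDr ?exprn_ge0// ltrXn2r ?nnegrE// ?divr_ge0// ?(ltW r0)//.
    by rewrite muln_eq0 /= -lt0n.
  rewrite ltr_wpDl ?exprn_ge0// ltrXn2r ?nnegrE// ?divr_ge0// ?(ltW r0)//.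
    by rewrite muln_eq0 /= -lt0n.
  by lra.
apply: (le_trans (markov_bounded_rv _ bW W0 s0)); rewrite lee_fin.
rewrite ler_pM2r ?invr_gt0// /W expectD; [|exact: bounded_rvX..].
rewrite mulr2n mulrDl mul1r; apply: lerD; apply: EB; first by left.
by right.
Qed.

End Tail.

(** * The sizes of the parameters as powers of [N] *)

Lemma powR_unbounded (R : realType) (a B : R) : 0 < a ->
  exists N0 : nat, forall N, (N0 <= N)%N -> B <= N%:R `^ a.
Proof.
move=> a0; pose b := (Num.max B 1) `^ a^-1.
exists (Num.truncn b).+1 => N HN.
have bN : b <= N%:R.
  by rewrite ltW// (lt_le_trans (truncnS_gt b))// ler_nat.
have B1 : 0 <= Num.max B 1 by rewrite le_max ler01 orbT.
apply: (@le_trans _ _ (b `^ a)).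
  by rewrite /b -powRrM mulVf ?gt_eqF// powRr1// le_max lexx.
by rewrite ge0_ler_powR ?nnegrE ?powR_ge0 ?(ltW a0).
Qed.

Section ControlParameter.
Variables (R : realType) (N : nat) (M delta gamma c psi eta : R).
Hypotheses (N_gt0 : (0 < N)%N) (delta_gt0 : 0 < delta) (gamma_gt0 : 0 < gamma).
Hypotheses (c_gt0 : 0 < c).
Hypotheses (MN : N%:R `^ delta <= M <= N%:R).
Hypotheses (psiM : M `^ (- 2^-1) <= psi <= M `^ (- c)).
Hypothesis eta_ge : M `^ (-1 + gamma) <= eta.

Let N1 : (1 : R) <= N%:R. Proof. by rewrite ler1n. Qed.

Lemma bandwidth_ge1 : 1 <= M.
Proof.
have /andP[NM _] := MN; apply: le_trans NM.
by rewrite -[leLHS](powRr0 N%:R) ler_powR// ltW.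
Qed.

Let M0 : 0 < M. Proof. exact: lt_le_trans ltr01 bandwidth_ge1. Qed.

Lemma inv_le_eta : N%:R^-1 <= eta.
Proof.
apply: le_trans eta_ge; have /andP[_ M_le] := MN.
apply: (@le_trans _ _ (M^-1)).
  by rewrite lef_pV2 ?posrE// (lt_le_trans ltr01).
rewrite -powR_inv1 ?(ltW M0)//; apply: ler_powR; first exact: bandwidth_ge1.
by have g0 := gamma_gt0; lra.
Qed.

Lemma psi_gt0 : 0 < psi.
Proof. by have /andP[h _] := psiM; apply: lt_le_trans h; exact: powR_gt0. Qed.

Lemma psi_le1 : psi <= 1.
Proof.
have /andP[_ h] := psiM; apply: (le_trans h).
rewrite -[leRHS](powRr0 M); apply: ler_powR; first exact: bandwidth_ge1.
by rewrite oppr_le0 ltW.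
Qed.

Lemma bandwidth_psi : 1 <= M * psi ^+ 2.
Proof.
have /andP[h _] := psiM.
have h2 : (M `^ (- 2^-1)) ^+ 2 <= psi ^+ 2.
  by rewrite lerXn2r ?nnegrE ?powR_ge0// ltW// psi_gt0.
apply: (@le_trans _ _ (M * (M `^ (- 2^-1)) ^+ 2)); last by rewrite ler_pM2l.
rewrite -powR_mulrn ?powR_ge0// -powRrM mulNr mulVf ?pnatr_eq0//.
by rewrite powR_inv1 ?(ltW M0)// divff// gt_eqF.
Qed.

Lemma inv_le_psi : N%:R^-1 <= psi.
Proof.
have /andP[h _] := psiM; apply: le_trans h.
have /andP[_ M_le] := MN.
apply: (@le_trans _ _ (M^-1)).
  by rewrite lef_pV2 ?posrE// (lt_le_trans ltr01).
rewrite -powR_inv1 ?(ltW M0)//; apply: ler_powR; first exact: bandwidth_ge1.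
by lra.
Qed.

Lemma psi_decay e : e <= c * delta / 2 ->
  N%:R `^ e * psi <= (N%:R `^ (c * delta / 2))^-1.
Proof.
move=> ec; have N0 : (0 : R) < N%:R by rewrite ltr0n.
have h : psi <= N%:R `^ (- (c * delta)).
  have /andP[_ h] := psiM; apply: (le_trans h).
  rewrite !powRN lef_pV2 ?posrE ?powR_gt0//.
  have /andP[NM _] := MN; rewrite mulrC powRrM.
  by rewrite ge0_ler_powR ?nnegrE ?powR_ge0 ?(ltW c_gt0) ?(ltW M0).
apply: (@le_trans _ _ (N%:R `^ (c * delta / 2) * N%:R `^ (- (c * delta)))).
  by apply: ler_pM => //; rewrite ?powR_ge0 ?(ltW psi_gt0)// ler_powR.
rewrite -powRN -powRD; last by rewrite (gt_eqF N0) implybT.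
by rewrite le_eqVlt; apply/orP; left; apply/eqP; congr (_ `^ _); lra.
Qed.

End ControlParameter.

(** * Averages for a fixed dimension, and the theorem *)

Section FixedSize.
Context {R : realType} {d : measure_display} {T : measurableType d}.
Variables (P : probability T R) (N : nat) (H : T -> 'M[R[i]]_N).
Variables (delta gamma c psi C th0 e1 : R) (Delta : admissible_graph).
Variables (F : {set gsum Delta}) (p : nat) (z : R[i]).
Local Notation n := (p * #|F|)%N.
Local Notation D := (deg Delta).
Local Notation M := (bandwidth P H).
(* Large enough for the bad event to outweigh the trivial bound
   [2 ^+ n * (3 * N) ^+ D] of the monomials, raised to the power [p], and to
   leave at most [psi ^+ ((D + n) * p)]. *)
Local Notation prob_exponent := ((1 + 2 * D + n) * p)%N.
Hypothesis HH : random_hermitian P H.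
Hypotheses (N_gt1 : (1 < N)%N) (p_gt0 : (0 < p)%N).
Hypotheses (delta_gt0 : 0 < delta) (gamma_gt0 : 0 < gamma) (c_gt0 : 0 < c).
Hypothesis MN : N%:R `^ delta <= M <= N%:R.
Hypothesis psiM : M `^ (- 2^-1) <= psi <= M `^ (- c).
Hypothesis zS : spectral_domain gamma M z.
Hypotheses (C_ge0 : 0 <= C) (th0_gt0 : 0 < th0) (th0_le1 : th0 <= 1).
Hypothesis monomial_controlled :
  forall (h : 'M[R[i]]_N) (a : {ffun gsum Delta -> 'I_N})
    (mu : {ffun gext Delta -> 'I_N}) (X : {set 'I_N}) (theta : R),
  0 <= theta <= th0 -> is_hermitian h -> 0 < complex.Im z ->
  max_deviation (msc z) z h <= theta -> (#|X| <= n)%N ->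
  (forall i, a i \notin X) -> (forall j, mu j \notin X) ->
  controlled theta X D C
    (fun V : {set 'I_N} => mx_monomial (msc z) z a mu (zero_rows V h)).
Hypotheses (e1_gt0 : 0 < e1) (e1_le : e1 <= c * delta / 2).
Hypothesis e1_small : e1 * ((D + n) * p)%:R <= 1.
Hypothesis Lambda_tail :
  (P [set t | (cmod ((Lambda H z t)%:C) > N%:R `^ e1 * psi)%R] <=
   (N%:R `^ (- prob_exponent%:R))%:E)%E.
Hypothesis N_th0 : th0^-1 <= N%:R `^ (c * delta / 2).
Hypothesis N_const : 2 ^+ n * 3 ^+ D <= N%:R :> R.

Let exponentE : prob_exponent = ((1 + D) * p + (D + n) * p)%N.
Proof. by rewrite mul2n -addnn -mulnDl !addnA. Qed.

Let Y := N%:R `^ e1.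
Let N1 : (1 : R) <= N%:R. Proof. by rewrite ler1n ltnW. Qed.
Let N0 : (0 : R) < N%:R. Proof. exact: lt_le_trans ltr01 N1. Qed.
Let N_gt0 : (0 < N)%N. Proof. exact: ltnW. Qed.

Let Im_gt0 : 0 < complex.Im z.
Proof.
have [_ /andP[h _]] := zS; apply: lt_le_trans (inv_le_eta N_gt0 delta_gt0 gamma_gt0 MN h).
by rewrite invr_gt0.
Qed.

Let Im_inv : (complex.Im z)^-1 <= N%:R.
Proof.
have [_ /andP[h _]] := zS; have h2 := inv_le_eta N_gt0 delta_gt0 gamma_gt0 MN h.
by rewrite -[leRHS]invrK lef_pV2 ?posrE ?invr_gt0.
Qed.

Let Ypsi : Y * psi <= th0.
Proof.
apply: (le_trans (psi_decay N_gt0 delta_gt0 c_gt0 MN psiM e1_le)).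
by rewrite -[leRHS]invrK lef_pV2 ?posrE ?invr_gt0 ?powR_gt0.
Qed.

Let psi0 : 0 < psi. Proof. exact: (psi_gt0 N_gt0 delta_gt0 MN psiM). Qed.

Let LambdaE t : Lambda H z t = max_deviation (msc z) z (hermitize (H t)).
Proof. by rewrite (hermitize_sample HH). Qed.

Let bad : set (sample_space R N) :=
  [set h | Y * psi < max_deviation (msc z) z (hermitize h)].

Let bad_prob : (sample_law HH bad <= (N%:R ^- prob_exponent)%:E)%E.
Proof.
rewrite -powR_invn ?(ltW N0)//; apply: le_trans Lambda_tail.
rewrite -[X in (X <= _)%E]/(P [set t | (Y * psi < max_deviation (msc z) z (hermitize (H t)))%R]).
rewrite le_eqVlt; apply/orP; left; apply/eqP; congr (P _).
apply/seteqP; split => t /=; rewrite -LambdaE /Normc.normc /= expr0n /= addr0 sqrtr_sqr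
  ger0_norm// LambdaE; apply: le_trans (le_max_deviation _ _ _ (Ordinal N_gt0) (Ordinal N_gt0));
  exact: cmod_ge0.
Qed.

(** The event on which the resolvent is close to its limit is not empty, which
    bounds [msc z] by an entry of a resolvent. *)
Let cmod_msc : cmod (msc z) <= N%:R + 1.
Proof.
have [h hb] : exists h : sample_space R N, ~ bad h.
  apply: contrapT => none; have badT : bad = setT.
    by apply/seteqP; split => // h _; apply: contrapT => nb; apply: none; exists h.
  have := bad_prob; rewrite badT => b1.
  have : (1 <= (N%:R ^- prob_exponent)%:E :> \bar R)%E.
    by apply: le_trans b1; rewrite probability_setT.
  rewrite lee_fin leNgt => /negP; apply; rewrite invf_lt1 ?exprn_gt0//.
  by rewrite exprn_egt1 ?ltr1n// -lt0n muln_gt0 p_gt0 andbT.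
pose x : 'I_N := Ordinal N_gt0; pose G := resolvent z (hermitize h) x x.
have hh := hermitize_hermitian h.
have dev : cmod (G - msc z) <= 1.
  have := le_max_deviation (msc z) z (hermitize h) x x; rewrite eqxx mul1r.
  move/le_trans; apply; apply: le_trans th0_le1; apply: le_trans Ypsi.
  by rewrite leNgt; apply/negP.
have -> : msc z = G - (G - msc z) by ring.
apply: (le_trans (cmodB _ _)); rewrite lerD//.
exact: le_trans (cmod_resolvent _ _ hh Im_gt0) Im_inv.
Qed.

Definition moment_constant : R :=
  p%:R * 2 ^+ (p * n) *
  (4 ^+ n * (4 ^+ #|F| * (4 ^+ n * (C + 1)))) ^+ p *
  (2 ^+ #|gsum Delta| * (1 + (p * #|gsum Delta|)%:R) ^+ #|gsum Delta|) ^+ p.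

(** The factor [N] absorbs the slack [N ^ e1] with which the deviation is bounded
    by [psi]. *)
Lemma expect_fluct_average_le (w : {ffun gsum Delta -> 'I_N} -> R) pi mu :
  adapted_weight M w -> pi = @complex.Re R \/ pi = @complex.Im R ->
  expect (sample_law HH) (fun h =>
    fluct_average (sample_law HH) F (msc z) z pi w mu h ^+ p) <=
  moment_constant * N%:R * (psi ^+ (D + #|F|)) ^+ p.
Proof.
move=> wa piP; have HR := sample_law_resampling HH.
have M0 : 0 < M by exact: lt_le_trans ltr01 (bandwidth_ge1 N_gt0 delta_gt0 MN).
have psi1 : psi <= 1 by exact: (psi_le1 N_gt0 delta_gt0 c_gt0 MN psiM).
have Y1 : 1 <= Y by rewrite -[leLHS](powRr0 N%:R) ler_powR// ltW.
have entry : (complex.Im z)^-1 + cmod (msc z) <= 3 * N%:R.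
  by have := cmod_msc; have := Im_inv; have := N1; lra.
have ctl (h : 'M[R[i]]_N) (a : {ffun gsum Delta -> 'I_N})
    (mu' : {ffun gext Delta -> 'I_N}) (X : {set 'I_N}) :
    is_hermitian h -> max_deviation (msc z) z h <= Y * psi -> (#|X| <= n)%N ->
    (forall i, a i \notin X) -> (forall j, mu' j \notin X) ->
    controlled (Y * psi) X D C
      (fun V : {set 'I_N} => mx_monomial (msc z) z a mu' (zero_rows V h)).
  move=> hh dev Xn aX muX; apply: monomial_controlled => //.
  by rewrite Ypsi mulr_ge0 ?powR_ge0 ?(ltW psi0).
have small : (2 ^+ n * (3 * N%:R) ^+ D) ^+ p * fine (sample_law HH bad) <=
    (psi ^+ (D + n)) ^+ p.
  have bp : fine (sample_law HH bad) <= N%:R ^- prob_exponent.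
    by rewrite -lee_fin fineK ?bad_prob// fin_num_measure//;
      apply: measurable_lt; exact: measurable_max_deviation.
  have k1 : (2 ^+ n * (3 * N%:R) ^+ D) ^+ p <= N%:R ^+ ((1 + D) * p) :> R.
    rewrite (exprM _ (1 + D)%N p) lerXn2r ?nnegrE ?mulr_ge0 ?exprn_ge0 ?mulr_ge0 ?(ltW N0)//.
    by rewrite exprMn mulrA add1n exprS ler_wpM2r// exprn_ge0 ?(ltW N0).
  have k2 : N%:R ^- ((D + n) * p) <= (psi ^+ (D + n)) ^+ p.
    rewrite -exprM -exprVn lerXn2r ?nnegrE ?invr_ge0 ?(ltW N0) ?(ltW psi0)//.
    exact: (inv_le_psi N_gt0 delta_gt0 MN psiM).
  apply: le_trans k2; apply: (@le_trans _ _ (N%:R ^+ ((1 + D) * p) * N%:R ^- prob_exponent)).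
    by apply: ler_pM => //; rewrite fine_ge0.
  rewrite exponentE.
  by rewrite exprD invfM mulVKf// gt_eqF// exprn_gt0.
have y0 : 'I_N := Ordinal N_gt0.
have w0 a : 0 <= w a by case: wa => w01 _; have /andP[] := w01 a.
have := @expect_fluct_average R N (sample_law HH) HR Delta F (msc z) z p C (3 * N%:R)
  psi Y Im_gt0 p_gt0 C_ge0 psi0 psi1 Y1 entry ctl small pi piP M w y0 M0
  (bandwidth_psi N_gt0 delta_gt0 MN psiM) w0 (adapted_weight_fix wa) mu.
move=> /le_trans; apply.
set W := (2 ^+ #|gsum Delta| * _) ^+ p.
have YN : Y ^+ ((D + n) * p) <= N%:R.
  rewrite /Y -powR_mulrn ?powR_ge0// -powRrM -[leRHS]powRr1 ?(ltW N0)//.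
  by rewrite ler_powR.
have eY : (4 ^+ n * (4 ^+ #|F| * (4 ^+ n * ((C + 1) * Y ^+ (D + n) * psi ^+ D)))) ^+ p =
    (4 ^+ n * (4 ^+ #|F| * (4 ^+ n * (C + 1)))) ^+ p *
    (Y ^+ ((D + n) * p) * psi ^+ (D * p)).
  by rewrite [Y ^+ (_ * p)]exprM [psi ^+ (_ * p)]exprM -!exprMn !mulrA.
have epsi : (psi ^+ (D + #|F|)) ^+ p = psi ^+ (D * p) * psi ^+ n.
  by rewrite -exprM mulnDl exprD [(#|F| * p)%N]mulnC.
rewrite eY epsi /moment_constant -/W.
set c1 := p%:R * _; set c2 := (4 ^+ n * _) ^+ p.
have c10 : 0 <= c1 by rewrite mulr_ge0 ?exprn_ge0.
have C1 : 0 <= C + 1 by have := C_ge0; lra.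
have c20 : 0 <= c2 by rewrite exprn_ge0// !mulr_ge0 ?exprn_ge0.
have W0 : 0 <= W by rewrite exprn_ge0// mulr_ge0 ?exprn_ge0 ?addr_ge0.
have ps : 0 <= psi ^+ (D * p) * psi ^+ n by rewrite mulr_ge0 ?exprn_ge0 ?(ltW psi0).
rewrite (_ : c1 * _ * _ * _ = (c1 * c2 * W) * (Y ^+ ((D + n) * p) *
  (psi ^+ (D * p) * psi ^+ n))); last by ring.
by rewrite -[leRHS]mulrA ler_wpM2l ?ler_wpM2r// !mulr_ge0.
Qed.

End FixedSize.

Theorem proposition6p1 (R : realType)
    (d : nat -> measure_display) (T : forall N, measurableType (d N))
    (P : forall N, probability (T N) R) (H : forall N, T N -> 'M[R[i]]_N)
    (delta gamma : R) (kappa : nat -> R)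
    (S : nat -> set R[i]) (Psi : nat -> R[i] -> R) (Delta : admissible_graph)
    (Hrandom : forall N, (0 < N)%N -> random_hermitian (P N) (H N))
    (delta_gt0 : 0 < delta)
    (M_bounds : forall N, (0 < N)%N ->
       N%:R `^ delta <= bandwidth (P N) (H N) <= N%:R)
    (moments : forall (p N : nat) (i j : 'I_N),
       (zeta_moment (P N) (H N) p i j <= (kappa p)%:E)%E)
    (gamma_gt0 : 0 < gamma)
    (S_sub : forall N, (0 < N)%N ->
       S N `<=` spectral_domain gamma (bandwidth (P N) (H N)))
    (Psi_admissible : admissible_control (fun N => bandwidth (P N) (H N)) S Psi)
    (Lambda_Psi : stoch_dom P S (fun N z t => (Lambda (H N) z t)%:C) Psi) :
  forall F : {set gsum Delta},
    stoch_dom P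
      (fun N => [set u : R[i] * {ffun gext Delta -> 'I_N} *
                         ({ffun gsum Delta -> 'I_N} -> R) |
                  S N u.1.1 /\ adapted_weight (bandwidth (P N) (H N)) u.2])
      (fun N u t => average (P N) (H N) F u.1.1 u.2 u.1.2 t)
      (fun N u => Psi N u.1.1 ^+ (deg Delta + #|F|)).
Proof.
move=> F eps L eps0 L0.
have [_ [c c0 psiM]] := Psi_admissible.
have [cm cm0 msc_lb] := cmod_msc_lb R.
(* The bound on the moment of order [p] carries a factor [N], Markov's inequality gains
   [N ^ (eps * p)], and one more factor [N] absorbs the constants. *)
pose q := (Num.truncn ((L + 2) / eps)).+1; pose p := (2 * q)%N.
have qL : L + 2 <= eps * p%:R.
  have := ltW (truncnS_gt ((L + 2) / eps)); rewrite ler_pdivrMr// mulrC -/q.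
  by move/le_trans; apply; rewrite ler_pM2l// ler_nat leq_pmull.
pose n := (p * #|F|)%N; pose D := deg Delta.
have [C [th [C0 th_gt0 ctl]]] := mx_monomial_controlled Delta n cm0.
pose th0 := Num.min th 1.
have th00 : 0 < th0 by rewrite lt_min th_gt0 ltr01.
have th01 : th0 <= 1 by rewrite ge_min lexx orbT.
(* The first bound makes [N ^ e1 * Psi] smaller than a negative power of [N], the
   second one keeps every power of [N ^ e1] that occurs at most [N]. *)
pose e1 := Num.min (c * delta / 2) (((D + n) * p).+1%:R)^-1.
have cd0 : 0 < c * delta / 2 by rewrite divr_gt0// mulr_gt0.
have e10 : 0 < e1 by rewrite lt_min cd0 invr_gt0 ltr0n.
have e1c : e1 <= c * delta / 2 by rewrite ge_min lexx.
have e1s : e1 * ((D + n) * p)%:R <= 1.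
  have : e1 <= (((D + n) * p).+1%:R)^-1 by rewrite ge_min lexx orbT.
  move=> /(ler_wpM2r (ler0n R ((D + n) * p))) /le_trans; apply.
  by rewrite mulrC ler_pdivrMr ?ltr0n// mul1r ler_nat.
pose Q := ((1 + 2 * D + n) * p)%N.
have p0 : (0 < p)%N by rewrite muln_gt0.
have Q0 : 0 < Q%:R :> R by rewrite ltr0n /Q muln_gt0 p0 andbT.
have [Na HNa] := Lambda_Psi e1 Q%:R e10 Q0.
have [Nb HNb] := powR_unbounded th0^-1 cd0.
have [Nc HNc] := powR_unbounded (2 ^+ n * 3 ^+ D) (ltr01 : 0 < (1 : R)).
pose K := moment_constant C F p.
have [Nd HNd] := powR_unbounded (2 * K * 2 ^+ p) (ltr01 : 0 < (1 : R)).
exists (maxn (maxn 2 Na) (maxn Nb (maxn Nc Nd))) => N.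
rewrite !geq_max => /andP[/andP[N2 NNa] /andP[NNb /andP[NNc NNd]]].
move=> [[z mu] w] /= [Sz wa].
have N0 : (0 < N)%N by exact: ltnW.
have NR0 : (0 : R) < N%:R by rewrite ltr0n.
have psiz := psiM N z N0 Sz; have MN := M_bounds N N0.
have [zE zI] := S_sub N N0 z Sz.
have eta0 : 0 < complex.Im z.
  apply: lt_le_trans (inv_le_eta N0 delta_gt0 gamma_gt0 MN (proj1 (andP zI))).
  by rewrite invr_gt0.
have mz : cm <= cmod (msc z).
  by apply: msc_lb => //; rewrite eta0; case/andP: zI.
have ctl' (h : 'M[R[i]]_N) (a : {ffun gsum Delta -> 'I_N})
    (mu' : {ffun gext Delta -> 'I_N}) (X : {set 'I_N}) (theta : R) :
    0 <= theta <= th0 -> is_hermitian h -> 0 < complex.Im z ->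
    max_deviation (msc z) z h <= theta -> (#|X| <= n)%N ->
    (forall i, a i \notin X) -> (forall j, mu' j \notin X) ->
    controlled theta X D C
      (fun V : {set 'I_N} => mx_monomial (msc z) z a mu' (zero_rows V h)).
  move=> /andP[t0 tth] hh z0 dev Xn aX muX; apply: ctl => //.
  by rewrite t0 (le_trans tth)// ge_min lexx.
have HNb' := HNb N NNb.
have HNc' : 2 ^+ n * 3 ^+ D <= N%:R :> R.
  by have := HNc N NNc; rewrite powRr1// ltW.
have HNd' : 2 * K * 2 ^+ p <= N%:R.
  by have := HNd N NNd; rewrite powRr1// ltW.
have Lt := HNa N NNa z Sz.
have EB := fun pi => @expect_fluct_average_le R _ _ (P N) N (H N) delta gamma c (Psi N z)
  C th0 e1 Delta F p z (Hrandom N N0) N2 p0 delta_gt0 gamma_gt0 c0 MN psiz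
  (conj zE zI) C0 th00 th01 ctl' e10 e1c e1s Lt HNb' HNc' w pi mu wa.
have psi0 := psi_gt0 N0 delta_gt0 MN psiz.
set r := N%:R `^ eps * Psi N z ^+ (D + #|F|).
have r0 : 0 < r by rewrite mulr_gt0 ?powR_gt0 ?exprn_gt0.
have q0 : (0 < q)%N by [].
apply: (le_trans (average_tail (HH := Hrandom N N0) eta0 q0 r0 EB)).
rewrite lee_fin -/p -/K -/D.
set b := (Psi N z ^+ (D + #|F|)) ^+ p; have b0 : 0 < b by rewrite !exprn_gt0.
have -> : (r / 2) ^+ p = N%:R `^ (eps * p%:R) * b / 2 ^+ p.
  by rewrite /r /b expr_div_n exprMn powRrM powR_mulrn ?powR_ge0.
set A := N%:R `^ (eps * p%:R); have A0 : 0 < A by exact: powR_gt0.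
rewrite (_ : _ / _ = (2 * K * 2 ^+ p) * N%:R / A); last first.
  by field; rewrite !gt_eqF ?exprn_gt0.
rewrite ler_pdivrMr// -powRD; last by rewrite (gt_eqF NR0) implybT.
apply: (@le_trans _ _ (N%:R `^ 2)).
  rewrite powR_mulrn ?(ltW NR0)// expr2.
  by rewrite ler_wpM2r ?(ltW NR0).
by rewrite ler_powR ?ler1n//; lra.
Qed.
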